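(* Let $x_1,x_2$ be two distinct points of $\mathbb{S}^2$. For all $i\geq 2$, $\Gamma_i(B_2(\mathbb{S}^2\setminus\{x_1,x_2\}))\cong\Gamma_i(\mathbb{Z}_2\ast\mathbb{Z})$, and $$\Gamma_i(B_2(\mathbb{S}^2\setminus\{x_1,x_2\}))/\Gamma_{i+1}(B_2(\mathbb{S}^2\setminus\{x_1,x_2\}))\cong\Gamma_i(\mathbb{Z}_2\ast\mathbb{Z})/\Gamma_{i+1}(\mathbb{Z}_2\ast\mathbb{Z})\cong\underbrace{\mathbb{Z}_2\oplus\cdots\oplus\mathbb{Z}_2}_{R_i\text{ times}},$$ where $$R_i=\sum_{j=0}^{i-2}\left(\sum_{\substack{k\mid i-j\\ k>1}}\mu\left(\frac{i-j}{k}\right)\frac{k\alpha_k}{i-j}\right),$$ $\mu$ is the Möbius function, and $$\alpha_k=\frac{1}{k}\left(\mathrm{Tr}\begin{pmatrix}0&-1\\-1&1\end{pmatrix}^k-1\right).$$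
   Context: For a surface $M$, $F_m(M)=\{(y_1,\ldots,y_m)\in M^m: y_i\neq y_j\text{ if }i\neq j\}$, and $B_m(M)=\pi_1(F_m(M)/S_m)$ is the $m$-string braid group of $M$. Lower central series: $\Gamma_1(G)=G$, $\Gamma_{i+1}(G)=[G,\Gamma_i(G)]$. $\mathbb{Z}_2$ is the cyclic group of order $2$ and $\ast$ denotes free product. In the definition of $\alpha_k$, $\mathrm{Tr}$ is the trace of the $k$th power of the matrix. *)

(* Defs.v *)
From HB Require Import structures.
From mathcomp Require Import all_boot all_order all_fingroup all_algebra.
From mathcomp Require Import generic_quotient.
From mathcomp Require Import all_classical all_reals all_analysis.
From mathcomp Require Import homotopy.
From mathcomp Require Import lra.
Import numFieldNormedType.Exports.

Set Implicit Arguments.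
Unset Strict Implicit.
Unset Printing Implicit Defensive.

Import Order.TTheory GRing.Theory Num.Theory.

Local Open Scope classical_set_scope.
Local Open Scope ring_scope.
Local Open Scope quotient_scope.

Section UnitInterval.
Variable R : realType.

Definition unit_interval : Type := set_type (`[0%R, 1%R]%classic : set R).
HB.instance Definition _ :=
  Topological.copy unit_interval (set_type (`[0%R, 1%R]%classic : set R)).

(* clamp extends the identity of [0, 1] to R, so that paths can be evaluated
   at to01 of an arbitrary real expression. *)
Definition clamp (t : R) : R := Num.max 0 (Num.min 1 t).

Lemma clamp_in (t : R) : clamp t \in (`[0%R, 1%R]%classic : set R).
Proof.
apply/mem_set; rewrite /= in_itv /= /clamp le_max lexx /= ge_max ler01 /=.
by rewrite ge_min lexx.
Qed.

Definition to01 (t : R) : unit_interval := exist _ (clamp t) (clamp_in t).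
Definition of01 (t : unit_interval) : R := sval t.

Lemma of01K : cancel of01 to01.
Proof.
move=> [t ht]; apply: val_inj => /=; move: (set_mem ht).
rewrite /= in_itv /= /clamp => /andP[t0 t1].
by rewrite (min_idPr t1) (max_idPr t0).
Qed.

Lemma to01K (t : R) : 0 <= t <= 1 -> of01 (to01 t) = t.
Proof.
move=> /andP[t0 t1]; rewrite /= /clamp.
by rewrite (min_idPr t1) (max_idPr t0).
Qed.

Lemma of01_ge0 t : 0 <= of01 t.
Proof. by case: t => t /= /set_mem; rewrite /= in_itv /= => /andP[]. Qed.

Lemma of01_le1 t : of01 t <= 1.
Proof. by case: t => t /= /set_mem; rewrite /= in_itv /= => /andP[]. Qed.

Lemma to01_le0 (t : R) : t <= 0 -> to01 t = to01 0.
Proof.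
move=> t0; apply: val_inj; rewrite /= /clamp (min_idPr (le_trans t0 ler01)).
by rewrite (min_idPr ler01) (max_idPl t0) maxxx.
Qed.

Lemma to01_ge1 (t : R) : 1 <= t -> to01 t = to01 1.
Proof.
by move=> t1; apply: val_inj; rewrite /= /clamp (min_idPl t1) minxx.
Qed.

Lemma of01_continuous : continuous of01.
Proof. exact: initial_continuous. Qed.

Lemma clamp_continuous : continuous clamp.
Proof.
rewrite -[clamp]/((cst 0) \max ((cst 1) \min id)).
apply: max_fun_continuous; first exact: cst_continuous.
by apply: min_fun_continuous; [exact: cst_continuous|move=> ?].
Qed.

Lemma to01_continuous : continuous to01.
Proof.
apply/continuousP => A [B oB <-].
rewrite [X in open X](_ : _ = clamp @^-1` B) //.
by move: B oB; apply/continuousP/clamp_continuous.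
Qed.

Lemma to01_neq : to01 0 != to01 1.
Proof.
apply/eqP => /(congr1 of01).
by rewrite !to01K ?lexx ?ler01//; apply/eqP; rewrite eq_sym oner_eq0.
Qed.

HB.instance Definition _ := isBiPointed.Build unit_interval to01_neq.

Lemma of01_zero : of01 zero = 0.
Proof. by rewrite to01K// lexx ler01. Qed.
Lemma of01_one : of01 one = 1.
Proof. by rewrite to01K// lexx ler01. Qed.

End UnitInterval.
Arguments to01 : simpl never.
Arguments of01 : simpl never.

Section Pasting.
Variables (R : realType) (X T : topologicalType).

Lemma paste_continuous (u : X -> R) (a : R) (f g : X -> T) :
  continuous u -> continuous f -> continuous g ->
  (forall x, u x = a -> f x = g x) ->
  continuous (fun x => if u x <= a then f x else g x).
Proof.
move=> cu cf cg fg; set h := fun x => _.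
have c1 : closed [set x | u x <= a].
  by apply: (preimage_closed _ (@closed_le _ a)) => y _; exact: cu.
have c2 : closed [set x | a <= u x].
  by apply: (preimage_closed _ (@closed_ge _ a)) => y _; exact: cu.
apply/continuous_subspace_setT.
have -> : [set: X] = [set x | u x <= a] `|` [set x | a <= u x].
  by apply/seteqP; split=> x //= _; apply/orP; exact: le_total.
apply: withinU_continuous => //.
- apply: (@subspace_eq_continuous _ _ _ f); last exact: continuous_subspaceT.
  by move=> x; rewrite inE /= /from_subspace /h => ->.
- apply: (@subspace_eq_continuous _ _ _ g); last exact: continuous_subspaceT.
  move=> x; rewrite inE /= /from_subspace /h => ux.
  by case: ifPn => // ux'; rewrite fg//; apply/eqP; rewrite eq_le ux ux'.
Qed.

End Pasting.

Section FundamentalGroup.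
Variables (R : realType) (T : topologicalType) (x : T).
Local Notation I := (unit_interval R).

Definition loop : Type := {path I from x to x in T}.
HB.instance Definition _ := Choice.on loop.

(* Homotopy relative to the endpoints; the first coordinate is the homotopy
   parameter. *)
Definition loop_homotopic (p q : loop) : Prop :=
  exists H : I * I -> T,
    [/\ continuous H,
        forall t, H (zero, t) = p t,
        forall t, H (one, t) = q t,
        forall s, H (s, zero) = x &
        forall s, H (s, one) = x].

Definition concat (p q : I -> T) (t : I) : T :=
  if of01 t <= 2^-1 then p (to01 (2 * of01 t)) else q (to01 (2 * of01 t - 1)).

Lemma to01_comp_continuous (X : topologicalType) (f : X -> R) :
  continuous f -> continuous (fun t => to01 (f t)).
Proof.
by move=> cf t; apply: (@continuous_comp _ _ _ f); [exact: cf|exact: to01_continuous].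
Qed.

Lemma affine_continuous (X : topologicalType) (f : X -> R) (a b : R) :
  continuous f -> continuous (fun t => a * f t + b).
Proof.
move=> cf t; apply: (@cvgD _ R^o); last exact: cvg_cst.
by apply: (@cvgM R^o); [exact: cvg_cst|exact: cf].
Qed.

Lemma scale_continuous (X : topologicalType) (f : X -> R) (a : R) :
  continuous f -> continuous (fun t => a * f t).
Proof. by move=> cf t; apply: (@cvgM R^o); [exact: cvg_cst|exact: cf]. Qed.

Lemma compl_continuous (X : topologicalType) (f : X -> R) :
  continuous f -> continuous (fun t => 1 - f t).
Proof. by move=> cf t; apply: (@cvgB _ R^o); [exact: cvg_cst|exact: cf]. Qed.

Lemma concat_cts (X : topologicalType) (u : X -> R) (f g : X -> R -> T) :
  continuous u ->
  (forall v : X -> R, continuous v -> continuous (fun y => f y (v y))) ->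
  (forall v : X -> R, continuous v -> continuous (fun y => g y (v y))) ->
  (forall y, f y 1 = g y 0) ->
  continuous (fun y => if u y <= 2^-1 then f y (2 * u y) else g y (2 * u y - 1)).
Proof.
move=> cu cf cg fg; apply: paste_continuous => //.
- by apply: cf; exact: scale_continuous.
- by apply: cg; exact: affine_continuous.
- by move=> y ->; rewrite mulfV ?pnatr_eq0// subrr.
Qed.

Section LoopOps.
Variables p q : loop.

Lemma loop_cts_comp (r : loop) (X : topologicalType) (v : X -> R) :
  continuous v -> continuous (fun y => r (to01 (v y))).
Proof.
move=> cv y; apply: (@continuous_comp _ _ _ (fun y => to01 (v y)) r).
  exact: to01_comp_continuous.
exact: cts_fun.
Qed.

Lemma concat_loop_cts : continuous (concat p q).
Proof.
apply: (@concat_cts I _ (fun _ r => p (to01 r)) (fun _ r => q (to01 r))).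
- exact: of01_continuous.
- by move=> v; exact: loop_cts_comp.
- by move=> v; exact: loop_cts_comp.
- by move=> _; rewrite [LHS]path_one [RHS]path_zero.
Qed.

Lemma concat_loop_zero : concat p q zero = x.
Proof.
by rewrite /concat of01_zero invr_ge0 ler0n mulr0 [LHS]path_zero.
Qed.

Lemma concat_loop_one : concat p q one = x.
Proof.
rewrite /concat of01_one ifF; last by apply/negbTE; rewrite -ltNge; lra.
by rewrite (_ : 2 * 1 - 1 = 1 :> R) ?[LHS]path_one//; lra.
Qed.

Definition loop_mul : loop :=
  mk_path concat_loop_cts concat_loop_zero concat_loop_one.

Lemma rev_loop_cts : continuous (fun t : I => p (to01 (1 - of01 t))).
Proof.
apply: loop_cts_comp; by apply: compl_continuous; exact: of01_continuous.
Qed.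

Lemma rev_loop_zero : p (to01 (1 - of01 (zero : I))) = x.
Proof. by rewrite of01_zero subr0 [LHS]path_one. Qed.

Lemma rev_loop_one : p (to01 (1 - of01 (one : I))) = x.
Proof. by rewrite of01_one subrr [LHS]path_zero. Qed.

Definition loop_inv : loop := mk_path rev_loop_cts rev_loop_zero rev_loop_one.

End LoopOps.

Definition loop_one : loop := [the loop of cst x].

Lemma loopP (p q : loop) : p =1 q -> p = q.
Proof. by move/path_eqP. Qed.

(* Two reparametrizations of a loop by maps agreeing at both ends are
   homotopic, through the affine homotopy between the reparametrizations. *)
Lemma reparam_homotopic (p a b : loop) (f g : R -> R) :
  continuous f -> continuous g -> f 0 = g 0 -> f 1 = g 1 ->
  (forall t, a t = p (to01 (f (of01 t)))) ->
  (forall t, b t = p (to01 (g (of01 t)))) ->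
  loop_homotopic a b.
Proof.
move=> cf cg f0 f1 ae be.
pose h (st : I * I) : R :=
  f (of01 st.2) + of01 st.1 * (g (of01 st.2) - f (of01 st.2)).
have ch : continuous h.
  have c1 : continuous (fun st : I * I => of01 st.1).
    move=> st; apply: (@continuous_comp _ _ _ fst); first exact: cvg_fst.
    exact: of01_continuous.
  have c2 (k : R -> R) : continuous k ->
      continuous (fun st : I * I => k (of01 st.2)).
    move=> ck st; apply: (@continuous_comp _ _ _ (fun st : I * I => of01 st.2)).
      apply: (@continuous_comp _ _ _ snd); first exact: cvg_snd.
      exact: of01_continuous.
    exact: ck.
  move=> st; apply: (@cvgD _ R^o); first exact: c2.
  apply: (@cvgM R^o); first exact: c1.
  by apply: (@cvgB _ R^o); exact: c2.
exists (fun st => p (to01 (h st))); split.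
- exact: loop_cts_comp.
- by move=> t; rewrite ae /h /= of01_zero mul0r addr0.
- by move=> t; rewrite be /h /= of01_one mul1r addrC subrK.
- move=> s; rewrite /h /= of01_zero f0 subrr mulr0 addr0 -f0.
  by rewrite -[X in f X]of01_zero -ae path_zero.
- move=> s; rewrite /h /= of01_one f1 subrr mulr0 addr0 -f1.
  by rewrite -[X in f X]of01_one -ae path_one.
Qed.

Lemma loop_homotopic_refl p : loop_homotopic p p.
Proof.
have ci : continuous (id : R -> R) by move=> ?.
by apply: (reparam_homotopic (p := p) ci ci) => // t; rewrite of01K.
Qed.

Lemma homotopy_cts_comp (H : I * I -> T) (X : topologicalType) (u v : X -> R) :
  continuous H -> continuous u -> continuous v ->
  continuous (fun y => H (to01 (u y), to01 (v y))).
Proof.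
move=> cH cu cv y.
apply: (@continuous_comp _ _ _ (fun y => (to01 (u y), to01 (v y))) H).
  move=> A [[P Q] /= [hP hQ] sPQ].
  have hu : nbhs y [set z | P (to01 (u z))] := to01_comp_continuous cu hP.
  have hv : nbhs y [set z | Q (to01 (v z))] := to01_comp_continuous cv hQ.
  apply: filterS (filterI hu hv) => z [Pz Qz].
  exact: (sPQ (_, _)).
exact: cH.
Qed.

Lemma of01_fst_continuous : continuous (fun st : I * I => of01 st.1).
Proof.
move=> st; apply: (@continuous_comp _ _ _ fst); first exact: cvg_fst.
exact: of01_continuous.
Qed.

Lemma of01_snd_continuous : continuous (fun st : I * I => of01 st.2).
Proof.
move=> st; apply: (@continuous_comp _ _ _ snd); first exact: cvg_snd.
exact: of01_continuous.
Qed.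

Lemma loop_homotopic_sym p q : loop_homotopic p q -> loop_homotopic q p.
Proof.
move=> [H [cH H0 H1 Hz Ho]].
exists (fun st => H (to01 (1 - of01 st.1), to01 (of01 st.2))); split => /=.
- apply: homotopy_cts_comp => //; last exact: of01_snd_continuous.
  by apply: compl_continuous; exact: of01_fst_continuous.
- by move=> t; rewrite of01_zero subr0 of01K H1.
- by move=> t; rewrite of01_one subrr of01K H0.
- by move=> s; rewrite of01K Hz.
- by move=> s; rewrite of01K Ho.
Qed.

Lemma loop_homotopic_trans p q r :
  loop_homotopic p q -> loop_homotopic q r -> loop_homotopic p r.
Proof.
move=> [H [cH H0 H1 Hz Ho]] [K [cK K0 K1 Kz Ko]].
exists (fun st => if of01 st.1 <= 2^-1
                  then H (to01 (2 * of01 st.1), to01 (of01 st.2))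
                  else K (to01 (2 * of01 st.1 - 1), to01 (of01 st.2))).
have half0 : (2^-1 >= 0 :> R) by rewrite invr_ge0.
have half1 : ((1 : R) <= 2^-1) = false.
  by apply/negbTE; rewrite -ltNge; lra.
split=> /=.
- apply: (@concat_cts _ _ (fun st a => H (to01 a, to01 (of01 st.2)))
                          (fun st a => K (to01 a, to01 (of01 st.2)))).
  + exact: of01_fst_continuous.
  + by move=> v cv; apply: homotopy_cts_comp => //; exact: of01_snd_continuous.
  + by move=> v cv; apply: homotopy_cts_comp => //; exact: of01_snd_continuous.
  + by move=> st; rewrite [LHS]H1 [RHS]K0.
- by move=> t; rewrite of01_zero half0 mulr0 of01K H0.
- move=> t; rewrite of01_one half1 of01K (_ : 2 * 1 - 1 = 1 :> R) ?K1//.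
  by lra.
- by move=> s; rewrite of01K Hz Kz if_same.
- by move=> s; rewrite of01K Ho Ko if_same.
Qed.

Lemma loop_mul_homotopic p p' q q' :
  loop_homotopic p p' -> loop_homotopic q q' ->
  loop_homotopic (loop_mul p q) (loop_mul p' q').
Proof.
move=> [H [cH H0 H1 Hz Ho]] [K [cK K0 K1 Kz Ko]].
exists (fun st => if of01 st.2 <= 2^-1
                  then H (to01 (of01 st.1), to01 (2 * of01 st.2))
                  else K (to01 (of01 st.1), to01 (2 * of01 st.2 - 1))).
have half0 : (2^-1 >= 0 :> R) by rewrite invr_ge0.
have half1 : ((1 : R) <= 2^-1) = false.
  by apply/negbTE; rewrite -ltNge; lra.
split=> /=.
- apply: (@concat_cts _ _ (fun st a => H (to01 (of01 st.1), to01 a))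
                          (fun st a => K (to01 (of01 st.1), to01 a))).
  + exact: of01_snd_continuous.
  + by move=> v cv; apply: homotopy_cts_comp => //; exact: of01_fst_continuous.
  + by move=> v cv; apply: homotopy_cts_comp => //; exact: of01_fst_continuous.
  + by move=> st; rewrite [LHS]Ho [RHS]Kz.
- by move=> t; rewrite of01K H0 K0.
- by move=> t; rewrite of01K H1 K1.
- by move=> s; rewrite of01_zero half0 mulr0 [LHS]Hz.
- move=> s; rewrite of01_one half1 of01K (_ : 2 * 1 - 1 = 1 :> R) ?[LHS]Ko//.
  by lra.
Qed.

Lemma loop_inv_homotopic p p' :
  loop_homotopic p p' -> loop_homotopic (loop_inv p) (loop_inv p').
Proof.
move=> [H [cH H0 H1 Hz Ho]].
exists (fun st => H (to01 (of01 st.1), to01 (1 - of01 st.2))); split => /=.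
- apply: homotopy_cts_comp => //; first exact: of01_fst_continuous.
  by apply: compl_continuous; exact: of01_snd_continuous.
- by move=> t; rewrite of01K H0.
- by move=> t; rewrite of01K H1.
- by move=> s; rewrite of01_zero subr0 of01K [LHS]Ho.
- by move=> s; rewrite of01_one subrr of01K [LHS]Hz.
Qed.

Lemma loop_mulA p q r :
  loop_homotopic (loop_mul p (loop_mul q r)) (loop_mul (loop_mul p q) r).
Proof.
apply: loop_homotopic_sym.
have ci : continuous (id : R -> R) by move=> ?.
pose f (t : R) := Num.min (2 * t) (Num.min (t + 4^-1) (2^-1 * t + 2^-1)).
apply: (reparam_homotopic (p := loop_mul p (loop_mul q r)) (f := f) (g := id)
  _ ci) => //.
- rewrite -[f]/((fun t => 2 * t) \min
    ((fun t => t + 4^-1) \min (fun t => 2^-1 * t + 2^-1))).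
  apply: min_fun_continuous.
    by exact: scale_continuous.
  apply: min_fun_continuous; last exact: affine_continuous.
  under eq_fun do rewrite -[X in X + _]mul1r.
  exact: affine_continuous.
- rewrite /f /= mulr0 min_l// le_min; apply/andP; split; lra.
- by rewrite /f; rewrite !min_r; lra.
- move=> t; have t0 := of01_ge0 t; have t1 := of01_le1 t.
  set s := of01 t in t0 t1 *; rewrite /= /mk_path /concat -/s.
  rewrite /= /mk_path /concat.
  case: (leP s 4^-1) => s4.
    have -> : f s = 2 * s by rewrite /f min_l// le_min; apply/andP; split; lra.
    rewrite ifT; last by lra.
    have h : 2 * s <= 2^-1 by lra.
    by rewrite (to01K (t := 2 * s)) ?h//; lra.
  case: (lerP s 2^-1) => s2 /=.
    have -> : f s = s + 4^-1 by rewrite /f min_r ?min_l //; lra.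
    rewrite (to01K (t := 2 * s)); last by lra.
    rewrite (to01K (t := s + 4^-1)); last by lra.
    rewrite ifF; last by apply/negbTE; rewrite -ltNge; lra.
    rewrite ifF; last by apply/negbTE; rewrite -ltNge; lra.
    rewrite to01K; last by lra.
    rewrite ifT; last by lra.
    by congr (q (to01 _)); lra.
  have -> : f s = 2^-1 * s + 2^-1 by rewrite /f !min_r //; lra.
  rewrite (to01K (t := 2^-1 * s + 2^-1)); last by lra.
  rewrite ifF; last by apply/negbTE; rewrite -ltNge; lra.
  rewrite to01K; last by lra.
  rewrite ifF; last by apply/negbTE; rewrite -ltNge; lra.
  by congr (r (to01 _)); lra.
- by move=> t; rewrite of01K.
Qed.

Lemma loop_mul1l p : loop_homotopic (loop_mul loop_one p) p.
Proof.
have ci : continuous (id : R -> R) by move=> ?.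
apply: (reparam_homotopic (p := p) (f := (fun t => Num.max 0 (2 * t - 1))) (g := id)
  _ ci) => //.
- rewrite -[X in continuous X]/((cst 0) \max (fun t => 2 * t - 1)).
  apply: max_fun_continuous; first exact: cst_continuous.
  exact: affine_continuous.
- by rewrite max_l//; lra.
- by rewrite max_r; lra.
- move=> t; rewrite /= /mk_path /concat; case: leP => h.
    by rewrite max_l; [rewrite [RHS]path_zero|lra].
  by rewrite max_r//; lra.
- by move=> t; rewrite of01K.
Qed.

Lemma loop_mul1r p : loop_homotopic (loop_mul p loop_one) p.
Proof.
have ci : continuous (id : R -> R) by move=> ?.
apply: (reparam_homotopic (p := p) (f := (fun t => Num.min 1 (2 * t))) (g := id)
  _ ci) => //.
- rewrite -[X in continuous X]/((cst 1) \min (fun t => 2 * t)).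
  apply: min_fun_continuous; first exact: cst_continuous.
  exact: scale_continuous.
- by rewrite min_r//; lra.
- by rewrite min_l; lra.
- move=> t; rewrite /= /mk_path /concat; case: leP => h.
    by rewrite min_r//; lra.
  by rewrite min_l; [rewrite [RHS]path_one|lra].
- by move=> t; rewrite of01K.
Qed.

Lemma loop_mulVl p : loop_homotopic (loop_mul (loop_inv p) p) loop_one.
Proof.
have ci : continuous (id : R -> R) by move=> ?.
apply: (reparam_homotopic (p := p) (f := (fun t => `|2 * t - 1|)) (g := (cst 1))).
- move=> t; apply: (@continuous_comp _ _ _ (fun t : R => 2 * t - 1)).
    exact: affine_continuous.
  exact: (@norm_continuous R R^o).
- exact: cst_continuous.
- by rewrite /= mulr0 sub0r normrN1.
- by rewrite /= ger0_norm; lra.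
- move=> t; have t0 := of01_ge0 t; have t1 := of01_le1 t.
  rewrite /= /mk_path /concat; case: leP => h.
    rewrite to01K; last by lra.
    by congr (p (to01 _)); rewrite ler0_norm; lra.
  by congr (p (to01 _)); rewrite ger0_norm; lra.
- by move=> t; rewrite [RHS]path_one.
Qed.

Lemma loop_mulVr p : loop_homotopic (loop_mul p (loop_inv p)) loop_one.
Proof.
have -> : p = loop_inv (loop_inv p).
  apply: loopP => t; have t0 := of01_ge0 t; have t1 := of01_le1 t.
  rewrite /= /mk_path to01K; last by lra.
  by rewrite opprB addrC subrK of01K.
have -> : loop_inv (loop_inv (loop_inv p)) = loop_inv p.
  apply: loopP => t; have t0 := of01_ge0 t; have t1 := of01_le1 t.
  rewrite /= /mk_path; congr (p (to01 _)).
  by rewrite !to01K; lra.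
exact: loop_mulVl.
Qed.

Definition loop_homotopicb (p q : loop) : bool := `[< loop_homotopic p q >].

Lemma loop_homotopicb_refl : reflexive loop_homotopicb.
Proof. by move=> p; apply/asboolP; exact: loop_homotopic_refl. Qed.

Lemma loop_homotopicb_sym : symmetric loop_homotopicb.
Proof.
by move=> p q; apply/asbool_equiv_eq; split; exact: loop_homotopic_sym.
Qed.

Lemma loop_homotopicb_trans : transitive loop_homotopicb.
Proof.
move=> q p r /asboolP pq /asboolP qr; apply/asboolP.
exact: loop_homotopic_trans qr.
Qed.

Canonical loop_homotopy := EquivRel loop_homotopicb
  loop_homotopicb_refl loop_homotopicb_sym loop_homotopicb_trans.

(* The group law is [p][q] = [p followed by q]. *)
Definition pi1 : Type := {eq_quot loop_homotopy}.
HB.instance Definition _ := Choice.on pi1.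
HB.instance Definition _ := EqQuotient.on pi1.

Definition pi1_mul (a b : pi1) : pi1 := \pi_pi1 (loop_mul (repr a) (repr b)).
Definition pi1_one : pi1 := \pi_pi1 loop_one.
Definition pi1_inv (a : pi1) : pi1 := \pi_pi1 (loop_inv (repr a)).

Lemma pi1_eqP (p q : loop) : \pi_pi1 p = \pi_pi1 q <-> loop_homotopic p q.
Proof.
by split=> [/eqmodP/asboolP|h] //; apply/eqmodP/asboolP.
Qed.

Lemma repr_pi1 (p : loop) : loop_homotopic (repr (\pi_pi1 p)) p.
Proof. by apply/pi1_eqP; rewrite reprK. Qed.

Lemma pi1_mulE (p q : loop) :
  pi1_mul (\pi_pi1 p) (\pi_pi1 q) = \pi_pi1 (loop_mul p q).
Proof. by apply/pi1_eqP; apply: loop_mul_homotopic; exact: repr_pi1. Qed.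

Lemma pi1_invE (p : loop) : pi1_inv (\pi_pi1 p) = \pi_pi1 (loop_inv p).
Proof. by apply/pi1_eqP; apply: loop_inv_homotopic; exact: repr_pi1. Qed.

Lemma pi1_mulA : associative pi1_mul.
Proof.
elim/quotW => p; elim/quotW => q; elim/quotW => r.
rewrite (pi1_mulE q r) (pi1_mulE p q) !pi1_mulE.
by apply/pi1_eqP; exact: loop_mulA.
Qed.

Lemma pi1_mul1 : left_id pi1_one pi1_mul.
Proof. elim/quotW => p; rewrite pi1_mulE; by apply/pi1_eqP; exact: loop_mul1l. Qed.

Lemma pi1_mulr1 : right_id pi1_one pi1_mul.
Proof. elim/quotW => p; rewrite pi1_mulE; by apply/pi1_eqP; exact: loop_mul1r. Qed.

Lemma pi1_mulV : left_inverse pi1_one pi1_inv pi1_mul.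
Proof.
elim/quotW => p; rewrite pi1_invE pi1_mulE; by apply/pi1_eqP; exact: loop_mulVl.
Qed.

Lemma pi1_mulrV : right_inverse pi1_one pi1_inv pi1_mul.
Proof.
elim/quotW => p; rewrite pi1_invE pi1_mulE; by apply/pi1_eqP; exact: loop_mulVr.
Qed.

HB.instance Definition _ := isGroup.Build pi1
  pi1_mulA pi1_mul1 pi1_mulr1 pi1_mulV pi1_mulrV.

End FundamentalGroup.

Section Subgroups.
Local Open Scope group_scope.
Variable G : groupType.

Definition is_subgroup (A : set G) : Prop :=
  A 1 /\ forall x y, A x -> A y -> A (x * y^-1).

Record subgroup := Subgroup {
  subgroup_set :> G -> Prop;
  subgroup_prop : is_subgroup subgroup_set }.

Lemma subgroup_closed (H : subgroup) :
  group_closed (fun x => x \in (H : set G)).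
Proof.
split=> [|x y]; rewrite !unfold_in; first exact/mem_set/(subgroup_prop H).1.
by move=> /set_mem Hx /set_mem Hy; exact/mem_set/(subgroup_prop H).2.
Qed.

Definition subgroup_type (H : subgroup) : Type := set_type (H : set G).
HB.instance Definition _ (H : subgroup) :=
  SubChoice.copy (subgroup_type H) (set_type (H : set G)).
HB.instance Definition _ (H : subgroup) :=
  SubChoice_isSubGroup.Build G (fun x => x \in (H : set G))
    (subgroup_type H) (subgroup_closed H).

Definition generated (A : set G) : set G := smallest is_subgroup A.

Lemma generated_subgroup (A : set G) : is_subgroup (generated A).
Proof.
split=> [B [[B1 _] _]|x y xA yA B hB] //.
by case: (hB) => -[_ BV] _; apply: BV; [exact: xA|exact: yA].
Qed.

(* Indexing starts at Gamma_1 = G; the value G at index 0 is a dummy.  With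
   [~ x, y] = x^-1 y^-1 x y the subgroups generated by commutators are the same
   as with x y x^-1 y^-1. *)
Fixpoint Gamma_set (i : nat) : set G :=
  match i with
  | j.+1 =>
      if j is _.+1 then
        generated [set z | exists x y, Gamma_set j y /\ z = [~ x, y]]
      else setT
  | 0 => setT
  end.

Lemma Gamma_subgroup (i : nat) : is_subgroup (Gamma_set i).
Proof. by case: i => [|[|i]]; [split..|exact: generated_subgroup]. Qed.

Definition Gamma (i : nat) : subgroup := Subgroup (Gamma_subgroup i).

Record normal_subgroup := NormalSubgroup {
  normal_sub :> subgroup;
  normal_prop : forall x g, normal_sub x -> normal_sub (x ^ g) }.

Section Quotient.
Variable N : normal_subgroup.

Lemma nsub1 : N 1.
Proof. by case: (subgroup_prop N). Qed.

Lemma nsubF x y : N x -> N y -> N (x * y^-1).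
Proof. by case: (subgroup_prop N) => _; exact. Qed.

Lemma nsubV x : N x -> N x^-1.
Proof. by move=> Nx; rewrite -[x^-1]mul1g; apply: nsubF => //; exact: nsub1. Qed.

Lemma nsubM x y : N x -> N y -> N (x * y).
Proof. by move=> Nx Ny; rewrite -[y]invgK; apply: nsubF => //; exact: nsubV. Qed.

Definition same_coset (x y : G) : bool := `[< N (x^-1 * y) >].

Lemma same_coset_refl : reflexive same_coset.
Proof. by move=> x; apply/asboolP; rewrite mulVg; exact: nsub1. Qed.

Lemma same_coset_sym : symmetric same_coset.
Proof.
by move=> x y; apply/asbool_equiv_eq; split=> /nsubV; rewrite invgM invgK.
Qed.

Lemma same_coset_trans : transitive same_coset.
Proof.
move=> y x z /asboolP xy /asboolP yz; apply/asboolP.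
by have := nsubM xy yz; rewrite -mulgA mulVKg.
Qed.

Canonical coset_equiv :=
  EquivRel same_coset same_coset_refl same_coset_sym same_coset_trans.

Definition quotient_group : Type := {eq_quot coset_equiv}.
HB.instance Definition _ := Choice.on quotient_group.
HB.instance Definition _ := EqQuotient.on quotient_group.

Definition quot_mul (a b : quotient_group) : quotient_group :=
  \pi_quotient_group (repr a * repr b).
Definition quot_one : quotient_group := \pi_quotient_group 1.
Definition quot_inv (a : quotient_group) : quotient_group :=
  \pi_quotient_group (repr a)^-1.

Lemma quot_eqP (x y : G) :
  \pi_quotient_group x = \pi_quotient_group y <-> N (x^-1 * y).
Proof. by split=> [/eqmodP/asboolP|h] //; apply/eqmodP/asboolP. Qed.

Lemma repr_quot (x : G) : N ((repr (\pi_quotient_group x))^-1 * x).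
Proof. by apply/quot_eqP; rewrite reprK. Qed.

Lemma quot_mulE (x y : G) :
  quot_mul (\pi_quotient_group x) (\pi_quotient_group y) =
  \pi_quotient_group (x * y).
Proof.
apply/quot_eqP; set x' := repr _; set y' := repr _.
have -> : (x' * y')^-1 * (x * y) = (x'^-1 * x) ^ y' * (y'^-1 * y).
  by rewrite invgM /conjg -!mulgA mulVKg.
apply: nsubM; last exact: repr_quot.
by apply: normal_prop; exact: repr_quot.
Qed.

Lemma quot_invE (x : G) :
  quot_inv (\pi_quotient_group x) = \pi_quotient_group x^-1.
Proof.
apply/quot_eqP; set x' := repr _; rewrite invgK.
have -> : x' * x^-1 = ((x'^-1 * x) ^ x'^-1)^-1.
  by rewrite /conjg invgK -mulgA mulVKg invgM invgK.
by apply: nsubV; apply: normal_prop; exact: repr_quot.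
Qed.

Lemma quot_mulA : associative quot_mul.
Proof.
elim/quotW => x; elim/quotW => y; elim/quotW => z.
by rewrite (quot_mulE y z) (quot_mulE x y) !quot_mulE mulgA.
Qed.

Lemma quot_mul1 : left_id quot_one quot_mul.
Proof. by elim/quotW => x; rewrite quot_mulE mul1g. Qed.

Lemma quot_mulr1 : right_id quot_one quot_mul.
Proof. by elim/quotW => x; rewrite quot_mulE mulg1. Qed.

Lemma quot_mulV : left_inverse quot_one quot_inv quot_mul.
Proof. by elim/quotW => x; rewrite quot_invE quot_mulE mulVg. Qed.

Lemma quot_mulrV : right_inverse quot_one quot_inv quot_mul.
Proof. by elim/quotW => x; rewrite quot_invE quot_mulE mulgV. Qed.

HB.instance Definition _ := isGroup.Build quotient_group
  quot_mulA quot_mul1 quot_mulr1 quot_mulV quot_mulrV.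

End Quotient.

Lemma generated_conj (A : set G) :
  (forall x g, A x -> A (x ^ g)) ->
  forall x g, generated A x -> generated A (x ^ g).
Proof.
move=> AJ x g; move: x; apply: smallest_sub; last first.
  by move=> x Ax; apply: sub_gen_smallest; exact: AJ.
case: (generated_subgroup A) => g1 gF; split=> [|x y] /=; first by rewrite conj1g.
by rewrite conjMg conjVg; exact: gF.
Qed.

Lemma Gamma_conj (i : nat) x g : Gamma i x -> Gamma i (x ^ g).
Proof.
elim: i x g => [//|[//|i] IH] x g; apply: generated_conj => {}x {}g.
move=> [a [b [hb ->]]]; exists (a ^ g), (b ^ g); split; last by rewrite conjRg.
exact: IH.
Qed.

Lemma Gamma_anti (i : nat) : (Gamma i.+1 : set G) `<=` Gamma i.
Proof.
case: i => [//|i]; apply: smallest_sub; first exact: Gamma_subgroup.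
move=> _ [a [b [hb ->]]].
have -> : [~ a, b] = (b^-1) ^ a * b by rewrite /commg /conjg !mulgA.
have [h1 hF] := Gamma_subgroup i.+1.
have hV : Gamma i.+1 b^-1 by rewrite -[b^-1]mul1g; exact: hF.
by rewrite -[X in _ * X]invgK; apply: hF => //; exact: Gamma_conj.
Qed.

End Subgroups.

Section LowerCentralQuotient.
Local Open Scope group_scope.
Variables (G : groupType) (i : nat).

Definition Gamma_next_set : set (subgroup_type (Gamma G i)) :=
  [set x | Gamma G i.+1 (val x)].

Lemma Gamma_next_subgroup : is_subgroup Gamma_next_set.
Proof.
have [h1 hF] := subgroup_prop (Gamma G i.+1).
split=> [|x y hx hy]; rewrite /Gamma_next_set /= ?gmulf1 ?gmulfF //.
exact: hF.
Qed.

Lemma Gamma_next_normal (x g : subgroup_type (Gamma G i)) :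
  Gamma_next_set x -> Gamma_next_set (x ^ g).
Proof. exact: (@Gamma_conj G i.+1 (val x) (val g)). Qed.

(* The subgroup Gamma_{i+1}(G), viewed inside the group Gamma_i(G). *)
Definition Gamma_next : normal_subgroup (subgroup_type (Gamma G i)) :=
  @NormalSubgroup _ (Subgroup Gamma_next_subgroup) Gamma_next_normal.

Definition Gamma_quotient : groupType := quotient_group Gamma_next.

End LowerCentralQuotient.

Definition isomorphic (G H : groupType) : Prop :=
  exists f : {multiplicative G -> H}, bijective f.

Section FreeProduct.
Local Open Scope group_scope.
Variables G H : groupType.

(* The free product is the set of words in the letters of G and H, modulo
   erasing unit letters and multiplying adjacent letters of the same factor. *)
Definition fp_word := seq (G + H).
HB.instance Definition _ := Choice.on fp_word.

Inductive fp_eq : fp_word -> fp_word -> Prop :=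
| fp_refl u : fp_eq u u
| fp_sym u v : fp_eq u v -> fp_eq v u
| fp_trans u v w : fp_eq u v -> fp_eq v w -> fp_eq u w
| fp_onel u v : fp_eq (u ++ inl 1 :: v) (u ++ v)
| fp_oner u v : fp_eq (u ++ inr 1 :: v) (u ++ v)
| fp_mull u v a b : fp_eq (u ++ [:: inl a, inl b & v]) (u ++ inl (a * b) :: v)
| fp_mulr u v a b : fp_eq (u ++ [:: inr a, inr b & v]) (u ++ inr (a * b) :: v).

Definition fp_eqb (u v : fp_word) : bool := `[< fp_eq u v >].

Lemma fp_eqb_refl : reflexive fp_eqb.
Proof. by move=> u; apply/asboolP; exact: fp_refl. Qed.

Lemma fp_eqb_sym : symmetric fp_eqb.
Proof. by move=> u v; apply/asbool_equiv_eq; split; exact: fp_sym. Qed.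

Lemma fp_eqb_trans : transitive fp_eqb.
Proof.
by move=> v u w /asboolP uv /asboolP vw; apply/asboolP; exact: fp_trans vw.
Qed.

Canonical fp_equiv := EquivRel fp_eqb fp_eqb_refl fp_eqb_sym fp_eqb_trans.

Definition free_product : Type := {eq_quot fp_equiv}.
HB.instance Definition _ := Choice.on free_product.
HB.instance Definition _ := EqQuotient.on free_product.

Lemma fp_catl u v w : fp_eq v w -> fp_eq (u ++ v) (u ++ w).
Proof.
elim=> [a|a b _|a b c _ IH1 _|a b|a b|a b x y|a b x y]; rewrite ?catA.
- exact: fp_refl.
- exact: fp_sym.
- exact: fp_trans.
- exact: fp_onel.
- exact: fp_oner.
- exact: fp_mull.
- exact: fp_mulr.
Qed.

Lemma fp_catr u v w : fp_eq v w -> fp_eq (v ++ u) (w ++ u).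
Proof.
elim=> [a|a b _|a b c _ IH1 _|a b|a b|a b x y|a b x y]; rewrite -?catA.
- exact: fp_refl.
- exact: fp_sym.
- exact: fp_trans.
- exact: fp_onel.
- exact: fp_oner.
- exact: fp_mull.
- exact: fp_mulr.
Qed.

Definition letter_inv (x : G + H) : G + H :=
  match x with inl a => inl a^-1 | inr b => inr b^-1 end.

Definition word_inv (u : fp_word) : fp_word := rev (map letter_inv u).

Lemma word_inv_cat u v : word_inv (u ++ v) = word_inv v ++ word_inv u.
Proof. by rewrite /word_inv map_cat rev_cat. Qed.

Lemma word_inv_cons x u : word_inv (x :: u) = word_inv u ++ [:: letter_inv x].
Proof. by rewrite -cat1s word_inv_cat. Qed.

Lemma word_invK : involutive word_inv.
Proof.
move=> u; rewrite /word_inv map_rev revK -map_comp map_id_in//.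
by case=> a _ /=; rewrite invgK.
Qed.

Lemma word_inv_eq u v : fp_eq u v -> fp_eq (word_inv u) (word_inv v).
Proof.
elim=> [a|a b _|a b c _ IH1 _|a b|a b|a b x y|a b x y];
  rewrite ?word_inv_cat ?word_inv_cons -?catA /= ?invg1 ?invgM.
- exact: fp_refl.
- exact: fp_sym.
- exact: fp_trans.
- exact: fp_onel.
- exact: fp_oner.
- exact: fp_mull.
- exact: fp_mulr.
Qed.

Lemma word_mulV u : fp_eq (word_inv u ++ u) [::].
Proof.
elim: u => [|x u IH]; first exact: fp_refl.
rewrite word_inv_cons -catA /=; apply: fp_trans IH.
case: x => a /=.
  by apply: fp_trans (fp_mull _ _ _ _) _; rewrite mulVg; exact: fp_onel.
by apply: fp_trans (fp_mulr _ _ _ _) _; rewrite mulVg; exact: fp_oner.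
Qed.

Definition fp_mul (a b : free_product) : free_product :=
  \pi_free_product (repr a ++ repr b : fp_word).
Definition fp_one : free_product := \pi_free_product ([::] : fp_word).
Definition fp_inv (a : free_product) : free_product :=
  \pi_free_product (word_inv (repr a)).

Lemma fp_eqP (u v : fp_word) :
  \pi_free_product u = \pi_free_product v <-> fp_eq u v.
Proof. by split=> [/eqmodP/asboolP|h] //; apply/eqmodP/asboolP. Qed.

Lemma repr_fp (u : fp_word) : fp_eq (repr (\pi_free_product u)) u.
Proof. by apply/fp_eqP; rewrite reprK. Qed.

Lemma fp_mulE (u v : fp_word) :
  fp_mul (\pi_free_product u) (\pi_free_product v) =
  \pi_free_product (u ++ v : fp_word).
Proof.
apply/fp_eqP; apply: (@fp_trans _ (u ++ repr (\pi_free_product v))).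
  by apply: fp_catr; exact: repr_fp.
by apply: fp_catl; exact: repr_fp.
Qed.

Lemma fp_invE (u : fp_word) :
  fp_inv (\pi_free_product u) = \pi_free_product (word_inv u).
Proof. by apply/fp_eqP; apply: word_inv_eq; exact: repr_fp. Qed.

Lemma fp_mulA : associative fp_mul.
Proof.
elim/quotW => u; elim/quotW => v; elim/quotW => w.
by rewrite (fp_mulE v w) (fp_mulE u v) !fp_mulE catA.
Qed.

Lemma fp_mul1g : left_id fp_one fp_mul.
Proof. by elim/quotW => u; rewrite fp_mulE. Qed.

Lemma fp_mulg1 : right_id fp_one fp_mul.
Proof. by elim/quotW => u; rewrite fp_mulE cats0. Qed.

Lemma fp_mulVg : left_inverse fp_one fp_inv fp_mul.
Proof.
elim/quotW => u; rewrite fp_invE fp_mulE; apply/fp_eqP; exact: word_mulV.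
Qed.

Lemma fp_mulgV : right_inverse fp_one fp_inv fp_mul.
Proof.
elim/quotW => u; rewrite fp_invE fp_mulE; apply/fp_eqP.
by rewrite -{1}[u]word_invK; exact: word_mulV.
Qed.

HB.instance Definition _ := isGroup.Build free_product
  fp_mulA fp_mul1g fp_mulg1 fp_mulVg fp_mulgV.

End FreeProduct.

(* Multiplicative copies of the additive groups Z and Z/2. *)
Definition Z_group : groupType := Algebra.to_multiplicative int.
Definition Z2_group : groupType := Algebra.to_multiplicative 'Z_2.
Definition Z2_star_Z : groupType := free_product Z2_group Z_group.
Definition Z2_power (r : nat) : groupType := {ffun 'I_r -> Z2_group}.

Section BraidGroups.
Variable M : topologicalType.

(* {ptws 'I_m -> M} is M^m with the product topology; conf_space m, which is
   F_m(M), carries the subspace topology. *)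
Definition conf_space (m : nat) : topologicalType :=
  set_type [set y : {ptws 'I_m -> M} | forall i j, i != j -> y i <> y j].

Definition same_orbit (m : nat) (y z : conf_space m) : bool :=
  `[< exists s : {perm 'I_m}, forall i, sval z i = sval y (s i) >].

Lemma same_orbit_refl m : reflexive (@same_orbit m).
Proof. by move=> y; apply/asboolP; exists 1%g => i; rewrite perm1. Qed.

Lemma same_orbit_sym m : symmetric (@same_orbit m).
Proof.
move=> y z; apply/asbool_equiv_eq.
by split=> -[s hs]; exists (s^-1)%g => i; rewrite hs permKV.
Qed.

Lemma same_orbit_trans m : transitive (@same_orbit m).
Proof.
move=> z y w /asboolP[s hs] /asboolP[t ht]; apply/asboolP.
by exists (t * s)%g => i; rewrite ht hs permM.
Qed.

Canonical orbit_equiv m := EquivRel (@same_orbit m)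
  (@same_orbit_refl m) (@same_orbit_sym m) (@same_orbit_trans m).

(* F_m(M)/S_m with the quotient topology. *)
Definition uconf_space (m : nat) : topologicalType :=
  quotient_topology {eq_quot (orbit_equiv m)}.

Definition braid_group (R : realType) (m : nat) (b : uconf_space m) :
  groupType := pi1 R b.

End BraidGroups.
Arguments braid_group {M} R m b.

(* Sums of squares are used because the library norm on 'rV[R]_3 is the sup
   norm; both norms induce the same topology. *)
Definition sphere (R : realType) : set 'rV[R]_3 :=
  [set v | \sum_(j < 3) v 0 j ^+ 2 = 1].

Definition punctured_sphere (R : realType) (x1 x2 : 'rV[R]_3) :
  topologicalType := set_type (@sphere R `\` [set x1; x2]).

(* moebius 0 is a dummy value. *)
Definition moebius (n : nat) : int :=
  if all (fun p => logn p n == 1%N) (primes n) then (-1) ^+ size (primes n)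
  else 0.

Definition trace_mx : 'M[rat]_2 :=
  \matrix_(i < 2, j < 2) nth 0 (nth [::] [:: [:: 0; -1]; [:: -1; 1]] i) j.

Definition alpha (k : nat) : rat := k%:R^-1 * (\tr (trace_mx ^+ k) - 1).

(* A rational-valued formula; j ranges over 0, ..., i - 2. *)
Definition rank_R (i : nat) : rat :=
  \sum_(0 <= j < i.-1)
    \sum_(k <- divisors (i - j) | (1 < k)%N)
      (moebius ((i - j) %/ k))%:~R * (k%:R * alpha k / (i - j)%:R).

(* Main.v *)
Require Import Defs.
From HB Require Import structures.
From mathcomp Require Import all_boot all_order all_algebra.
From mathcomp Require Import generic_quotient complex.
From mathcomp Require Import all_classical all_reals all_analysis.
From mathcomp Require Import homotopy.
From mathcomp Require perm.
From mathcomp Require Import zify ring lra.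
Import numFieldNormedType.Exports.

Set Implicit Arguments.
Unset Strict Implicit.
Unset Printing Implicit Defensive.

Import Order.TTheory GRing.Theory Num.Theory.

Local Open Scope classical_set_scope.
Local Open Scope ring_scope.
Local Open Scope quotient_scope.


(** Topology. Stereographic projection from x1 and a translation identify the twice punctured sphere
    with the nonzero complex numbers, and Vieta's formulas turn an unordered pair of distinct points
    into its sum and product (s, p), with p != 0 and s^2 != 4 p ([conf_homeo]). The map (r, y) |->
    (r y, r^2), with r != 0 and y different from 2 and -2, is a double cover of that set with deck
    transformation (r, y) |-> (-r, -y). Hence its fundamental group B is generated by a half turn
    rho of r and a loop u of y around 2 ([sum_prod_generated]). Conjugation by rho exchanges u with
    the loop around -2 in both directions, so rho^2 is central. Transport of a locally defined
    cocycle gives a homomorphism f from B onto Z2 * Z = <a> * <t> with rho |-> a and u |-> t. The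
    quotient of B by rho^2 receives a map back from Z2 * Z, so the kernel of f lies in the group
    generated by rho^2. The winding number of p sends rho to 1 and kills Gamma_2, so f is injective
    on Gamma_2 ([sum_prod_group]). A surjection that is injective on Gamma_2 induces isomorphisms on
    Gamma_i and on Gamma_i / Gamma_{i+1} for i >= 2 ([Gamma_isomorphic],
    [Gamma_quotient_isomorphic]).

    Algebra. For n >= 2, squares of elements of Gamma_n(Z2 * Z) lie in Gamma_{n+1} ([Z2_star_Z_sq]),
    so Gamma_n / Gamma_{n+1} is a vector space over F_2. Give t weight 1 and v = [t, a] weight 2,
    and let H be a Hall set on t and v obtained by Lazard elimination. A basis is given by the
    powers h^(2^(n - m)), for h in H of weight m with 2 <= m <= n. They generate because the
    elimination can be carried out in the group itself ([start_span], [lie_hall]). They are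
    independent because Z2 * Z acts on the noncommutative power series in Y and V in such a way that
    h - 1 has as leading term, modulo 2, the corresponding Lie polynomial in Y and V; these
    polynomials are independent by a Poincare-Birkhoff-Witt count ([hall_free], [hall_independent]).

    Counting. Elimination gives the factorization of 1 - X - X^2 as the product of 1 - X^m over the
    weights m of H. Its logarithmic derivative says that the sum of d c_d over the divisors d of m
    is the Lucas number L_m, the trace of the m-th power of the matrix, where c_d counts the Hall
    elements of weight d. Moebius inversion then identifies c_{i-j} with the inner sum of R_i
    ([Hall_count_rank]). *)

Section GroupBasics.
Local Open Scope group_scope.

(** * Integer powers, subgroups and homomorphisms of groups *)

Definition gpowz (G : groupType) (x : G) (z : int) : G :=
  match z with Posz n => x ^+ n | Negz n => (x ^+ n.+1)^-1 end.

Lemma gpowz_succ (G : groupType) (x : G) (z : int) :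
  gpowz x (z + 1)%R = gpowz x z * x.
Proof.
case: z => n /=; first by rewrite addn1 expgSr.
case: n => [|n]; first by rewrite mulVg.
rewrite NegzE -addn1 PoszD opprD subrK -NegzE.
by rewrite -[gpowz _ _]/((x ^+ n.+1)^-1) addn1 (expgS x n.+1) invgM mulgVK.
Qed.

Lemma gpowzD (G : groupType) (x : G) (m n : int) :
  gpowz x (m + n)%R = gpowz x m * gpowz x n.
Proof.
elim/int_rect: n => [|n IH|n IH]; first by rewrite addr0 mulg1.
  by rewrite -addn1 PoszD addrA gpowz_succ IH gpowz_succ mulgA.
apply: (mulIg x); rewrite -gpowz_succ -mulgA -gpowz_succ.
by rewrite -addn1 PoszD opprD addrA !subrK.
Qed.

Lemma isomorphic_sym (G H : groupType) : isomorphic G H -> isomorphic H G.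
Proof.
move=> [f [g fK gK]].
have gM : {morph g : x y / x * y}.
  by move=> x y; apply: (can_inj fK); rewrite gmulfM !gK.
pose m := isMultiplicative.Build H G g gM.
pose g' : {multiplicative H -> G} := HB.pack g m.
by exists g'; exists f.
Qed.

Lemma isomorphic_of_bij (G H : groupType) (f : G -> H) :
  {morph f : x y / x * y} -> injective f -> (forall y, exists x, f x = y) ->
  isomorphic G H.
Proof.
move=> fM fI fS; pose m := isMultiplicative.Build G H f fM.
pose f' : {multiplicative G -> H} := HB.pack f m.
exists f'; exists (fun y => projT1 (cid (fS y))) => [x|y] /=.
  by apply: fI; exact: (projT2 (cid (fS (f x)))).
exact: (projT2 (cid (fS y))).
Qed.

Section SubgroupFacts.
Variables (G : groupType) (A : set G).
Hypothesis hA : is_subgroup A.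

Lemma sgr1 : A 1. Proof. by case: hA. Qed.
Lemma sgrV x : A x -> A x^-1.
Proof. by case: hA => A1 AF Ax; rewrite -[x^-1]mul1g; exact: AF. Qed.
Lemma sgrM x y : A x -> A y -> A (x * y).
Proof. by move=> Ax Ay; rewrite -[y]invgK; apply: (proj2 hA) => //; exact: sgrV. Qed.
Lemma sgrX x n : A x -> A (x ^+ n).
Proof.
by move=> Ax; elim: n => [|n IH]; [exact: sgr1|rewrite expgS; exact: sgrM].
Qed.
Lemma sgr_powz x z : A x -> A (gpowz x z).
Proof. by move=> Ax; case: z => n /=; [|apply: sgrV]; exact: sgrX. Qed.
End SubgroupFacts.

Lemma generated_sub (G : groupType) (A B : set G) :
  is_subgroup B -> A `<=` B -> generated A `<=` B.
Proof. by move=> hB AB; apply: smallest_sub. Qed.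

Lemma sub_generated (G : groupType) (A : set G) : A `<=` generated A.
Proof. exact: sub_gen_smallest. Qed.

Section Morphisms.
Variables (G H : groupType) (f : {multiplicative G -> H}).

Lemma gm1 : f 1 = 1.
Proof. by apply: (mulIg (f 1)); rewrite -gmulfM !mul1g. Qed.
Lemma gmV x : f x^-1 = (f x)^-1.
Proof. by apply: (mulIg (f x)); rewrite -gmulfM !mulVg gm1. Qed.
Lemma gmJ x y : f (x ^ y) = f x ^ f y.
Proof. by rewrite /conjg !gmulfM gmV. Qed.
Lemma gmR x y : f [~ x, y] = [~ f x, f y].
Proof. by rewrite /commg gmulfM gmV gmJ. Qed.
Lemma gmX x n : f (x ^+ n) = f x ^+ n.
Proof. by elim: n => [|n IH]; [exact: gm1|rewrite !expgS gmulfM IH]. Qed.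
Lemma gmZ x z : f (gpowz x z) = gpowz (f x) z.
Proof. by case: z => n /=; rewrite ?gmV gmX. Qed.
End Morphisms.

Lemma preimage_subgroup (G H : groupType) (f : {multiplicative G -> H}) (A : set H) :
  is_subgroup A -> is_subgroup (f @^-1` A).
Proof.
move=> hA; split=> [|x y] /=; first by rewrite gm1; exact: sgr1.
by move=> Ax Ay; rewrite gmulfM gmV; apply: hA.2.
Qed.

Lemma image_subgroup (G H : groupType) (f : {multiplicative G -> H}) (A : set G) :
  is_subgroup A -> is_subgroup (f @` A).
Proof.
move=> hA; split=> [|_ _ [x Ax <-] [y Ay <-]].
  by exists 1; [exact: sgr1|rewrite gm1].
by exists (x * y^-1); [exact: hA.2|rewrite gmulfM gmV].
Qed.

End GroupBasics.

(** * Universal property of free products and of Z2 * Z *)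

Section FreeProductUniversal.
Local Open Scope group_scope.
Variables (G H K : groupType) (f : {multiplicative G -> K}) (g : {multiplicative H -> K}).

Definition fp_letter (x : G + H) : K :=
  match x with inl a => f a | inr b => g b end.

Definition fp_eval (u : fp_word G H) : K := \prod_(x <- u) fp_letter x.

Lemma fp_eval_eq u v : fp_eq u v -> fp_eval u = fp_eval v.
Proof.
rewrite /fp_eval; elim=> [a|a b _ ->|a b c _ -> _ ->|a b|a b|a b x y|a b x y] //;
  rewrite !big_cat ?big_cons /= ?gm1 ?mul1g //.
- by rewrite gmulfM !mulgA.
- by rewrite gmulfM !mulgA.
Qed.

Definition fp_map (x : free_product G H) : K := fp_eval (repr x).

Lemma fp_mapE (u : fp_word G H) : fp_map (\pi_(free_product G H) u) = fp_eval u.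
Proof. by apply: fp_eval_eq; exact: repr_fp. Qed.

Lemma fp_map_morph : {morph fp_map : x y / x * y}.
Proof.
by elim/quotW => u; elim/quotW => v; rewrite [_ * _]fp_mulE !fp_mapE /fp_eval big_cat.
Qed.

HB.instance Definition _ :=
  isMultiplicative.Build (free_product G H) K fp_map fp_map_morph.

End FreeProductUniversal.

Section Z2StarZ.
Local Open Scope group_scope.

Definition za : Z2_star_Z := \pi_(free_product Z2_group Z_group) [:: inl (1%R : 'Z_2)].
Definition zt : Z2_star_Z := \pi_(free_product Z2_group Z_group) [:: inr (1%R : int)].

Lemma za2 : za * za = 1.
Proof.
rewrite [LHS]fp_mulE; apply/fp_eqP.
apply: fp_trans (fp_mull [::] [::] _ _) _.
rewrite [X in inl X](_ : _ = 1 :> Z2_group); last exact/val_inj.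
exact: (fp_onel [::] [::]).
Qed.

Section Universal.
Variables (K : groupType) (a t : K).
Hypothesis a2 : a * a = 1.

Definition z2_pow (x : Z2_group) : K := a ^+ (x : 'Z_2).
Lemma z2_pow_morph : {morph z2_pow : x y / x * y}.
Proof.
move=> x y; rewrite /z2_pow; change (a ^+ ((x : 'Z_2) + (y : 'Z_2))%R = a ^+ x * a ^+ y).
case: x => [[|[|//]] i]; case: y => [[|[|//]] j] //=.
- by rewrite -[LHS]/(1 : K) -[RHS]/(1 * 1 : K) mulg1.
- by rewrite -[LHS]/a -[RHS]/(1 * a) mul1g.
- by rewrite -[LHS]/a -[RHS]/(a * 1) mulg1.
Qed.
HB.instance Definition _ := isMultiplicative.Build Z2_group K z2_pow z2_pow_morph.

Definition z_pow (x : Z_group) : K := gpowz t x.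
Lemma z_pow_morph : {morph z_pow : x y / x * y}.
Proof. exact: gpowzD. Qed.
HB.instance Definition _ := isMultiplicative.Build Z_group K z_pow z_pow_morph.

Definition zmap : {multiplicative Z2_star_Z -> K} := fp_map z2_pow z_pow.

Lemma zmap_a : zmap za = a.
Proof. by rewrite [LHS]fp_mapE /fp_eval big_seq1. Qed.
Lemma zmap_t : zmap zt = t.
Proof. by rewrite [LHS]fp_mapE /fp_eval big_seq1. Qed.

End Universal.

(** Each letter of a word is a power of [za] or of [zt]. This serves as the induction principle for
    statements about all elements of Z2 * Z. *)
Lemma Z2_star_Z_gen (S : set Z2_star_Z) :
  is_subgroup S -> S za -> S zt -> forall g, S g.
Proof.
move=> hS Sa St; elim/quotW; elim=> [|x u IH]; first exact: (sgr1 hS).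
rewrite -cat1s -[\pi_ _ _]fp_mulE; apply: (sgrM hS) => //.
case: x => [] x.
  have -> : \pi_(free_product Z2_group Z_group) [:: inl x] = za ^+ (x : 'Z_2).
    case: x => [[|[|//]]] i.
      apply/fp_eqP; rewrite (_ : Ordinal i = 0%R); last exact/val_inj.
      exact: (fp_onel [::] [::]).
    by congr (\pi_ _ [:: inl _]); exact/val_inj.
  exact: (sgrX hS).
have -> : \pi_(free_product Z2_group Z_group) [:: inr x] = gpowz zt x.
  pose p (z : int) : Z2_star_Z := \pi_(free_product Z2_group Z_group) [:: inr (z : Z_group)].
  have pS z : p (z + 1)%R = p z * zt.
    by rewrite [RHS]fp_mulE; apply/fp_eqP/fp_sym; exact: (fp_mulr [::] [::]).
  rewrite -/(p x); elim/int_rect: x => [|n IHn|n IHn].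
  - by apply/fp_eqP; exact: (fp_oner [::] [::]).
  - by rewrite -addn1 PoszD gpowz_succ -IHn pS.
  - apply: (mulIg zt); rewrite -gpowz_succ -pS -addn1 PoszD opprD subrK.
    exact: IHn.
exact: (sgr_powz hS).
Qed.

End Z2StarZ.

#[local] Arguments Gamma : simpl never.
#[local] Arguments subgroup_set : simpl never.

(** * Commutator calculus and the lower central series *)

Section LowerCentral.
Local Open Scope group_scope.

Section GammaFacts.
Variable G : groupType.
Implicit Types x y z g h : G.

Lemma Gam1 i : Gamma G i 1. Proof. exact: (sgr1 (Gamma_subgroup G i)). Qed.
Lemma GamV i x : Gamma G i x -> Gamma G i x^-1.
Proof. exact: (sgrV (Gamma_subgroup G i)). Qed.
Lemma GamM i x y : Gamma G i x -> Gamma G i y -> Gamma G i (x * y).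
Proof. exact: (sgrM (Gamma_subgroup G i)). Qed.
Lemma GamX i x n : Gamma G i x -> Gamma G i (x ^+ n).
Proof. exact: (sgrX (Gamma_subgroup G i)). Qed.
Lemma GamJ i x y : Gamma G i x -> Gamma G i (x ^ y).
Proof. exact: Gamma_conj. Qed.

Lemma Gam_le i j x : (i <= j)%N -> Gamma G j x -> Gamma G i x.
Proof.
by move=> /subnK <-; elim: (j - i)%N => [//|k IH]; rewrite addSn => /Gamma_anti.
Qed.

Lemma Gam_comm1 i x y : (0 < i)%N -> Gamma G i y -> Gamma G i.+1 [~ x, y].
Proof. by case: i => // i _ hy; apply: sub_generated; exists x, y. Qed.

Lemma Gam_comm1r i x y : (0 < i)%N -> Gamma G i y -> Gamma G i.+1 [~ y, x].
Proof. by move=> i0 hy; rewrite -invgR; apply: GamV; exact: Gam_comm1. Qed.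

Lemma commMg x y z : [~ x * y, z] = [~ x, z] ^ y * [~ y, z].
Proof. by rewrite /commg /conjg !gnorm. Qed.

Lemma commgM x y z : [~ x, y * z] = [~ x, z] * [~ x, y] ^ z.
Proof. by rewrite /commg /conjg !gnorm. Qed.

Lemma commVg x y : [~ x^-1, y] = ([~ x, y]^-1) ^ x^-1.
Proof. by rewrite /commg /conjg !gnorm. Qed.

Lemma commgV x y : [~ x, y^-1] = ([~ x, y]^-1) ^ y^-1.
Proof. by rewrite /commg /conjg !gnorm. Qed.

Lemma conjg_comm x y : x ^ y = x * [~ x, y].
Proof. by rewrite /commg mulVKg. Qed.

(* The Hall-Witt identity, with y replaced by its inverse. *)
Lemma Hall_Witt x y z :
  [~ x, y, z] ^ y^-1 * [~ y^-1, z^-1, x] ^ z * [~ z, x^-1, y^-1] ^ x = 1.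
Proof. by rewrite /commg /conjg !gnorm. Qed.

(** The three subgroups argument, by induction on i: the Hall-Witt identity writes [[x, y], z], up
    to conjugation and inversion, through [[y^-1, z^-1], x] and [[z, x^-1], y^-1], and in both of
    these the factor y occurs with its lower index. *)
Lemma Gam_commM i j x y : (0 < i)%N -> (0 < j)%N ->
  Gamma G i x -> Gamma G j y -> Gamma G (i + j) [~ x, y].
Proof.
case: i => // i _; elim: i j x y => [|i IH] j x y j0.
  by move=> _; exact: Gam_comm1.
have sA : is_subgroup [set x | forall y, Gamma G j y -> Gamma G (i.+2 + j) [~ x, y]].
  split=> [z hz|u v hu hv z hz] /=; first by rewrite comm1g; exact: Gam1.
  rewrite commMg commVg; apply: GamM; apply: GamJ; first exact: hu.
  by apply: GamV; exact: hv.
move=> hx; apply: (generated_sub sA _ hx) => {x hx y} _ [x [y [hy ->]]] z hz /=.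
rewrite -[[~ _, _, _]](conjgK y^-1) invgK; apply: GamJ.
set w := _ ^ y^-1.
have -> : w = ([~ y^-1, z^-1, x] ^ z * [~ z, x^-1, y^-1] ^ x)^-1.
  by apply/eqP; rewrite -mulg_eq1 mulgA; apply/eqP; exact: Hall_Witt.
apply: GamV; apply: GamM; apply: GamJ.
  by rewrite addSn; apply: Gam_comm1r => //; apply: IH => //; exact: GamV.
rewrite -invgR; apply: GamV; rewrite addSn -addnS; apply: IH => //.
  exact: GamV.
exact: Gam_comm1r.
Qed.

End GammaFacts.

Definition gam_in (G : groupType) i (x : G) (h : Gamma G i x) :
  subgroup_type (Gamma G i) := exist _ x (mem_set h).

Lemma val_gam (G : groupType) i (x : G) (h : Gamma G i x) : val (gam_in h) = x.
Proof. by []. Qed.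

Lemma gam_valP (G : groupType) i (x : subgroup_type (Gamma G i)) : Gamma G i (val x).
Proof. exact: set_mem (valP x). Qed.

Lemma gam_quotP (G : groupType) i (x y : subgroup_type (Gamma G i)) :
  \pi_(quotient_group (Gamma_next G i)) x = \pi_(quotient_group (Gamma_next G i)) y <->
  Gamma G i.+1 ((val x)^-1 * val y).
Proof. by split=> [/quot_eqP|h]; [|apply/quot_eqP]. Qed.

Section GammaMorphism.
Variables (G H : groupType) (f : {multiplicative G -> H}).

Lemma Gam_map i x : Gamma G i x -> Gamma H i (f x).
Proof.
elim: i x => [//|[//|i] IH] x.
apply: (@generated_sub _ _ (f @^-1` (Gamma H i.+2))) => [|_ [u [v [hv ->]]]].
  exact: (preimage_subgroup f (Gamma_subgroup H i.+2)).
by rewrite /= gmR; apply: Gam_comm1 => //; exact: IH.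
Qed.

Hypothesis fsurj : forall y, exists x, f x = y.

Lemma Gam_surj i y : Gamma H i y -> exists2 x, Gamma G i x & f x = y.
Proof.
elim: i y => [|[|i] IH] y; [by have [x <-] := fsurj y; exists x..|].
apply: (@generated_sub _ _ (f @` (Gamma G i.+2))) => [|_ [u [v [/IH [v' hv' <-] ->]]]].
  exact: (image_subgroup f (Gamma_subgroup G i.+2)).
have [u' <-] := fsurj u; exists [~ u', v']; last by rewrite gmR.
exact: Gam_comm1.
Qed.

Hypothesis finj : forall x, Gamma G 2 x -> f x = 1 -> x = 1.

Lemma Gam_inj i x y : (2 <= i)%N -> Gamma G i x -> Gamma G i y -> f x = f y -> x = y.
Proof.
move=> i2 hx hy fxy; apply: divg1_eq; apply: finj.
  by apply: GamM; [|apply: GamV]; exact: Gam_le i2 _.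
by rewrite gmulfM gmV fxy mulgV.
Qed.

(** The image also comes from an element of Gamma_i, and injectivity on Gamma_2 forces the two
    preimages to agree. This makes the induced maps of quotients injective. *)
Lemma Gam_reflect i x : (2 <= i)%N -> Gamma G 2 x -> Gamma H i (f x) -> Gamma G i x.
Proof.
move=> i2 hx /Gam_surj [x' hx' fx']; suff -> : x = x' by [].
by apply: (@Gam_inj 2) => //; exact: Gam_le i2 _.
Qed.

(** Surjectivity of f carries Gamma_i onto Gamma_i, and Gamma_i lies in Gamma_2, where f is
    injective. *)
Lemma Gamma_isomorphic i : (2 <= i)%N ->
  isomorphic (subgroup_type (Gamma G i)) (subgroup_type (Gamma H i)).
Proof.
move=> i2.
pose F (x : subgroup_type (Gamma G i)) := gam_in (Gam_map (gam_valP x)).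
apply: (@isomorphic_of_bij _ _ F) => [x y|x y|y].
- by apply: val_inj; rewrite valM !val_gam valM gmulfM.
- move/(congr1 val); rewrite !val_gam => fxy; apply: val_inj.
  by apply: (@Gam_inj i) => //; exact: gam_valP.
- have [x hx fx] := Gam_surj (gam_valP y).
  by exists (gam_in hx); apply: val_inj; rewrite !val_gam.
Qed.

Lemma Gamma_quotient_isomorphic i : (2 <= i)%N ->
  isomorphic (Gamma_quotient G i) (Gamma_quotient H i).
Proof.
move=> i2.
pose F (x : subgroup_type (Gamma G i)) := gam_in (Gam_map (gam_valP x)).
pose N := Gamma_next G i; pose N' := Gamma_next H i.
have FM x y : F (x * y) = F x * F y.
  by apply: val_inj; rewrite valM !val_gam valM gmulfM.
have FN x y : (\pi_(quotient_group N') (F x) = \pi_(quotient_group N') (F y)) <->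
              (\pi_(quotient_group N) x = \pi_(quotient_group N) y).
  split=> /gam_quotP; rewrite ?val_gam => h; apply/gam_quotP; rewrite ?val_gam.
    apply: Gam_reflect; rewrite ?gmulfM ?gmV //; first exact: ltnW.
    by apply: GamM; [apply: GamV|]; apply: Gam_le i2 _; exact: gam_valP.
  by rewrite -gmV -gmulfM; exact: Gam_map.
pose Q (x : quotient_group N) : quotient_group N' := \pi_(quotient_group N') (F (repr x)).
have QE x : Q (\pi_(quotient_group N) x) = \pi_(quotient_group N') (F x).
  by apply/FN; rewrite reprK.
apply: (@isomorphic_of_bij _ _ Q).
- elim/quotW => x; elim/quotW => y.
  by rewrite [_ * _ in LHS]quot_mulE !QE [RHS]quot_mulE FM.
- by elim/quotW => x; elim/quotW => y; rewrite !QE => /FN.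
- elim/quotW => y; have [x hx fx] := Gam_surj (gam_valP y).
  exists (\pi_(quotient_group N) (gam_in hx)); rewrite QE.
  by congr (\pi_(quotient_group N') _); apply: val_inj; rewrite !val_gam.
Qed.

End GammaMorphism.

End LowerCentral.

(** * Lazard elimination of weighted generators *)

Section Elimination.
Variables (G : eqType) (br : G -> G -> G) (N : nat).
Local Notation wgt := (nat * G)%type.

Definition ad_iter (x : G) (k : nat) (y : G) : G := iter k (fun z => br z x) y.

(** In the free Lie algebra on x and Y the ideal generated by Y is free on the elements ad(x)^k y.
    Those of weight at most N are kept; when x has positive weight, k <= N covers all of them. *)
Definition elim_list (x : wgt) (Y : seq wgt) : seq wgt :=
  flatten [seq [seq ((y.1 + k * x.1)%N, ad_iter x.2 k y.2)
               | k <- iota 0 N.+1 & (y.1 + k * x.1 <= N)%N] | y <- Y].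

(* Lazard elimination up to weight N: H lists the generators in the order in
   which they are eliminated from X. *)
Inductive Hall : seq wgt -> seq wgt -> Prop :=
| Hall_nil X : all (fun x : nat * G => N < x.1)%N X -> Hall X [::]
| Hall_step X x Y H : perm_eq X (x :: Y) ->
    Hall (elim_list x Y) H -> Hall X (x :: H).

Lemma elim_listP (x : wgt) (Y : seq wgt) z :
  z \in elim_list x Y ->
  exists y k, [/\ y \in Y, (y.1 + k * x.1 <= N)%N &
    z = ((y.1 + k * x.1)%N, ad_iter x.2 k y.2)].
Proof.
case/flattenP => s /mapP[y yY ->] /mapP[k]; rewrite mem_filter => /andP[le _] ->.
by exists y, k.
Qed.

Lemma mem_elim_list (x y : wgt) k (Y : seq wgt) : (0 < x.1)%N -> y \in Y ->
  (y.1 + k * x.1 <= N)%N ->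
  ((y.1 + k * x.1)%N, ad_iter x.2 k y.2) \in elim_list x Y.
Proof.
move=> x0 yY le; apply/flatten_mapP; exists y => //.
apply/mapP; exists k => //; rewrite mem_filter le mem_iota /= ltnS.
by rewrite (leq_trans _ le) // (leq_trans _ (leq_addl _ _)) // leq_pmulr.
Qed.

(** Each bracket with x adds a positive weight, so only the terms with k = 0 can have the least
    weight d. *)
Lemma elim_list_weight_gt (x : wgt) (Y : seq wgt) d : (0 < x.1)%N ->
  (forall y : nat * G, y \in Y -> d <= y.1)%N -> (d <= x.1)%N ->
  (count (fun y : nat * G => y.1 == d) (elim_list x Y) <= count (fun y : nat * G => y.1 == d) Y)%N.
Proof.
move=> x0 hY dx; rewrite /elim_list count_flatten -map_comp.
elim: Y hY => // y Y IH hY; rewrite map_cons -[sumn (_ :: _)]/(_ + sumn _)%N.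
rewrite -[count _ (y :: _)]/((y.1 == d) + count _ _)%N; apply: leq_add; last first.
  by apply: IH => z zY; apply: hY; rewrite inE zY orbT.
rewrite [(_ \o _) _]/comp count_map count_filter.
have [le|gt] := ltnP d y.1.
  rewrite (eq_count (a2 := pred0)) ?count_pred0 // => k.
  by apply/negbTE/negP => /andP[/eqP /= h _]; lia.
have e : y.1 = d by apply/eqP; rewrite eqn_leq gt hY // inE eqxx.
rewrite e eqxx /= mul0n addn0 eqxx /=.
rewrite (eq_in_count (a2 := pred0)) ?count_pred0 ?addn0; first by case: (d <= N)%N.
move=> k; rewrite mem_iota => /andP[k0 _]; apply/negbTE/negP => /andP[/eqP /= h _].
by move: k0; rewrite (_ : k = 0%N) //; nia.
Qed.

(** Always eliminate an element of least weight d. This removes one element of weight d and creates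
    none, so N + 1 - d and the number of elements of weight d decrease lexicographically. *)
Lemma Hall_exists (X : seq wgt) : (forall x : nat * G, x \in X -> 0 < x.1)%N ->
  exists H, Hall X H.
Proof.
have main e : forall d c (X : seq wgt), (N.+1 - d <= e)%N -> (0 < d)%N ->
    (forall x : nat * G, x \in X -> d <= x.1)%N ->
    (count (fun y : nat * G => y.1 == d) X <= c)%N -> exists H, Hall X H.
  elim: e => [|e IHe] d c {}X de d0 hX hc.
    exists [::]; apply: Hall_nil; apply/allP => x /hX h /=; lia.
  elim: c X hX hc => [|c IHc] X hX hc.
    apply: (IHe d.+1 (size X)) => //; first by lia.
      move=> x xX; rewrite ltn_neqAle hX // andbT eq_sym.
      apply/negP => xd; suff : has (fun y : nat * G => y.1 == d) X by rewrite has_count; lia.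
      by apply/hasP; exists x.
    exact: count_size.
  have [/hasP[x xX /eqP xd]|no] := boolP (has (fun y : nat * G => y.1 == d) X); last first.
    by apply: IHc => //; move: no; rewrite has_count; lia.
  have pX := perm_to_rem xX.
  have [||H hH] := IHc (elim_list x (rem x X)).
  - move=> _ /elim_listP[y [k [/mem_rem/hX yd _ ->]]] /=; lia.
  - apply: leq_trans (elim_list_weight_gt _ _ _) _; rewrite ?xd //.
      by move=> y /mem_rem/hX.
    by move: hc; rewrite (permP pX) /= xd eqxx; lia.
  - by exists (x :: H); apply: Hall_step hH.
by move=> hX; apply: (main N.+1 1%N (size X)) => //; [lia|exact: count_size].
Qed.

Lemma Hall_pos (X H : seq wgt) : Hall X H -> (forall x : nat * G, x \in X -> 0 < x.1)%N ->
  (forall x : nat * G, x \in H -> 0 < x.1)%N.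
Proof.
elim=> // {}X x Y {}H pX _ IH hX z; rewrite inE => /predU1P[->|zH].
  by apply: hX; rewrite (perm_mem pX) inE eqxx.
apply: IH zH => _ /elim_listP[y [k [yY _ ->]]] /=.
by rewrite ltn_addr //; apply: hX; rewrite (perm_mem pX) inE yY orbT.
Qed.

End Elimination.

(** Elimination is formal in the bracket. This lets one elimination on pairs be read off in each
    component. *)
Lemma Hall_map (E E' : eqType) (br : E -> E -> E) (br' : E' -> E' -> E') (h : E -> E') N X H :
  {morph h : x y / br x y >-> br' x y} -> Hall br N X H ->
  Hall br' N [seq (x.1, h x.2) | x <- X] [seq (x.1, h x.2) | x <- H].
Proof.
move=> hM; elim=> [{}X hX|{}X x Y {}H pX _ IH].
  by apply: Hall_nil; rewrite all_map.
apply: (@Hall_step _ _ _ _ (x.1, h x.2) [seq (y.1, h y.2) | y <- Y]); first exact: (perm_map _ pX).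
move: IH; rewrite /elim_list map_flatten -!map_comp; congr (Hall _ _ (flatten _) _).
apply: eq_map => y /=; rewrite -map_comp; apply: eq_map => k /=; congr (_, _).
by rewrite /ad_iter; elim: k => //= k IHk; rewrite hM IHk.
Qed.

(** * Generating functions of Hall sets modulo X^(N+1) *)

Section TruncatedPolynomials.
Variable N : nat.
Implicit Types p q : {poly int}.

Definition eqX p q := forall k, (k <= N)%N -> p`_k = q`_k.

Lemma eqX_refl p : eqX p p. Proof. by []. Qed.
Lemma eqX_sym p q : eqX p q -> eqX q p.
Proof. by move=> h k kN; rewrite h. Qed.
Lemma eqX_trans q p r : eqX p q -> eqX q r -> eqX p r.
Proof. by move=> h h' k kN; rewrite h ?h'. Qed.
Lemma eqXD p p' q q' : eqX p p' -> eqX q q' -> eqX (p + q) (p' + q').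
Proof. by move=> h h' k kN; rewrite !coefD h ?h'. Qed.
Lemma eqXN p p' : eqX p p' -> eqX (- p) (- p').
Proof. by move=> h k kN; rewrite !coefN h. Qed.
Lemma eqXM p p' q q' : eqX p p' -> eqX q q' -> eqX (p * q) (p' * q').
Proof.
move=> h h' k kN; rewrite !coefM; apply: eq_bigr => i _; rewrite h ?h' //.
  by apply: leq_trans kN; rewrite leq_subr.
by apply: leq_trans kN; rewrite -ltnS.
Qed.
Lemma eqXn m : (N < m)%N -> eqX 'X^m 0.
Proof. by move=> Nm k kN; rewrite coefXn coef0; case: eqP => // ?; lia. Qed.
Lemma eqX_sum (I : Type) (s : seq I) (F F' : I -> {poly int}) :
  (forall i, eqX (F i) (F' i)) -> eqX (\sum_(i <- s) F i) (\sum_(i <- s) F' i).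
Proof.
by move=> h; elim: s => [|i s IH]; rewrite ?big_nil // !big_cons; exact: eqXD.
Qed.
Lemma eqX_derivX p q : eqX p q -> eqX ('X * p^`()) ('X * q^`()).
Proof. by move=> h [|k] kN; rewrite !coefXM //= !coef_deriv h. Qed.

Variables (G : eqType) (br : G -> G -> G).
Implicit Types X Y H : seq (nat * G).

Definition hall_prod H : {poly int} := \prod_(x <- H) (1 - 'X^(x.1)).
Definition gen_sum X : {poly int} := \sum_(x <- X) 'X^(x.1).

(** Each y contributes a geometric series with ratio X^(wt x), truncated beyond degree N. *)
Lemma gen_sum_elim (x : nat * G) Y : (0 < x.1)%N ->
  eqX ((1 - 'X^(x.1)) * gen_sum (elim_list br N x Y)) (gen_sum Y).
Proof.
move=> x0; rewrite /gen_sum /elim_list big_flatten big_map mulr_sumr.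
apply: eqX_sum => y; rewrite big_map big_filter /=.
apply: (@eqX_trans ((1 - 'X^(x.1)) * (\sum_(k <- iota 0 N.+1) 'X^(y.1 + k * x.1)))).
  apply: eqXM => //; rewrite big_mkcond; apply: eqX_sum => k.
  by case: leqP => // h; apply: eqX_sym; exact: eqXn.
have -> : (1 - 'X^(x.1)) * (\sum_(k <- iota 0 N.+1) 'X^(y.1 + k * x.1)) =
    'X^(y.1) - 'X^(y.1 + N.+1 * x.1) :> {poly int}.
  elim: (N.+1) => [|n IH]; first by rewrite big_nil mulr0 addn0 subrr.
  rewrite -[in iota _ _]addn1 iotaD big_cat big_seq1 /= add0n mulrDr IH mulSn.
  by rewrite addnCA [in RHS]exprD; ring.
rewrite -[X in eqX _ X]subr0; apply: eqXD => //; apply: eqXN; apply: eqXn; nia.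
Qed.

(** One elimination step is the identity (1 - X^w) (1 - S') = 1 - X^w - S, where w is the weight of
    x, and S and S' are the generating sums of the other generators before and after the step. *)
Lemma hall_prodE X H : Hall br N X H -> (forall x : nat * G, x \in X -> 0 < x.1)%N ->
  eqX (hall_prod H) (1 - gen_sum X).
Proof.
elim=> [{}X /allP hX _|{}X x Y {}H pX _ IH hX].
  rewrite /hall_prod big_nil -[X in eqX X _]subr0; apply: eqXD => //; apply: eqXN.
  rewrite /gen_sum big_seq; elim/big_ind: _ => //.
    by move=> p q hp hq; rewrite -[0]addr0; exact: eqXD.
  by move=> x /hX h; apply: eqX_sym; exact: eqXn.
have x0 : (0 < x.1)%N by apply: hX; rewrite (perm_mem pX) inE eqxx.
rewrite /hall_prod big_cons (_ : gen_sum X = 'X^(x.1) + gen_sum Y); last first.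
  by rewrite /gen_sum (perm_big _ pX) big_cons.
apply: (@eqX_trans ((1 - 'X^(x.1)) * (1 - gen_sum (elim_list br N x Y)))).
  apply: eqXM => //; apply: IH => _ /elim_listP[y [k [yY _ ->]]] /=.
  by rewrite ltn_addr //; apply: hX; rewrite (perm_mem pX) inE yY orbT.
rewrite mulrBr mulr1 opprD addrA; apply: eqXD => //; apply: eqXN.
exact: gen_sum_elim.
Qed.

Definition log_deriv H : {poly int} :=
  \sum_(x <- H) \sum_(k <- iota 1 N) x.1%:R * 'X^(k * x.1).

(** [log_deriv] expands -X P' / P for P = [hall_prod H]: the factor 1 - X^w contributes w X^w / (1 -
    X^w). *)
Lemma log_derivE H : (forall x : nat * G, x \in H -> 0 < x.1)%N ->
  eqX (log_deriv H * hall_prod H) (- ('X * (hall_prod H)^`())).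
Proof.
elim: H => [|x H IH] hH.
  by rewrite /log_deriv /hall_prod !big_nil derivC mul0r mulr0 oppr0.
have x0 : (0 < x.1)%N by apply: hH; rewrite inE eqxx.
rewrite /log_deriv /hall_prod !big_cons -/(log_deriv H) -/(hall_prod H).
rewrite mulrDl derivM mulrDr opprD; apply: eqXD.
  have -> : - ('X * ((1 - 'X^(x.1))^`() * hall_prod H)) =
    (x.1%:R * 'X^(x.1)) * hall_prod H.
    rewrite derivB derivC derivXn sub0r -[in RHS](prednK x0) exprS; move: (hall_prod H) => p.
    by rewrite -mulr_natl prednK //; ring.
  rewrite mulrA; apply: eqXM => //.
  have -> : (\sum_(k <- iota 1 N) x.1%:R * 'X^(k * x.1)) * (1 - 'X^(x.1)) =
      x.1%:R * ('X^(x.1) - 'X^(N.+1 * x.1)) :> {poly int}.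
    elim: N => [|n IHn]; first by rewrite big_nil mul0r mul1n subrr mulr0.
    rewrite -[X in iota _ X]addn1 iotaD big_cat big_seq1 /= add1n mulrDl IHn.
    by rewrite [(n.+2 * _)%N]mulSn [in RHS]exprD; ring.
  apply: eqXM => //; rewrite -[X in eqX _ X]subr0; apply: eqXD => //; apply: eqXN.
  by apply: eqXn; nia.
rewrite mulrCA [X in eqX _ (- X)]mulrCA -mulrN; apply: eqXM => //.
by apply: IH => z zH; apply: hH; rewrite inE zH orbT.
Qed.

Lemma coef_log_deriv H m : (0 < m <= N)%N -> (forall x : nat * G, x \in H -> 0 < x.1)%N ->
  (log_deriv H)`_m = \sum_(x <- H | (x.1 %| m)%N) x.1%:R.
Proof.
move=> mN hH; rewrite coef_sum [RHS]big_mkcond /=.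
rewrite big_seq [RHS]big_seq; apply: eq_bigr => x /hH x0.
rewrite coef_sum.
have hk k : (x.1%:R * 'X^(k * x.1) : {poly int})`_m = if m == (k * x.1)%N then x.1%:R else 0.
  by rewrite mulr_natl coefMn coefXn; case: eqP; rewrite ?mul0rn.
rewrite (eq_bigr _ (fun k _ => hk k)); case: ifP => [/dvdnP[k mk]|no].
  rewrite (bigD1_seq k) ?iota_uniq //=; last by rewrite mem_iota; nia.
  rewrite mk eqxx big1 ?addr0 // => l lk; rewrite eqn_pmul2r // eq_sym.
  by rewrite (negbTE lk).
by rewrite big1 // => k _; case: eqP => // mk; rewrite mk dvdn_mull in no.
Qed.

End TruncatedPolynomials.

(** * Traces of matrix powers as Lucas numbers *)

Section Lucas.

Definition lucas (m : nat) : rat := \tr (trace_mx ^+ m).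

Lemma lucasSS m : lucas m.+2 = lucas m.+1 + lucas m.
Proof.
rewrite /lucas -mxtraceD; congr (\tr _).
(* The Cayley-Hamilton identity, from which the Fibonacci recurrence of the traces follows. *)
have M2 : trace_mx ^+ 2 = trace_mx + 1.
  apply/matrixP => i j; rewrite expr2 !mxE !big_ord_recl big_ord0 !mxE /=.
  by case: i => [[|[|//]] ?]; case: j => [[|[|//]] ?].
have -> : trace_mx ^+ m.+2 = trace_mx ^+ m * trace_mx ^+ 2 by rewrite -exprD addn2.
by rewrite M2 mulrDr mulr1 -exprSr.
Qed.

Lemma lucas1 : lucas 1 = 1.
Proof. by rewrite /lucas expr1 /mxtrace !big_ord_recl big_ord0 !mxE. Qed.

Lemma lucas0 : lucas 0 = 2.
Proof. by rewrite /lucas expr0 mxtrace1. Qed.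

(** The recurrence is (1 - X - X^2) a = X + 2 X^2 read coefficient by coefficient; the right side is
    -X times the derivative of 1 - X - X^2. *)
Lemma lucas_rec (N : nat) (a : nat -> int) : a 0%N = 0 ->
  (forall m, (m <= N)%N -> a m = (if m is k.+1 then a k else 0) +
     (if m is k.+2 then a k else 0) + (m == 1)%:R + (m == 2)%:R *+ 2) ->
  forall m, (0 < m <= N)%N -> (a m)%:~R = lucas m.
Proof.
move=> a0 ha.
suff h m : ((0 < m <= N)%N -> (a m)%:~R = lucas m) /\
           ((0 < m.+1 <= N)%N -> (a m.+1)%:~R = lucas m.+1) by move=> m /(proj1 (h m)).
elim: m => [|m [IH1 IH2]]; split=> //.
  by move=> /andP[_ h]; rewrite ha // a0 lucas1.
move=> /andP[_ h]; rewrite ha // lucasSS.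
case: m IH1 IH2 h => [|m] IH1 IH2 h.
  by rewrite a0 ha ?a0 ?lucas1 ?lucas0 //; exact: ltnW.
by rewrite !addr0 rmorphD /= IH1 ?IH2 ?(ltnW h) ?(ltnW (ltnW h)).
Qed.

End Lucas.

(** * Moebius inversion *)

Section Moebius.

Lemma moebius_mul_prime p e : prime p -> ~~ (p %| e)%N -> (0 < e)%N ->
  moebius (p * e) = - moebius e.
Proof.
move=> pp pe e0; have p0 := prime_gt0 pp.
have pn : p \notin primes e by rewrite mem_primes pp e0.
have pm : perm_eq (primes (p * e)) (p :: primes e).
  apply: uniq_perm; rewrite /= ?primes_uniq ?pn // => q.
  by rewrite primesM // primes_prime // !inE.
rewrite /moebius (perm_all _ pm) (perm_size pm) /= lognM // logn_prime // eqxx /=.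
have l0 : logn p e = 0%N by rewrite lognE pp e0 (negbTE pe).
rewrite l0 addn0 eqxx /=.
have -> : all (fun q => logn q (p * e) == 1%N) (primes e) =
          all (fun q => logn q e == 1%N) (primes e).
  apply: eq_in_all => q; rewrite mem_primes => /and3P[pq _ qe].
  rewrite lognM // logn_prime //; have [qp|//] := eqVneq q p.
  by case/negP: pe; move: qe; rewrite qp.
by case: ifP => _; rewrite ?oppr0 // exprS mulN1r.
Qed.

Lemma moebius_sq p e : prime p -> (p * p %| e)%N -> (0 < e)%N -> moebius e = 0.
Proof.
move=> pp pe e0; rewrite /moebius ifF //; apply/negbTE/allPn; exists p.
  by rewrite mem_primes pp e0 (dvdn_trans _ pe) // dvdn_mulr.
have : (2 <= logn p e)%N by rewrite -pfactor_dvdn // expn2.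
by case: (logn p e) => [|[|]].
Qed.

(** Fix a prime p dividing n. Divisors divisible by p^2 contribute 0, and the others cancel in pairs
    e and p e with e prime to p. *)
Lemma sum_moebius n : (0 < n)%N ->
  \sum_(e < n.+1 | (e %| n)%N) moebius e = (n == 1%N)%:R.
Proof.
case: n => [//|[|n]] _; first by rewrite big_mkcond !big_ord_recl big_ord0.
set m := n.+2; have pp := pdiv_prime (isT : (1 < m)%N).
set p := pdiv m in pp *; have pm : (p %| m)%N := pdiv_dvd m; have p0 := prime_gt0 pp.
have dpos (e : 'I_m.+1) : (e %| m)%N -> (0 < e)%N by move=> /dvdn_gt0; exact.
rewrite (bigID (fun e : 'I_m.+1 => (p %| e)%N)) /=.
rewrite (bigID (fun e : 'I_m.+1 => (p * p %| e)%N)) /= big1 ?add0r; last first.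
  by move=> e /andP[/andP[em pe] ppe]; apply: moebius_sq ppe _ => //; exact: dpos.
pose h (e : 'I_m.+1) : 'I_m.+1 := inord (p * e).
pose h' (e : 'I_m.+1) : 'I_m.+1 := inord (e %/ p).
rewrite (reindex_onto h h'); last first.
  move=> e /andP[/andP[em pe] _]; apply: val_inj; rewrite /h' /h /=.
  by rewrite (inordK (m := (e %/ p)%N)) ?inordK 1?mulnC ?divnK // ltnS
    (leq_trans (leq_div _ _)) // -ltnS.
rewrite [X in X + _](eq_bigl (fun e : 'I_m.+1 => (e %| m)%N && ~~ (p %| e)%N)); last first.
  (* When p e is out of range, [inord] returns a junk value, and both sides of the equivalence have
     to be shown false. *)
  move=> e; have [em|] := ltnP (p * e) m.+1; last first.
    move=> le; have ei : ~~ (p * e %| m)%N by apply/negP => /dvdn_leq; lia.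
    transitivity false.
      apply/negbTE/negP => /andP[/andP[/andP[h1 h2] h3] /eqP h4].
      move: ei; have : (p * (h e %/ p) %| m)%N by rewrite mulnC divnK.
      have -> : (h e %/ p)%N = e.
        by have /= := congr1 val h4; rewrite /h' inordK // ltnS (leq_trans (leq_div _ _)) // -ltnS.
      by move=> ->.
    apply/esym/negbTE/negP => /andP[em pe]; move/negP: ei; apply.
    by rewrite Gauss_dvd ?pm // prime_coprime.
  rewrite /h /h' /= inordK // mulKn // inord_val eqxx andbT dvdn_mulr // andbT.
  rewrite dvdn_pmul2l //; apply/idP/idP => /andP[h1 h2]; apply/andP; split=> //.
    exact: dvdn_trans (dvdn_mull _ _) h1.
  by rewrite Gauss_dvd ?pm // prime_coprime.
rewrite -big_split /= big1 // => e /andP[em pe].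
have e0 := dpos _ em; have le : (p * e < m.+1)%N.
  by rewrite ltnS dvdn_leq // Gauss_dvd ?pm // prime_coprime.
by rewrite /h /= inordK // moebius_mul_prime // addNr.
Qed.

Lemma sum_divisors_ord (V : zmodType) n (F : nat -> V) : (0 < n)%N ->
  \sum_(k <- divisors n) F k = \sum_(k < n.+1 | (k %| n)%N) F k.
Proof.
move=> n0; rewrite -(big_mkord (fun k => k %| n)%N) -big_filter; apply: perm_big.
apply: uniq_perm; rewrite ?divisors_uniq ?filter_uniq ?iota_uniq // => k.
rewrite mem_filter mem_index_iota -dvdn_divisors //.
by case: (boolP (k %| n)%N) => //= /dvdn_leq; rewrite ltnS => ->.
Qed.

(** After substitution and exchange of the sums, the coefficient of [c d] is the sum of the Moebius
    function over the divisors of n / d, which vanishes unless d = n. *)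
Lemma moebius_inversion (c : nat -> rat) (a : nat -> rat) n : (0 < n)%N ->
  (forall m, (0 < m <= n)%N -> a m = \sum_(d < m.+1 | (d %| m)%N) c d) ->
  \sum_(k <- divisors n) (moebius (n %/ k))%:~R * a k = c n.
Proof.
move=> n0 ha; rewrite sum_divisors_ord //.
have dpos (e : nat) : (e %| n)%N -> (0 < e)%N by move=> /dvdn_gt0; exact.
transitivity (\sum_(k < n.+1 | (k %| n)%N) \sum_(d < n.+1 | (d %| k)%N)
   (moebius (n %/ k))%:~R * c d).
  apply: eq_bigr => k kn; rewrite ha; last by rewrite dpos //= dvdn_leq.
  have kn1 : (k.+1 <= n.+1)%N := ltn_ord k.
  rewrite mulr_sumr (@big_ord_widen_cond _ _ _ _ _ (fun d => d %| k)%N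
    (fun d => (moebius (n %/ k))%:~R * c d) kn1).
  apply: eq_bigl => d; rewrite andb_idr // => dk; rewrite ltnS dvdn_leq //.
  exact: dpos.
rewrite (exchange_big_dep (fun d : 'I_n.+1 => (d %| n)%N)) /=; last first.
  by move=> k d kn dk; exact: dvdn_trans dk kn.
rewrite (bigD1 ord_max) //= [X in _ + X]big1 ?addr0; last first.
  move=> d /andP[dn dmax].
  have d0 := dpos _ dn; have dltn : (d < n)%N.
    rewrite ltn_neqAle dvdn_leq // andbT; apply/eqP => h; case/eqP: dmax.
    exact: val_inj.
  rewrite -mulr_suml -rmorph_sum /=.
  suff -> : \sum_(k < n.+1 | (k %| n)%N && (d %| k)%N) moebius (n %/ k) = 0.
    by rewrite mul0r.
  have q0 : (0 < n %/ d)%N by rewrite divn_gt0 // dvdn_leq.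
  have q1 : (n %/ d != 1)%N.
    apply: contraTneq dltn => h; rewrite -leqNgt -[X in (X <= _)%N](divnK dn) h.
    by rewrite mul1n.
  transitivity (\sum_(e < (n %/ d).+1 | (e %| n %/ d)%N) moebius e); last first.
    by rewrite sum_moebius // (negbTE q1).
  have qn : ((n %/ d).+1 <= n.+1)%N by rewrite ltnS leq_div.
  rewrite (@big_ord_widen_cond _ _ _ _ _ (fun e => e %| n %/ d)%N moebius qn).
  pose h (e : 'I_n.+1) : 'I_n.+1 := inord (n %/ e).
  rewrite (reindex_onto h h); last first.
    move=> e /andP[en _]; apply: val_inj; rewrite /h /= !inordK ?ltnS ?leq_div //.
    by rewrite divnA // mulKn.
  apply: eq_big => [e|e /andP[/andP[en de] /eqP he]]; last first.
    rewrite /h /= inordK ?ltnS ?leq_div //.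
    move: en; rewrite /h /= inordK ?ltnS ?leq_div // => en.
    have := congr1 val he; rewrite /h /= !inordK ?ltnS ?leq_div // => ->.
    by [].
  rewrite /h /= !inordK ?ltnS ?leq_div //.
  have [e0|e0] := posnP e.
    by rewrite e0 divn0 !dvd0n !gtn_eqF.
  apply/idP/idP.
    move=> /andP[/andP[h1 h2] /eqP/(congr1 val) h3]; move: h3.
    rewrite /= inordK ?ltnS ?leq_div // => h3.
    have ed : (e %| n)%N by apply/dvdnP; exists (n %/ e)%N; rewrite -{2}h3 mulnC divnK.
    have edv : (e %| n %/ d)%N.
      by rewrite dvdn_divRL // mulnC -dvdn_divRL.
    by rewrite edv; exact: dvdn_leq.
  move=> /andP[h1 h2].
  have ed : (e * d %| n)%N by rewrite -dvdn_divRL.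
  have en : (e %| n)%N := dvdn_trans (dvdn_mulr _ (dvdnn _)) ed.
  rewrite dvdn_div //= dvdn_divRL // mulnC ed /=; apply/eqP/val_inj => /=.
  by rewrite inordK ?ltnS ?leq_div // divnA // mulKn.
rewrite (bigD1 ord_max) /= ?dvdnn // big1 ?addr0; last first.
  move=> k /andP[/andP[kn nk] kmax]; move: kmax.
  suff -> : k = ord_max by rewrite eqxx.
  by apply: val_inj; apply/eqP; rewrite eqn_dvd kn.
by rewrite divnn n0 /moebius /= mul1r.
Qed.

End Moebius.

(** * The number of Hall elements of each weight *)

Section HallRank.
Variables (G : eqType) (br : G -> G -> G) (N : nat) (t v : G) (H : seq (nat * G)).
Hypothesis hH : Hall br N [:: (1%N, t); (2%N, v)] H.

Let Xpos : forall x : nat * G, x \in [:: (1%N, t); (2%N, v)] -> (0 < x.1)%N.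
Proof. by move=> x; rewrite !inE => /orP[/eqP->|/eqP->]. Qed.

Let Hpos := Hall_pos hH Xpos.

Let qE : eqX N (hall_prod H) (1 - 'X - 'X^2).
Proof.
apply: eqX_trans (hall_prodE hH Xpos) _.
by rewrite /gen_sum big_cons big_seq1 expr1 opprD addrA.
Qed.

(** The logarithmic derivative of 1 - X - X^2 is computed twice: the factorization over the Hall set
    gives divisor sums, the polynomial itself gives the Lucas recurrence. *)
Lemma Hall_lucas m : (0 < m <= N)%N ->
  \sum_(x <- H | (x.1 %| m)%N) x.1%:R = lucas m.
Proof.
move=> mN; transitivity (((log_deriv N H)`_m)%:~R : rat).
  by rewrite coef_log_deriv // rmorph_sum; apply: eq_bigr => x _; rewrite rmorph_nat.
have a0 : (log_deriv N H)`_0 = 0.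
  rewrite coef_sum big_seq big1 // => x /Hpos x0; rewrite coef_sum big_seq big1 // => k.
  rewrite mem_iota mulr_natl coefMn coefXn => /andP[k0 _].
  by rewrite ltn_eqF ?mul0rn // muln_gt0 k0 x0.
apply: (@lucas_rec N (fun m => (log_deriv N H)`_m)) => // {mN}m mN.
have h := log_derivE (N := N) Hpos.
have : ((log_deriv N H) * (1 - 'X - 'X^2))`_m = (- ('X * (1 - 'X - 'X^2)^`()))`_m.
  rewrite -(eqXM (@eqX_refl N (log_deriv N H)) qE mN) h //.
  by apply: eqXN mN; exact: eqX_derivX.
rewrite !mulrBr mulr1 !coefB coefMX coefMXn coefN coefXM coef_deriv !coefB coef1 coefX coefXn.
move: (log_deriv N H) a0 => p a0; case: m mN => [|[|[|m]]] mN /=.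
- by rewrite a0.
- by rewrite a0 => /eqP; rewrite !subr0 => /eqP ->.
- rewrite subn2 /= a0 => /eqP; rewrite subr0 subr_eq sub0r mulNrn opprK => /eqP ->.
  by rewrite !addr0 addrC.
- rewrite subn2 /= !subr0 mul0rn oppr0 => /eqP; rewrite subr_eq0 => /eqP.
  by move/eqP; rewrite subr_eq => /eqP ->; rewrite addrC.
Qed.

(** With c_d Hall elements of weight d, Moebius inversion of [Hall_lucas] shows that the inner sum
    of [rank_R] at m = i - j equals c_m; the outer sum runs over the weights from 2 to i. *)
Lemma Hall_count_rank i : (2 <= i <= N)%N ->
  (count (fun x : nat * G => 2 <= x.1 <= i)%N H)%:R = rank_R i.
Proof.
move=> /andP[i2 iN]; rewrite /rank_R.
pose c (d : nat) := count (fun x : nat * G => x.1 == d) H.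
have sumH m : (0 < m <= N)%N -> lucas m = \sum_(d < m.+1 | (d %| m)%N) (d * c d)%:R.
  move=> mN; rewrite -(Hall_lucas mN) /c; elim: (H) => [|x s IH].
    by rewrite big_nil big1 // => d _; rewrite muln0.
  rewrite big_cons /= IH; under [in RHS]eq_bigr do rewrite mulnDr natrD.
  rewrite big_split /=; case: ifP => xm.
    congr (_ + _); have xle : (x.1 < m.+1)%N by rewrite ltnS dvdn_leq //; case/andP: mN.
    rewrite (bigD1 (Ordinal xle)) //= eqxx muln1 big1 ?addr0 // => d /andP[_ dx].
    case: eqP => [e|]; last by rewrite muln0.
    by case/eqP: dx; apply: val_inj.
  rewrite [X in _ = X + _]big1 ?add0r // => d dm; case: eqP => [e|]; last by rewrite muln0.
  by rewrite e dm in xm.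
have inner m : (2 <= m <= N)%N -> \sum_(k <- divisors m | (1 < k)%N)
    (moebius (m %/ k))%:~R * (k%:R * alpha k / m%:R) = (c m)%:R :> rat.
  move=> /andP[m2 mN]; have m0 : (0 < m)%N by exact: ltnW.
  have mR : m%:R != 0 :> rat by rewrite pnatr_eq0 -lt0n.
  have dpos k : k \in divisors m -> (0 < k)%N.
    by rewrite -dvdn_divisors // => /dvdn_gt0; exact.
  (* Here k [alpha k] is L_k - 1, and the missing term k = 1 may be restored because L_1 = 1. *)
  transitivity (m%:R^-1 * \sum_(k <- divisors m) (moebius (m %/ k))%:~R * (lucas k - 1)).
    rewrite mulr_sumr big_mkcond /= big_seq [RHS]big_seq; apply: eq_bigr => k /dpos k0.
    have [k1|] := ltnP 1 k.
      by rewrite /alpha mulVKf ?pnatr_eq0 -?lt0n // /lucas; ring.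
    by case: k k0 => [|[|//]] // _ _; rewrite lucas1 subrr !mulr0.
  under eq_bigr do rewrite mulrBr; rewrite sumrB.
  rewrite (@moebius_inversion (fun d => (d * c d)%:R) lucas m m0); last first.
    by move=> k /andP[k0 km]; apply: sumH; rewrite k0 (leq_trans km).
  (* The constants -1 add up to the Moebius inverse of the function 1, which is zero since m > 1. *)
  rewrite (@moebius_inversion (fun d => (d == 1%N)%:R) (fun=> 1) m m0); last first.
    move=> k /andP[k0 _]; rewrite (bigD1 (inord 1)) /= inordK ?ltnS ?dvd1n // eqxx.
    rewrite big1 ?addr0 // => d /andP[_ /eqP d1]; case: eqP => // e; case: d1.
    by apply: val_inj; rewrite /= inordK.
  by rewrite gtn_eqF // subr0 natrM mulrA mulVf // mul1r.
transitivity (\sum_(2 <= m < i.+1) (c m)%:R : rat).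
  rewrite -natr_sum; congr (_%:R); rewrite /c; elim: (H) => [|x s IH].
    by rewrite big1.
  rewrite /= IH big_split /=; congr addn.
  case: (boolP (2 <= x.1 <= i)%N) => h.
    rewrite (bigD1_seq x.1) ?iota_uniq ?mem_index_iota //= eqxx big1 ?addn0 // => j jx.
    by rewrite eq_sym (negbTE jx).
  rewrite big_seq big1 // => j; rewrite mem_index_iota ltnS => hj.
  by case: eqP => // e; rewrite e hj in h.
rewrite -[2%N]add0n big_addn [RHS]big_nat_rev /= add0n !subSS.
have -> : i.-1 = (i - 1)%N by lia.
rewrite !big_seq; apply: eq_bigr => j; rewrite mem_index_iota => /andP[_ ji].
have -> : (i - (i - 1 - j.+1))%N = (j + 2)%N by lia.
by rewrite inner //; apply/andP; split; lia.
Qed.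

End HallRank.

(** * A Poincare-Birkhoff-Witt basis over F_2 *)

Section PBW.
Variable N : nat.
Local Notation F2 := 'F_2.
Local Notation fn := (seq bool -> F2).
Local Notation op := (fn -> fn).

(* Letters of weight 1 (false) and 2 (true). *)
Definition wt (w : seq bool) : nat := size w + count id w.

Definition unit_fn : fn := fun w => (w == [::])%:R.
Definition op_comm (p q : op) : op := fun f => p (q f) - q (p f).
Definition op_add (p : op) : Prop := {morph p : f g / f + g}.

Lemma op_add0 p : op_add p -> p 0 = 0.
Proof. by move=> h; apply: (addrI (p 0)); rewrite -h !addr0. Qed.
Lemma op_addN p f : op_add p -> p (- f) = - p f.
Proof. by move=> h; apply: (addrI (p f)); rewrite -h !subrr op_add0. Qed.
Lemma op_addB p f g : op_add p -> p (f - g) = p f - p g.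
Proof. by move=> h; rewrite h op_addN. Qed.
Lemma op_comm_add p q : op_add p -> op_add q -> op_add (op_comm p q).
Proof. by move=> hp hq f g; rewrite /op_comm hq hp hp hq addrACA opprD. Qed.

Implicit Types X Y H : seq (nat * op).

(** The part of weight m of the cyclic module generated by the constant series 1 under the operators
    of X; over F_2, closure under sums is closure under linear combinations. *)
Inductive gspan X : nat -> fn -> Prop :=
| gspan_unit : gspan X 0 unit_fn
| gspan_zero m : gspan X m 0
| gspan_add m f g : gspan X m f -> gspan X m g -> gspan X m (f + g)
| gspan_op x m f : x \in X -> gspan X m f -> gspan X (x.1 + m) (x.2 f).

Inductive pspan (x : nat * op) X : nat -> fn -> Prop :=
| pspan_in m f : gspan X m f -> pspan x X m f
| pspan_add m f g : pspan x X m f -> pspan x X m g -> pspan x X m (f + g)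
| pspan_op m f : pspan x X m f -> pspan x X (x.1 + m) (x.2 f).

Inductive lspan (s : seq fn) : fn -> Prop :=
| lspan_zero : lspan s 0
| lspan_add f g : lspan s f -> lspan s g -> lspan s (f + g)
| lspan_in f : f \in s -> lspan s f.

(** Write y x = x y + [y, x]. Since [y, x] again belongs to the eliminated list, every occurrence of
    x can be moved to the left. *)
Lemma gspan_elim (x : nat * op) Y X m f : (0 < x.1)%N -> perm_eq X (x :: Y) ->
  (forall y : nat * op, y \in X -> op_add y.2) ->
  gspan X m f -> (m <= N)%N -> pspan x (elim_list op_comm N x Y) m f.
Proof.
move=> x0 pX hX; set X' := elim_list _ _ _ _.
have xA : op_add x.2 by apply: hX; rewrite (perm_mem pX) inE eqxx.
have X'A (y : nat * op) : y \in X' -> op_add y.2.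
  move=> /elim_listP[z [k [zY _ ->]]] /=.
  have zA : op_add z.2 by apply: hX; rewrite (perm_mem pX) inE zY orbT.
  by elim: k => //= k IH; exact: op_comm_add.
have X'x (y : nat * op) : y \in X' -> (y.1 + x.1 <= N)%N ->
    ((y.1 + x.1)%N, op_comm y.2 x.2) \in X'.
  move=> /elim_listP[z [k [zY _ ->]]] /= le.
  have /= := @mem_elim_list _ op_comm N x z k.+1 Y x0 zY.
  by rewrite mulSnr addnA => /(_ le).
have cl : forall m f, pspan x X' m f -> forall y : nat * op, y \in X' ->
    (y.1 + m <= N)%N -> pspan x X' (y.1 + m) (y.2 f).
  move=> {}m {}f; elim=> {m f} [m f hf|m f g _ IHf _ IHg|m f hf IH] y yX le.
  - by apply: pspan_in; exact: gspan_op.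
  - by rewrite X'A //; apply: pspan_add; [exact: IHf|exact: IHg].
  have -> : y.2 (x.2 f) = x.2 (y.2 f) + op_comm y.2 x.2 f.
    by rewrite /op_comm addrC subrK.
  apply: pspan_add.
    by rewrite addnCA; apply: pspan_op; apply: IH => //; lia.
  rewrite addnA; apply: (IH ((y.1 + x.1)%N, op_comm y.2 x.2)) => /=.
    by apply: X'x => //; lia.
  by rewrite -addnA.
elim=> {m f} [|m|m f g _ IHf _ IHg|y m f yX _ IH] le.
- exact/pspan_in/gspan_unit.
- exact/pspan_in/gspan_zero.
- by apply: pspan_add; [exact: IHf|exact: IHg].
move: yX; rewrite (perm_mem pX) inE => /predU1P[->|yY].
  by apply: pspan_op; apply: IH; lia.
apply: cl => //; first by apply: IH; lia.
have /= := @mem_elim_list _ op_comm N x y 0 Y x0 yY.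
rewrite mul0n addn0 -surjective_pairing; apply.
exact: leq_trans (leq_addr _ _) le.
Qed.

(** [pbw H m] lists the ordered monomials of weight m in the elements of H, applied to the constant
    series 1. [pbw_step] inserts the powers of the first factor, with n as fuel. *)
Fixpoint pbw_step (x : nat * op) (s : nat -> seq fn) (n m : nat) : seq fn :=
  s m ++ (if n is n'.+1 then
            if (x.1 <= m)%N then map x.2 (pbw_step x s n' (m - x.1)) else [::]
          else [::]).

Fixpoint pbw H (m : nat) : seq fn :=
  if H is x :: H' then pbw_step x (pbw H') m m
  else if m == 0%N then [:: unit_fn] else [::].

Lemma pbw_step_fuel x s n n' m : (0 < x.1)%N -> (m <= n)%N -> (m <= n')%N ->
  pbw_step x s n m = pbw_step x s n' m.
Proof.
move=> x0; elim: n n' m => [|n IH] [|n'] m le le' //=.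
- by move: le; rewrite leqn0 => /eqP->; rewrite leqNgt x0.
- by move: le'; rewrite leqn0 => /eqP->; rewrite leqNgt x0.
by case: leqP => // xm; rewrite (IH n') //; lia.
Qed.

Lemma pbw_cons x H m : (0 < x.1)%N ->
  pbw (x :: H) m = pbw H m ++ (if (x.1 <= m)%N then map x.2 (pbw (x :: H) (m - x.1)) else [::]).
Proof.
move=> x0; case: m => [|m] /=; first by rewrite leqNgt x0.
by case: ifP => // xm; rewrite (@pbw_step_fuel _ _ m (m.+1 - x.1)) //; lia.
Qed.

Lemma pbw_nil m : pbw [::] m = if m == 0%N then [:: unit_fn] else [::].
Proof. by []. Qed.

#[local] Arguments pbw : simpl never.

Lemma lspan_sub s s' f : {subset s <= s'} -> lspan s f -> lspan s' f.
Proof.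
move=> ss'; elim=> [|{}f g _ hf _ hg|{}f fs]; [exact: lspan_zero|exact: lspan_add|].
by apply: lspan_in; exact: ss'.
Qed.

Lemma lspan_map p s f : op_add p -> lspan s f -> lspan (map p s) (p f).
Proof.
move=> pA; elim=> [|{}f g _ hf _ hg|{}f fs].
- by rewrite op_add0 //; exact: lspan_zero.
- by rewrite pA; exact: lspan_add.
- by apply: lspan_in; exact: map_f.
Qed.

(** By [gspan_elim] each elimination step splits off the powers of one generator on the left; what
    remains at the end has weight above N, so only constants survive. *)
Lemma pbw_span X H : Hall op_comm N X H ->
  (forall x : nat * op, x \in X -> (0 < x.1)%N /\ op_add x.2) ->
  forall m f, (m <= N)%N -> gspan X m f -> lspan (pbw H m) f.
Proof.
elim=> [{}X /allP hX _|{}X x Y {}H pX _ IH hX] m f mN hf.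
  have : m = 0%N \/ f = 0.
    elim: hf mN => {m f} [|m|m f g _ IHf _ IHg|x m f xX _ _] mN; [by left|by right| |].
      have [->|->] := IHf mN; first by left.
      by have [->|->] := IHg mN; [left|rewrite addr0; right].
    by have /= h := hX _ xX; move: (leq_trans (leq_addr _ _) mN); rewrite leqNgt h.
  case=> [m0|->]; last exact: lspan_zero.
  rewrite m0 -[pbw _ _]/[:: unit_fn].
  elim: hf m0 mN => {m f} [|m|m f g _ IHf _ IHg|x m f xX _ _] m0 mN.
  - by apply: lspan_in; rewrite inE.
  - exact: lspan_zero.
  - by apply: lspan_add; [exact: IHf|exact: IHg].
  - by have /= h := hX _ xX; move: (leq_trans (leq_addr _ _) mN); rewrite leqNgt h.
have [x0 xA] : (0 < x.1)%N /\ op_add x.2 by apply: hX; rewrite (perm_mem pX) inE eqxx.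
have X'A (y : nat * op) : y \in elim_list op_comm N x Y -> (0 < y.1)%N /\ op_add y.2.
  move=> /elim_listP[z [k [zY _ ->]]] /=.
  have [z0 zA] : (0 < z.1)%N /\ op_add z.2 by apply: hX; rewrite (perm_mem pX) inE zY orbT.
  by split; [rewrite ltn_addr|elim: k => //= k IHk; exact: op_comm_add].
have : pspan x (elim_list op_comm N x Y) m f.
  by apply: (gspan_elim x0 pX) hf mN => y /hX[].
move=> hp; elim: hp mN => {hf m f} [m f hf|m f g _ IHf _ IHg|m f hf IHf] mN.
- rewrite pbw_cons //; apply: (@lspan_sub (pbw H m)).
    by move=> u us; rewrite mem_cat us.
  exact: IH.
- by apply: lspan_add; [exact: IHf|exact: IHg].
rewrite pbw_cons // leq_addr addKn.
apply: (@lspan_sub (map x.2 (pbw (x :: H) m))).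
  by move=> u us; rewrite mem_cat us orbT.
by apply: lspan_map => //; apply: IHf; lia.
Qed.

Lemma pbw0 H : (forall x : nat * op, x \in H -> (0 < x.1)%N) -> pbw H 0 = [:: unit_fn].
Proof.
elim: H => // x H IH hH; have x0 : (0 < x.1)%N by apply: hH; rewrite inE eqxx.
rewrite pbw_cons // leqNgt x0 cats0; apply: IH => y yH.
by apply: hH; rewrite inE yH orbT.
Qed.

Lemma pbw_gens H m : (0 < m)%N -> (forall x : nat * op, x \in H -> (0 < x.1)%N) ->
  exists s, perm_eq (pbw H m) ([seq x.2 unit_fn | x <- H & x.1 == m] ++ s).
Proof.
move=> m0; elim: H => [|x H IH] hH.
  by exists [::]; rewrite pbw_nil gtn_eqF.
have x0 : (0 < x.1)%N by apply: hH; rewrite inE eqxx.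
have [|s hs] := IH; first by move=> y yH; apply: hH; rewrite inE yH orbT.
rewrite pbw_cons //=; case: eqP => [xm|_].
  rewrite xm leqnn subnn pbw0 //=; exists s.
  by rewrite perm_catC /= perm_cons.
exists (s ++ (if (x.1 <= m)%N then map x.2 (pbw (x :: H) (m - x.1)) else [::])).
by rewrite catA perm_cat2r.
Qed.

Fixpoint words (m : nat) : seq (seq bool) :=
  match m with
  | 0 => [:: [::]]
  | 1 => [:: [:: false]]
  | (m''.+1 as m').+1 => map (cons false) (words m') ++ map (cons true) (words m'')
  end.

Lemma mem_words m w : (w \in words m) = (wt w == m).
Proof.
have main n : forall m w, (m <= n)%N -> (w \in words m) = (wt w == m).
  elim: n => [|n IH] {}m {}w.
    by rewrite leqn0 => /eqP ->; case: w => [|[] w].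
  case: m => [|[|m]] le; first by case: w => [|[] w].
    case: w => [|[] w]; rewrite /wt //= !inE; first by apply/esym/negbTE; lia.
    rewrite eqseq_cons /= add0n addSn eqSS -/(wt w).
    by rewrite -(IH 0%N) ?inE.
  rewrite -[words _]/(map (cons false) (words m.+1) ++ map (cons true) (words m)) mem_cat.
  case: w => [|[] w].
  - by apply/negbTE; rewrite negb_or; apply/andP; split; apply/mapP => -[].
  - rewrite (mem_map (fun u v => @congr1 _ _ behead (_ :: u) (_ :: v))) IH; last by lia.
    rewrite /wt /= addSn addnCA add1n !eqSS (_ : _ \in _ = false) //.
    by apply/mapP => -[].
  - rewrite (mem_map (fun u v => @congr1 _ _ behead (_ :: u) (_ :: v))) IH; last by lia.
    rewrite /wt /= add0n addSn eqSS (_ : (_ \in map (cons true) _) = false) ?orbF //.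
    by apply/mapP => -[].
exact: (main m).
Qed.

Lemma size_wordsSS m : size (words m.+2) = (size (words m.+1) + size (words m))%N.
Proof. by rewrite size_cat !size_map. Qed.

Definition series_of (a : nat -> nat) : {poly int} := \poly_(i < N.+1) (a i)%:R.

Lemma coef_series a k : (k <= N)%N -> (series_of a)`_k = (a k)%:R.
Proof. by move=> kN; rewrite coef_poly ltnS kN. Qed.

Lemma words_series :
  eqX N (series_of (fun m => size (words m)) * (1 - 'X - 'X^2)) 1.
Proof.
move=> k kN; rewrite !mulrBr mulr1 !coefB coefMX coefMXn coef1.
case: k kN => [|[|k]] kN /=; rewrite ?coef_series //; try lia.
by rewrite subn2 /= size_wordsSS natrD addrAC addrK addrN.
Qed.

Lemma pbw_series H : (forall x : nat * op, x \in H -> (0 < x.1)%N) ->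
  eqX N (series_of (fun m => size (pbw H m)) * hall_prod H) 1.
Proof.
elim: H => [|x H IH] hH.
  rewrite /hall_prod big_nil mulr1 => k kN; rewrite coef_series // coef1 pbw_nil.
  by case: k {kN}.
have x0 : (0 < x.1)%N by apply: hH; rewrite inE eqxx.
rewrite /hall_prod big_cons mulrA.
apply: eqX_trans (IH _); last by move=> y yH; apply: hH; rewrite inE yH orbT.
apply: eqXM => // k kN; rewrite mulrBr mulr1 coefB coefMXn !coef_series ?(leq_trans (leq_subr _ _)) //.
rewrite pbw_cons // size_cat; case: leqP => xk; last by rewrite addn0 subr0.
by rewrite size_map natrD addrK.
Qed.

(** The monomials are counted by the inverse of [hall_prod H] and the words by the inverse of 1 - X
    - X^2; the two agree by [hall_prodE]. *)
Lemma size_pbw (t v : op) H : Hall op_comm N [:: (1%N, t); (2%N, v)] H ->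
  forall m, (m <= N)%N -> size (pbw H m) = size (words m).
Proof.
move=> hH m mN.
have Xpos (x : nat * op) : x \in [:: (1%N, t); (2%N, v)] -> (0 < x.1)%N.
  by rewrite !inE => /orP[/eqP->|/eqP->].
have Hpos := Hall_pos hH Xpos.
have qE : eqX N (hall_prod H) (1 - 'X - 'X^2).
  apply: eqX_trans (hall_prodE hH Xpos) _.
  by rewrite /gen_sum big_cons big_seq1 expr1 opprD addrA.
suff h : eqX N (series_of (fun m => size (pbw H m))) (series_of (fun m => size (words m))).
  by have := h m mN; rewrite !coef_series // => /eqP; rewrite eqr_nat => /eqP.
set p := series_of _; set w := series_of _.
apply: (@eqX_trans _ (p * (w * (1 - 'X - 'X^2)))).
  rewrite -[X in eqX _ X]mulr1; apply: eqXM => //; apply: eqX_sym; exact: words_series.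
apply: (@eqX_trans _ (w * (p * hall_prod H))).
  rewrite mulrCA; apply: eqXM => //; apply: eqXM => //; exact: eqX_sym.
rewrite -[X in eqX _ _ X]mulr1; apply: eqXM => //; exact: pbw_series.
Qed.

Definition coords (m : nat) (f : fn) : 'rV[F2]_(size (words m)) :=
  \row_i f (nth [::] (words m) i).

Lemma coordsD m f g : coords m (f + g) = coords m f + coords m g.
Proof. by apply/rowP => i; rewrite !mxE. Qed.

Lemma lspan_coords m s f : lspan s f -> coords m f \in <<map (coords m) s>>%VS.
Proof.
elim=> [|{}f g _ hf _ hg|{}f fs].
- by rewrite (_ : coords m 0 = 0) ?mem0v //; apply/rowP => i; rewrite !mxE.
- by rewrite coordsD rpredD.
- by apply: memv_span; exact: map_f.
Qed.

Definition shift (b : bool) : op := fun f w =>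
  if w is c :: w' then if c == b then f w' else 0 else 0.

Lemma shift_add b : op_add (shift b).
Proof.
move=> f g; apply/funext => w; rewrite [RHS]/GRing.add/=.
by case: w => [|c w] /=; rewrite ?addr0 //; case: ifP; rewrite ?addr0.
Qed.

Lemma uniq_words m : uniq (words m).
Proof.
have main n : forall m, (m <= n)%N -> uniq (words m).
  elim: n => [|n IH] {}m; first by rewrite leqn0 => /eqP ->.
  case: m => [|[|m]] // le.
  rewrite -[words _]/(map (cons false) (words m.+1) ++ map (cons true) (words m)) cat_uniq.
  rewrite !map_inj_uniq; try by move=> u v [].
  rewrite !IH ?andbT /=; try lia.
  by apply/hasPn => _ /mapP[u _ ->]; apply/mapP => -[].
exact: (main m).
Qed.

(** The ordered monomials span all functions on the words of weight m, and there are as many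
    monomials as words, so they form a basis. *)
Lemma pbw_free H : Hall op_comm N [:: (1%N, shift false); (2%N, shift true)] H ->
  forall m, (m <= N)%N -> free (map (coords m) (pbw H m)).
Proof.
move=> hH m mN; set X := [:: _; _] in hH.
have XP (x : nat * op) : x \in X -> (0 < x.1)%N /\ op_add x.2.
  by rewrite !inE => /orP[/eqP->|/eqP->]; split=> //; exact: shift_add.
have full : (fullv <= <<map (coords m) (pbw H m)>>)%VS.
  apply/subvP => u _; rewrite [u]row_sum_delta; apply: rpred_sum => i _; apply: rpredZ.
  set w := nth [::] (words m) i.
  have wm : wt w = m by apply/eqP; rewrite -mem_words mem_nth.
  have -> : delta_mx 0 i = coords m (fun w' => (w' == w)%:R).
    by apply/rowP => j; rewrite !mxE /= /w nth_uniq ?uniq_words //.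
  apply: lspan_coords; apply: pbw_span hH XP _ _ mN _.
  rewrite -wm; elim: w {wm} => [|b w IH]; first exact: gspan_unit.
  have -> : (fun w' => (w' == b :: w)%:R) = shift b (fun w' => (w' == w)%:R : F2).
    by apply/funext => -[|c w'] //=; rewrite eqseq_cons; case: eqP.
  rewrite (_ : wt (b :: w) = ((if b then 2 else 1) + wt w)%N); last first.
    by rewrite /wt /=; case: b => /=; lia.
  by case: b; [apply: (@gspan_op X (2%N, shift true))|
     apply: (@gspan_op X (1%N, shift false))]; rewrite ?inE ?eqxx ?orbT.
rewrite /free eqn_leq dim_span size_map (size_pbw hH mN) /=.
by apply: leq_trans (dimvS full); rewrite dimvf dim_matrix mul1r.
Qed.

(** A single Hall operator is an ordered monomial with one factor, so these vectors are part of the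
    basis [pbw_free]. *)
Lemma hall_free H : Hall op_comm N [:: (1%N, shift false); (2%N, shift true)] H ->
  forall m, (0 < m <= N)%N ->
  free [seq coords m (x.2 unit_fn) | x <- H & x.1 == m].
Proof.
move=> hH m /andP[m0 mN]; have Hpos : forall x : nat * op, x \in H -> (0 < x.1)%N.
  by apply: (Hall_pos hH) => x; rewrite !inE => /orP[/eqP->|/eqP->].
have [s hs] := pbw_gens m0 Hpos.
have := pbw_free hH mN; rewrite (perm_free (perm_map _ hs)) map_cat -map_comp.
exact: catl_free.
Qed.

End PBW.

(** * The automorphism group of an abelian group *)

Section AdditiveBijections.
Local Open Scope group_scope.
Variable V : zmodType.

Record addbij := AddBij {
  ab_fun :> V -> V;
  ab_inv : V -> V;
  ab_add : {morph ab_fun : x y / (x + y)%R};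
  ab_funK : cancel ab_fun ab_inv;
  ab_invK : cancel ab_inv ab_fun }.

HB.instance Definition _ := gen_eqMixin addbij.
HB.instance Definition _ := gen_choiceMixin addbij.

Lemma addbijP (f g : addbij) : f =1 g -> f = g.
Proof.
case: f g => [f f' fA fK f'K] [g g' gA gK g'K] /= /funext fg.
have fg' : f' = g'.
  by apply/funext => x; rewrite -{1}(g'K x) -fg fK.
move: fA fK f'K gA gK g'K; rewrite fg fg' => *.
by congr AddBij; exact: Prop_irrelevance.
Qed.

Lemma ab_inv_add (f : addbij) : {morph ab_inv f : x y / (x + y)%R}.
Proof. by move=> x y; apply: (can_inj (ab_funK f)); rewrite ab_add !ab_invK. Qed.

Definition ab_one : addbij :=
  @AddBij id id (fun _ _ => erefl) (fun _ => erefl) (fun _ => erefl).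
Lemma ab_mul_add (f g : addbij) : {morph f \o g : x y / (x + y)%R}.
Proof. by move=> x y /=; rewrite !ab_add. Qed.
Definition ab_mul (f g : addbij) : addbij :=
  AddBij (ab_mul_add f g) (can_comp (ab_funK f) (ab_funK g))
    (can_comp (ab_invK g) (ab_invK f)).
Definition ab_inverse (f : addbij) : addbij :=
  AddBij (ab_inv_add f) (ab_invK f) (ab_funK f).

Lemma ab_mulA : associative ab_mul. Proof. by move=> f g h; exact: addbijP. Qed.
Lemma ab_mul1 : left_id ab_one ab_mul. Proof. by move=> f; exact: addbijP. Qed.
Lemma ab_mulr1 : right_id ab_one ab_mul. Proof. by move=> f; exact: addbijP. Qed.
Lemma ab_mulV : left_inverse ab_one ab_inverse ab_mul.
Proof. by move=> f; apply: addbijP => x /=; rewrite ab_funK. Qed.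
Lemma ab_mulrV : right_inverse ab_one ab_inverse ab_mul.
Proof. by move=> f; apply: addbijP => x /=; rewrite ab_invK. Qed.

HB.instance Definition _ := isGroup.Build addbij ab_mulA ab_mul1 ab_mulr1 ab_mulV ab_mulrV.

Lemma ab1E (x : V) : (1 : addbij) x = x. Proof. by []. Qed.
Lemma abME (f g : addbij) (x : V) : (f * g) x = f (g x). Proof. by []. Qed.

End AdditiveBijections.

(** * A filtered representation of Z2 * Z on power series *)

(* Z[[Y, V]], the noncommutative power series over words in Y = false and
   V = true, carries an action of Z2 * Z: t is left multiplication by 1 + Y and
   a is the automorphism Y |-> Y + V, V |-> - V. *)
Section Representation.
Local Notation M := (seq bool -> int).
Implicit Types f g : M.

Lemma fDE f g w : (f + g) w = f w + g w. Proof. by []. Qed.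
Lemma fNE f w : (- f) w = - f w. Proof. by []. Qed.

Definition act_t f : M := fun w =>
  f w + (if w is false :: w' then f w' else 0).

(** Left multiplication by the inverse of 1 + Y: the equation g = f - Y g is solved along the
    word. *)
Fixpoint act_tV_word f (w : seq bool) : int :=
  match w with
  | [::] => f [::]
  | true :: _ => f w
  | false :: w' => f w - act_tV_word f w'
  end.
Definition act_tV f : M := act_tV_word f.

Lemma act_tD : {morph act_t : f g / f + g}.
Proof.
move=> f g; apply/funext => w; rewrite [in RHS]/GRing.add/= /act_t.
by case: w => [|[] w]; rewrite ?addr0 //; rewrite addrACA.
Qed.

Lemma act_tK : cancel act_t act_tV.
Proof.
move=> f; apply/funext; elim=> [|[] w IH]; rewrite /act_tV /= /act_t ?addr0 //.
by rewrite [act_tV_word _ _]IH addrK.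
Qed.

Lemma act_tVK : cancel act_tV act_t.
Proof.
by move=> f; apply/funext; case=> [|[] w]; rewrite /act_t /act_tV /= ?addr0 // subrK.
Qed.

Fixpoint act_a_word (w : seq bool) f : int :=
  match w with
  | [::] => f [::]
  | b :: w' => if b
      then act_a_word w' (f \o cons false) - act_a_word w' (f \o cons true)
      else act_a_word w' (f \o cons false)
  end.
Definition act_a f : M := act_a_word^~ f.

Lemma act_a_wordD w f g : act_a_word w (f + g) = act_a_word w f + act_a_word w g.
Proof.
elim: w f g => //= b w IH f g.
rewrite -![(f + g) \o _]/((f \o _) + (g \o _)) !IH.
by case: b => //; rewrite opprD addrACA.
Qed.

Lemma act_aD : {morph act_a : f g / f + g}.
Proof. by move=> f g; apply/funext => w; exact: act_a_wordD. Qed.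

Lemma act_aN f : act_a (- f) = - act_a f.
Proof.
apply: (addrI (act_a f)); rewrite -act_aD !subrr.
by apply: (addrI (act_a 0)); rewrite -act_aD !addr0.
Qed.

Lemma act_aK : involutive act_a.
Proof.
move=> f; apply/funext => w; elim: w f => // b w IH f; case: b; last exact: (IH (f \o _)).
have -> : act_a (act_a f) (true :: w) = act_a (act_a (f \o cons false)) w -
  act_a (act_a (f \o cons false) - act_a (f \o cons true)) w by [].
by rewrite act_aD act_aN fDE fNE !IH opprD opprK addrA subrr add0r.
Qed.

Definition rep_t : addbij M := AddBij act_tD act_tK act_tVK.
Definition rep_a : addbij M := AddBij act_aD act_aK act_aK.

Lemma rep_a2 : (rep_a * rep_a = 1)%g.
Proof. by apply: addbijP => f /=; rewrite act_aK. Qed.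

Definition rep : {multiplicative Z2_star_Z -> addbij M} := zmap rep_t rep_a2.

Lemma rep_za : rep za = rep_a. Proof. exact: zmap_a. Qed.
Lemma rep_zt : rep zt = rep_t. Proof. exact: zmap_t. Qed.

(* The powers of the augmentation ideal act on these subgroups by raising k;
   the prime 2 has weight one, except on the powers of Y. *)
Definition filt (k : nat) f : Prop :=
  (forall w, exists z, f w = 2 ^+ (k - wt w) * z) /\
  (forall m, (m < k)%N -> f (nseq m false) = 0).

Lemma filtD k f g : filt k f -> filt k g -> filt k (f + g).
Proof.
move=> [hf hf0] [hg hg0]; split=> [w|m mk].
  have [z hz] := hf w; have [z' hz'] := hg w.
  by exists (z + z'); rewrite mulrDr -hz -hz'.
by rewrite [LHS]/(_ + _) hf0 // hg0.
Qed.

Lemma filtN k f : filt k f -> filt k (- f).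
Proof.
move=> [hf hf0]; split=> [w|m mk].
  by have [z hz] := hf w; exists (- z); rewrite mulrN -hz.
by rewrite [LHS]/(- _) hf0 // oppr0.
Qed.

Lemma filtB k f g : filt k f -> filt k g -> filt k (f - g).
Proof. by move=> hf hg; apply: filtD => //; exact: filtN. Qed.

Lemma filt0 k : filt k 0.
Proof. by split=> [w|m _] //; exists 0; rewrite mulr0. Qed.

Lemma filt_le j k f : (j <= k)%N -> filt k f -> filt j f.
Proof.
move=> jk [hf hf0]; split=> [w|m mk]; last by apply: hf0; exact: leq_trans jk.
have [z hz] := hf w; exists (2 ^+ (k - wt w - (j - wt w)) * z).
by rewrite hz mulrA -exprD; congr (2 ^+ _ * _); lia.
Qed.

Lemma filt_double_succ k f : filt k f -> (forall m, f (nseq m false) = 0) ->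
  filt k.+1 (f *+ 2).
Proof.
move=> [hf hf0] hY; split=> [w|m mk]; last by rewrite mulr2n fDE hY.
have [z hz] := hf w; rewrite mulr2n fDE hz.
have [h|h] := leqP (wt w) k.
  by exists z; rewrite subSn // exprS; ring.
by exists (z + z); rewrite (_ : (k - wt w = 0)%N); [|lia]; rewrite (_ : (k.+1 - wt w = 0)%N); [ring|lia].
Qed.

Definition deep (n : nat) (x : addbij M) : Prop :=
  forall k f, filt k f -> filt (k + n) (x f - f).

Lemma deep1_t : deep 1 rep_t.
Proof.
move=> k f [hf hf0].
have e w : (rep_t f - f) w = if w is false :: w' then f w' else 0.
  by rewrite fDE fNE /= /act_t addrAC subrr add0r.
split=> [w|m mk]; rewrite e.
  case: w => [|[] w]; [by exists 0; rewrite mulr0..|].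
  have [z hz] := hf w; exists z; rewrite hz; congr (2 ^+ _ * _).
  by rewrite /wt /=; lia.
by case: m mk => // m mk; apply: hf0; lia.
Qed.

(** Write f = f_0 + Y f_Y + V f_V. The coefficient of a f - f at V w is that of a(f_Y) - (a - 1) f_V
    - 2 f_V at w, and each term is divisible by one more 2 than f is required to be. Coefficients at
    powers of Y do not change under a. *)
Lemma deep1_a : deep 1 rep_a.
Proof.
have div_a w f k : (forall w, exists z, f w = 2 ^+ (k - wt w) * z) ->
    (exists z, act_a f w = 2 ^+ (k - wt w) * z) /\
    (exists z, act_a f w - f w = 2 ^+ (k.+1 - wt w) * z).
  elim: w f k => [|b w IH] f k hf.
    split; first exact: hf.
    by exists 0; rewrite subrr mulr0.
  have [|[z1 e1] [z2 e2]] := IH (f \o cons false) (k - 1)%N.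
    move=> u; have [z hz] := hf (false :: u); exists z; rewrite /= hz.
    by congr (2 ^+ _ * _); rewrite /wt /=; lia.
  case: b; last first.
    have w1 : wt (false :: w) = (wt w).+1 by rewrite /wt /= add0n addSn.
    split; first by exists z1; rewrite [LHS]e1 w1; congr (2 ^+ _ * _); lia.
    have [k0|k0] := posnP k.
      by exists (act_a f (false :: w) - f (false :: w)); rewrite w1 k0 subSS sub0n mul1r.
    by exists z2; rewrite [LHS]e2 w1; congr (2 ^+ _ * _); lia.
  have w2 : wt (true :: w) = (wt w).+2 by rewrite /wt /=; lia.
  have [|[z3 e3] [z4 e4]] := IH (f \o cons true) (k - 2)%N.
    move=> u; have [z hz] := hf (true :: u); exists z; rewrite /= hz.
    by congr (2 ^+ _ * _); rewrite /wt /=; lia.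
  have ea : act_a f (true :: w) = act_a (f \o cons false) w - act_a (f \o cons true) w by [].
  have [z5 e5] := hf (true :: w).
  rewrite ea w2; split.
    have [h|h] := leqP k (wt w).+2.
      by rewrite (_ : (k - _ = 0)%N); [eexists; rewrite mul1r|lia].
    exists (2 * z1 - z3); rewrite e1 e3.
    have -> : (k - 1 - wt w = (k - (wt w).+2).+1)%N by lia.
    have -> : (k - 2 - wt w = k - (wt w).+2)%N by lia.
    by rewrite exprS; ring.
  have [h|h] := leqP k (wt w).+1.
    by rewrite (_ : (k.+1 - _ = 0)%N); [eexists; rewrite mul1r|lia].
  exists (z1 - z4 - z5).
  have -> : act_a (f \o cons true) w = (act_a (f \o cons true) w - (f \o cons true) w) + f (true :: w).
    by rewrite subrK.
  rewrite e4 e5 e1 w2.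
  have -> : (k - 1 - wt w = (k - (wt w).+2).+1)%N by lia.
  have -> : ((k - 2).+1 - wt w = (k - (wt w).+2).+1)%N by lia.
  have -> : (k.+1 - (wt w).+2 = (k - (wt w).+2).+1)%N by lia.
  by rewrite !exprS; ring.
move=> k f [hf hf0]; split=> [w|m mk].
  by have [_] := div_a w f k hf; rewrite addn1.
have aY g n : act_a g (nseq n false) = g (nseq n false).
  by elim: n g => //= n IH g; rewrite [LHS]IH.
by rewrite fDE fNE /= aY subrr.
Qed.

Lemma deep_one n : deep n 1%g.
Proof. by move=> k f hf; rewrite ab1E subrr; exact: filt0. Qed.

Lemma deep_stable n x k f : deep n x -> filt k f -> filt k (x f).
Proof.
move=> hx hf; rewrite -[x f](subrK f); apply: filtD => //.
by apply: filt_le (hx _ _ hf); exact: leq_addr.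
Qed.

Lemma deepM n x y : deep n x -> deep n y -> deep n (x * y)%g.
Proof.
move=> hx hy k f hf; rewrite abME.
have -> : x (y f) - f = (x (y f) - y f) + (y f - f) by rewrite addrA subrK.
apply: filtD; last exact: hy.
by apply: hx; exact: deep_stable hy hf.
Qed.

Lemma ab_addN (x : addbij M) f : x (- f) = - x f.
Proof.
apply: (addrI (x f)); rewrite -ab_add !subrr.
by apply: (addrI (x 0)); rewrite -ab_add !addr0.
Qed.

Lemma ab_addB (x : addbij M) f g : x (f - g) = x f - x g.
Proof. by rewrite ab_add ab_addN. Qed.

Lemma ab_VK (x : addbij M) f : (x^-1)%g (x f) = f.
Proof. by rewrite -abME mulVg. Qed.

Lemma ab_KV (x : addbij M) f : x ((x^-1)%g f) = f.
Proof. by rewrite -abME mulgV. Qed.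

(* It suffices to treat generators for which the inverse is filtered too. *)
Lemma deepV n x : deep n x -> (forall k f, filt k f -> filt k ((x^-1)%g f)) ->
  deep n (x^-1)%g.
Proof.
move=> hx hV k f hf; have -> : (x^-1)%g f - f = - (x^-1)%g (x f - f).
  by rewrite ab_addB ab_VK opprB.
by apply: filtN; apply: hV; exact: hx.
Qed.

Lemma filt_tV k f : filt k f -> filt k (act_tV f).
Proof.
move=> [hf hf0]; split=> [w|m mk].
  elim: w => [|b w [z hz]]; first exact: hf.
  case: b; first exact: hf.
  have [z' hz'] := hf (false :: w); rewrite /act_tV /= hz' [act_tV_word _ _]hz.
  have -> : wt (false :: w) = (wt w).+1 by rewrite /wt /= add0n addSn.
  have [h|h] := leqP k (wt w).
    by rewrite (_ : (k - _.+1 = 0)%N); [eexists; rewrite [RHS]mul1r|lia].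
  exists (z' - 2 * z); have -> : (k - wt w = (k - (wt w).+1).+1)%N by lia.
  by rewrite exprS; ring.
elim: m mk => [|m IH] mk; first exact: (hf0 0%N).
by rewrite /act_tV /= [act_tV_word _ _]IH ?subr0; [exact: (hf0 m.+1)|exact: ltnW].
Qed.

Lemma rep_filt (x : Z2_star_Z) k f : filt k f -> filt k (rep x f).
Proof.
have : (deep 1 (rep x) /\ deep 1 (rep x)^-1%g); last first.
  by move=> [h _]; exact: (deep_stable h).
have hS : is_subgroup [set g : Z2_star_Z | deep 1 (rep g) /\ deep 1 (rep g)^-1%g].
  split=> [|{}x y [hx hx'] [hy hy']] /=.
    by rewrite gm1 invg1; split; exact: deep_one.
  by rewrite gmulfM gmV invgM invgK; split; exact: deepM.
apply: (Z2_star_Z_gen hS) => /=.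
  rewrite rep_za (_ : rep_a^-1%g = rep_a); first by split; exact: deep1_a.
  by apply: mulg1_eq; exact: rep_a2.
rewrite rep_zt; split; first exact: deep1_t.
by apply: deepV; [exact: deep1_t|exact: filt_tV].
Qed.

Definition deepG n (g : Z2_star_Z) := deep n (rep g).

Lemma deepG_subgroup n : is_subgroup (deepG n).
Proof.
split=> [|x y hx hy]; first by rewrite /deepG gm1; exact: deep_one.
rewrite /deepG gmulfM gmV; apply: deepM => //.
by apply: deepV => // k f hf; rewrite -gmV; exact: rep_filt.
Qed.

Lemma deepG1 (g : Z2_star_Z) : deepG 1 g.
Proof.
apply: (Z2_star_Z_gen (deepG_subgroup 1)); rewrite /deepG.
  by rewrite rep_za; exact: deep1_a.
by rewrite rep_zt; exact: deep1_t.
Qed.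

(** The operator identity [g, h] - 1 = g^-1 h^-1 ((g - 1)(h - 1) - (h - 1)(g - 1)), which makes
    depth additive under commutators. *)
Lemma rep_comm (g h : Z2_star_Z) f : rep [~ g, h]%g f - f =
  rep (g^-1 * h^-1)%g ((rep g (rep h f - f) - (rep h f - f)) -
                       (rep h (rep g f - f) - (rep g f - f))).
Proof.
have -> : rep g (rep h f - f) - (rep h f - f) - (rep h (rep g f - f) - (rep g f - f)) =
    rep g (rep h f) - rep h (rep g f).
  by rewrite !ab_addB; apply/funext => w; rewrite !(fDE, fNE); ring.
rewrite ab_addB; congr (_ - _).
  by rewrite /commg /conjg !mulgA !gmulfM.
by rewrite gmulfM !gmV -[LHS](ab_VK (rep g)) -[in LHS](ab_VK (rep h) (rep g f)).
Qed.

Lemma deepG_comm m n (g h : Z2_star_Z) : deepG m g -> deepG n h -> deepG (m + n) [~ g, h]%g.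
Proof.
move=> hg hh k f hf; rewrite rep_comm; apply: rep_filt; apply: filtB.
  by rewrite (addnC m) addnA; apply: hg; exact: hh.
by rewrite addnA; apply: hh; exact: hg.
Qed.

(** Every element has depth 1, and depth adds under commutators just as indices do in the lower
    central series. *)
Lemma Gamma_deep n (g : Z2_star_Z) : Gamma Z2_star_Z n.+1 g -> deepG n.+1 g.
Proof.
elim: n g => [|n IH] g; first by move=> _; exact: deepG1.
apply: (generated_sub (deepG_subgroup n.+2)) => _ [x [y [hy ->]]].
by rewrite -[n.+2]add1n; apply: deepG_comm; [exact: deepG1|exact: IH].
Qed.

End Representation.

(** * Leading terms modulo 2 and independence of Hall elements *)

Section Symbols.
Local Notation M := (seq bool -> int).
Local Notation F2 := 'F_2.
Local Notation fn := (seq bool -> F2).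
Local Notation op := (fn -> fn).
Local Notation Gt := Z2_star_Z.
Implicit Types f : M.

(** The component of weight k modulo 2; on [filt k] it depends only on the class modulo
    [filt k.+1]. *)
Definition red (k : nat) f : fn := fun w => if wt w == k then (f w)%:~R else 0.

Lemma redD k f g : red k (f + g) = red k f + red k g.
Proof.
apply/funext => w; rewrite [RHS]/GRing.add/= /red.
by case: eqP => _; rewrite ?addr0 // fDE rmorphD.
Qed.

Lemma two_F2 : 2 = 0 :> F2. Proof. exact/val_inj. Qed.

Lemma red_filt k f : filt k.+1 f -> red k f = 0.
Proof.
move=> [hf _]; apply/funext => w; rewrite /red; case: eqP => // wk.
have [z ->] := hf w; rewrite wk subSn // subnn expr1 rmorphM /=.
by rewrite (_ : (2 : int)%:~R = 2) // two_F2 mul0r.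
Qed.

Lemma redB k f g : red k (f - g) = red k f - red k g.
Proof.
rewrite redD; congr (_ + _); apply/funext => w; rewrite [RHS]/GRing.opp/= /red.
by case: eqP => _; rewrite ?oppr0 // fNE rmorphN.
Qed.

Lemma red_rep (g : Gt) k f : filt k f -> red k (rep g f) = red k f.
Proof.
move=> hf; apply/eqP; rewrite -subr_eq0 -redB; apply/eqP/red_filt.
by rewrite -addn1; exact: deepG1.
Qed.

(** p is the leading term of g - 1: the operator that g - 1 induces modulo 2 from weight k to weight
    k + n. *)
Definition symbol (n : nat) (g : Gt) (p : op) : Prop :=
  [/\ op_add p, deepG n g &
      forall k f, filt k f -> red (k + n) (rep g f - f) = p (red k f)].

Lemma symbol_comm m n g h p q : symbol m g p -> symbol n h q ->
  symbol (m + n) [~ g, h]%g (op_comm p q).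
Proof.
move=> [pA dg hp] [qA dh hq]; split; [exact: op_comm_add|exact: deepG_comm|].
move=> k f hf; have h1 := dh _ _ hf; have h2 := dg _ _ hf.
have h3 := dg _ _ h1; have h4 := dh _ _ h2.
have e : (k + (m + n) = k + n + m)%N by lia.
have e' : (k + n + m = k + m + n)%N by lia.
rewrite rep_comm red_rep; last by rewrite e; apply: filtB => //; rewrite e'.
rewrite e redB hp // hq // /op_comm; congr (_ - _).
by rewrite e' hq // hp.
Qed.

Lemma symbol_t : symbol 1 zt (shift false).
Proof.
split; [exact: shift_add|exact: deepG1|move=> k f hf].
apply/funext => w; rewrite /red rep_zt fDE fNE /= /act_t addrAC subrr add0r.
case: w => [|[] w] /=; rewrite ?if_same //.
by rewrite /wt /= add0n addSn addn1 eqSS.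
Qed.

(** Conjugating t by a gives left multiplication by 1 + Y + V, so [t, a] - 1 is t^-1 composed with
    left multiplication by V. *)
Lemma rep_ata f : rep [~ zt, za]%g f - f =
  rep zt^-1%g (fun w => if w is true :: w' then f w' else 0).
Proof.
have za' : za^-1%g = za by apply: mulg1_eq; exact: za2.
have -> : f = rep zt^-1%g (rep zt f) by rewrite gmV ab_VK.
rewrite /commg /conjg gmulfM abME -ab_addB; congr (rep _ _).
rewrite gmV ab_VK za' !gmulfM !abME rep_za rep_zt /=.
rewrite /act_t -[X in act_a X]/(act_a f + (fun w => if w is false :: w' then act_a f w' else 0)).
rewrite act_aD act_aK; apply/funext => w; rewrite !(fDE, fNE) opprD addrACA subrr add0r.
have hz w' : act_a_word w' (fun=> 0) = 0 by elim: w' => //= b w' IH; rewrite !IH subr0 if_same.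
have haa w' : act_a_word w' (act_a f) = f w' by rewrite -[LHS]/(act_a (act_a f) w') act_aK.
case: w => [|[] w]; rewrite /act_a /= ?subr0 //.
  by rewrite -[X in X - _]/(act_a_word w (act_a f)) haa -[X in _ - X]/(act_a_word w (fun=> 0)) hz subr0.
by rewrite -[X in X - _]/(act_a_word w (act_a f)) haa subrr.
Qed.

Lemma symbol_v : symbol 2 [~ zt, za]%g (shift true).
Proof.
split; [exact: shift_add|by apply: (@deepG_comm 1 1); exact: deepG1|move=> k f hf].
rewrite rep_ata red_rep; last first.
  case: hf => hf hf0; split=> [[|[] w]|[|m] _] //; try by exists 0; rewrite mulr0.
  have [z ->] := hf w; exists z; congr (2 ^+ _ * _); rewrite /wt /=; lia.
apply/funext => -[|[] w]; rewrite /red /= ?if_same //.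
rewrite (_ : wt (true :: w) = wt w + 2)%N ?eqn_add2r //; rewrite /wt /=; lia.
Qed.

(** Group elements and operators are bracketed side by side, so that a single elimination produces
    Hall elements together with their symbols. *)
Definition pair_br (x y : Gt * op) : Gt * op := ([~ x.1, y.1]%g, op_comm x.2 y.2).

Definition hall_start : seq (nat * (Gt * op)) :=
  [:: (1%N, (zt, shift false)); (2%N, ([~ zt, za]%g, shift true))].

Lemma hall_symbol N X H : Hall pair_br N X H ->
  (forall x : nat * (Gt * op), x \in X -> symbol x.1 x.2.1 x.2.2) ->
  forall x : nat * (Gt * op), x \in H -> symbol x.1 x.2.1 x.2.2.
Proof.
elim=> // {}X x Y {}H pX _ IH hX z.
have hx : symbol x.1 x.2.1 x.2.2 by apply: hX; rewrite (perm_mem pX) inE eqxx.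
rewrite inE => /predU1P[->//|]; apply: IH => _ /elim_listP[y [k [yY _ ->]]] /=.
have hy : symbol y.1 y.2.1 y.2.2 by apply: hX; rewrite (perm_mem pX) inE yY orbT.
elim: k => [|k IHk]; first by rewrite mul0n addn0.
by rewrite mulSnr addnA; exact: symbol_comm.
Qed.

Lemma hall_start_symbol (x : nat * (Gt * op)) : x \in hall_start -> symbol x.1 x.2.1 x.2.2.
Proof. by rewrite !inE => /orP[/eqP->|/eqP->]; [exact: symbol_t|exact: symbol_v]. Qed.

(** The divisibility half of [filt]. Unlike [filt], it gains a degree under doubling, even when
    powers of Y occur. *)
Definition filtd (k : nat) f : Prop := forall w, exists z, f w = 2 ^+ (k - wt w) * z.

Lemma filtdD k f g : filtd k f -> filtd k g -> filtd k (f + g).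
Proof.
move=> hf hg w; have [z hz] := hf w; have [z' hz'] := hg w.
by exists (z + z'); rewrite mulrDr -hz -hz'.
Qed.

Lemma filt_filtd k f : filt k f -> filtd k f. Proof. by case. Qed.

Lemma filtd_le j k f : (j <= k)%N -> filtd k f -> filtd j f.
Proof.
move=> jk hf w; have [z hz] := hf w; exists (2 ^+ (k - wt w - (j - wt w)) * z).
by rewrite hz mulrA -exprD; congr (2 ^+ _ * _); lia.
Qed.

Lemma filtd_double k f : filtd k f -> filtd k.+1 (f *+ 2).
Proof.
move=> hf w; have [z hz] := hf w; rewrite mulr2n fDE hz.
have [h|h] := leqP (wt w) k; first by exists z; rewrite subSn // exprS; ring.
exists (z + z); rewrite (_ : (k - wt w = 0)%N); last by lia.
by rewrite (_ : (k.+1 - wt w = 0)%N); [ring|lia].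
Qed.

Definition delta : M := fun w => (w == [::])%:R.

Lemma filt_delta : filt 0 delta.
Proof. by split=> // w; exists (delta w); rewrite sub0n mul1r. Qed.

Definition lin (g : Gt) : M := rep g delta - delta.

Lemma linE n g : deepG n g -> filt n (lin g).
Proof. by move=> h; exact: (h 0%N _ filt_delta). Qed.

(** The defect of additivity of [lin] is (g - 1)(h - 1) applied to the constant series 1, hence of
    depth m + n. *)
Lemma linM m n g h : deepG m g -> deepG n h -> filt (m + n) (lin (g * h)%g - (lin g + lin h)).
Proof.
move=> hg hh; have -> : lin (g * h)%g - (lin g + lin h) = rep g (lin h) - lin h.
  rewrite /lin gmulfM abME ab_addB; apply/funext => w; rewrite !(fDE, fNE); ring.
by rewrite addnC; apply: hg; exact: linE.
Qed.

(** By [linM] squaring doubles [lin] up to an error of degree 2 (m + j), which is at least m + j + 2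
    because m >= 2. *)
Lemma lin_pow2 m g j : (2 <= m)%N -> (forall j, deepG (m + j) (g ^+ (2 ^ j))%g) ->
  filtd (m + j).+1 (lin (g ^+ (2 ^ j))%g - lin g *+ (2 ^ j)).
Proof.
move=> m2 hg; elim: j => [|j IH].
  by rewrite expn0 expg1 mulr1n subrr; exact: filt_filtd (filt0 _).
have -> : lin (g ^+ (2 ^ j.+1))%g - lin g *+ (2 ^ j.+1) =
  (lin (g ^+ (2 ^ j) * g ^+ (2 ^ j))%g - (lin (g ^+ (2 ^ j))%g + lin (g ^+ (2 ^ j))%g)) +
  (lin (g ^+ (2 ^ j))%g - lin g *+ (2 ^ j)) *+ 2.
  rewrite expnS mul2n -addnn expgnDr mulrnDr mulr2n.
  by apply/funext => w; rewrite !(fDE, fNE); ring.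
apply: filtdD; last by rewrite addnS; exact: filtd_double.
apply: filtd_le (filt_filtd (linM (hg j) (hg j))); lia.
Qed.

Lemma lin_powe n g (e : nat) : (1 <= n)%N -> deepG n g ->
  filtd n.+1 (lin (g ^+ e)%g - lin g *+ e).
Proof.
move=> n1 hg; elim: e => [|e IH].
  rewrite expg0 mulr0n subr0 /lin gm1 ab1E subrr; exact: filt_filtd (filt0 _).
have -> : lin (g ^+ e.+1)%g - lin g *+ e.+1 =
  (lin (g * g ^+ e)%g - (lin g + lin (g ^+ e)%g)) + (lin (g ^+ e)%g - lin g *+ e).
  by rewrite expgS mulrS; apply/funext => w; rewrite !(fDE, fNE); ring.
apply: filtdD => //; apply: filtd_le (filt_filtd (linM hg _)).
  by rewrite -addn1 leq_add2l; exact: n1.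
elim: e {IH} => [|e IH]; first by rewrite expg0 /deepG gm1; exact: deep_one.
by rewrite expgS; exact: (sgrM (deepG_subgroup n)).
Qed.

Lemma lin_prod n (I : Type) (s : seq I) (g : I -> Gt) : (1 <= n)%N ->
  (forall i, deepG n (g i)) ->
  filtd n.+1 (lin (\prod_(i <- s) g i)%g - \sum_(i <- s) lin (g i)).
Proof.
move=> n1 hg; elim: s => [|i s IH].
  rewrite !big_nil subr0 /lin gm1 ab1E subrr; exact: filt_filtd (filt0 _).
have dp : deepG n (\prod_(i <- s) g i)%g.
  elim: s {IH} => [|k s IH]; first by rewrite big_nil /deepG gm1; exact: deep_one.
  by rewrite big_cons; exact: (sgrM (deepG_subgroup n)).
rewrite !big_cons.
have -> : lin (g i * \prod_(j <- s) g j)%g - (lin (g i) + \sum_(j <- s) lin (g j)) =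
  (lin (g i * \prod_(j <- s) g j)%g - (lin (g i) + lin (\prod_(j <- s) g j)%g)) +
  (lin (\prod_(j <- s) g j)%g - \sum_(j <- s) lin (g j)).
  by apply/funext => w; rewrite !(fDE, fNE); ring.
apply: filtdD => //; apply: filtd_le (filt_filtd (linM (hg i) dp)).
by rewrite -addn1 leq_add2l.
Qed.

Lemma free_indep (T : eqType) (V : vectType F2) (v : T -> V) (P : pred T) (x0 : T) (K : seq T) :
  free [seq v x | x <- K & P x] ->
  forall c : nat -> F2, \sum_(i < size K | P (nth x0 K i)) c i *: v (nth x0 K i) = 0 ->
  forall i, (i < size K)%N -> P (nth x0 K i) -> c i = 0.
Proof.
elim: K => //= x K IH fr c; rewrite big_mkcond big_ord_recl -big_mkcond /=.
have memS (d : nat -> F2) : \sum_(i < size K | P (nth x0 K i)) d i *: v (nth x0 K i) \in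
    <<[seq v x | x <- K & P x]>>%VS.
  apply: rpred_sum => i Pi; apply: rpredZ; apply: memv_span; apply: map_f.
  by rewrite mem_filter Pi mem_nth.
move: fr; case: ifP => Px; last first.
  move=> fr; rewrite add0r => h0 [|i] ik Pi; first by rewrite /= Px in Pi.
  exact: (IH fr (fun i => c i.+1) h0 i ik Pi).
rewrite map_cons free_cons => /andP[xK fr] h0.
have c0 : c 0%N = 0.
  apply/eqP; apply: contraNT xK => c0; move/eqP: h0; rewrite addr_eq0 => /eqP h0.
  rewrite -[v x](scalerK c0) h0 rpredZ // rpredN; exact: (memS (fun i => c i.+1)).
move: h0; rewrite c0 scale0r add0r => h0 [|i] ik Pi //.
exact: (IH fr (fun i => c i.+1) h0 i ik Pi).
Qed.

(** Applying [lin] to the product gives a sum of 2^(n - m_i) e_i u_i that lies in degree n + 1,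
    where u_i is [lin] of the i-th Hall element and m_i its weight. On words of weight m this is
    compared modulo 2^(n + 1 - m), and [hall_free] forces the exponents in weight m to be even. *)
Lemma hall_independent n H (e : nat -> nat) : (2 <= n)%N ->
  Hall pair_br n hall_start H ->
  (forall m j (g : Gt), (2 <= m)%N -> Gamma Gt m g -> Gamma Gt (m + j) (g ^+ (2 ^ j))%g) ->
  (forall x : nat * (Gt * op), x \in H -> Gamma Gt x.1 x.2.1) ->
  let K := [seq x <- H | (2 <= x.1 <= n)%N] in
  let x0 := (1%N, (zt, shift false)) in
  Gamma Gt n.+1 (\prod_(i < size K) ((nth x0 K i).2.1 ^+ (2 ^ (n - (nth x0 K i).1) * e i)))%g ->
  forall i, (i < size K)%N -> ~~ odd (e i).
Proof.
move=> n2 hH Gsq HG K x0 gG.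
have KH i : (i < size K)%N -> (nth x0 K i) \in H /\ (2 <= (nth x0 K i).1 <= n)%N.
  move=> ik; have := mem_nth x0 ik; rewrite mem_filter => /andP[h1 h2].
  by split.
have symK i : (i < size K)%N -> symbol (nth x0 K i).1 (nth x0 K i).2.1 (nth x0 K i).2.2.
  move=> /KH[h _]; exact: hall_symbol hH hall_start_symbol _ h.
pose mm i := (nth x0 K i).1; pose gg i := (nth x0 K i).2.1; pose u i := lin (gg i).
have Gdeep m j i : (i < size K)%N -> m = mm i -> deepG (m + j) (gg i ^+ (2 ^ j))%g.
  move=> ik ->; have [iH /andP[i2 _]] := KH i ik.
  have := Gsq _ j _ i2 (HG _ iH); rewrite -/(mm i) -/(gg i).
  have -> : (mm i + j = (mm i + j).-1.+1)%N by rewrite prednK // addn_gt0 (ltnW i2).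
  exact: Gamma_deep.
have total : filtd n.+1 (\sum_(i < size K) u i *+ (2 ^ (n - mm i) * e i)).
  pose h i := (gg i ^+ (2 ^ (n - mm i) * e i))%g.
  have dh i : (i < size K)%N -> deepG n (gg i ^+ (2 ^ (n - mm i)))%g.
    move=> ik; have [_ /andP[_ i2]] := KH i ik.
    by have := Gdeep _ (n - mm i)%N i ik erefl; rewrite subnKC.
  have h1 : filtd n.+1 (lin (\prod_(i < size K) h i)%g).
    apply/filt_filtd/linE; exact: Gamma_deep.
  have h2 := @lin_prod n 'I_(size K) (index_enum _) (fun i => h i) (ltnW n2).
  have {}h2 : filtd n.+1 (lin (\prod_(i < size K) h i)%g - \sum_(i < size K) lin (h i)).
    apply: h2 => i; rewrite /h expgnA.
    by apply: (sgrX (deepG_subgroup n)); exact: dh.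
  have h3 : filtd n.+1 (\sum_(i < size K) (lin (h i) - u i *+ (2 ^ (n - mm i) * e i))).
    elim/big_ind: _ => [|f g|i _]; [exact: filt_filtd (filt0 _)|exact: filtdD|].
    have [_ /andP[i2 i3]] := KH i (ltn_ord i).
    have -> : lin (h i) - u i *+ (2 ^ (n - mm i) * e i) =
      (lin (h i) - lin (gg i ^+ (2 ^ (n - mm i)))%g *+ e i) +
      (lin (gg i ^+ (2 ^ (n - mm i)))%g - u i *+ (2 ^ (n - mm i))) *+ e i.
      by rewrite [X in _ = _ + X]mulrnBl -mulrnA addrA subrK.
    apply: filtdD.
      by rewrite /h expgnA; apply: lin_powe; [exact: ltnW|exact: dh].
    have : filtd n.+1 (lin (gg i ^+ (2 ^ (n - mm i)))%g - u i *+ (2 ^ (n - mm i))).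
      have := @lin_pow2 (mm i) (gg i) (n - mm i)%N i2; rewrite subnKC //; apply=> j.
      exact: Gdeep.
    elim: (e i) => [|k IH] hk; first by rewrite mulr0n; exact: filt_filtd (filt0 _).
    by rewrite mulrS; apply: filtdD => //; exact: IH.
  have hN f : filtd n.+1 f -> filtd n.+1 (- f).
    by move=> hf w; have [z hz] := hf w; exists (- z); rewrite mulrN -hz.
  have -> : \sum_(i < size K) u i *+ (2 ^ (n - mm i) * e i) =
    lin (\prod_(i < size K) h i)%g + - (lin (\prod_(i < size K) h i)%g - \sum_(i < size K) lin (h i))
    + - (\sum_(i < size K) (lin (h i) - u i *+ (2 ^ (n - mm i) * e i))).
    have -> : \sum_(i < size K) (lin (h i) - u i *+ (2 ^ (n - mm i) * e i)) =
      \sum_(i < size K) lin (h i) - \sum_(i < size K) u i *+ (2 ^ (n - mm i) * e i).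
      by rewrite -sumrN -big_split.
    move: (\sum_(i < size K) u i *+ _) (\sum_(i < size K) lin _) (lin _) => A B C.
    by apply/funext => w; rewrite !(fDE, fNE); ring.
  by apply: filtdD; [apply: filtdD => //|]; exact: hN.
have hfree m : (2 <= m <= n)%N -> free [seq coords m (x.2.2 unit_fn) | x <- K & x.1 == m].
  move=> /andP[m2 mn]; rewrite -filter_predI.
  have -> : [seq x <- H | predI (fun x : nat * (Gt * op) => x.1 == m) (fun x => 2 <= x.1 <= n)%N x] =
            [seq x <- H | x.1 == m].
    by apply: eq_filter => x /=; case: eqP => //= ->; rewrite m2 mn.
  pose h (x : Gt * op) := x.2.
  have hM : {morph h : x y / pair_br x y >-> op_comm x y} by [].
  have hH' := Hall_map hM hH.
  have := hall_free hH' (m := m); rewrite filter_map -map_comp /=; apply.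
  by rewrite mn andbT (ltnW m2).
have red_u i : (i < size K)%N -> red (mm i) (u i) = (nth x0 K i).2.2 unit_fn.
  move=> ik; have [_ _ h] := symK i ik.
  suff <- : red 0 delta = unit_fn by have := h 0%N _ filt_delta; rewrite add0n.
  by apply/funext; case=> [|b w].
suff main d : forall i, (i < size K)%N -> (n - mm i)%N = d -> ~~ odd (e i).
  by move=> i ik; exact: (main _ i ik erefl).
(* Induction on n - m: the weights are treated from the largest downwards. *)
elim/ltn_ind: d => d IHd i ik di.
have [_ i23] := KH i ik; rewrite -/(mm i) in i23; set m := mm i in di i23.
have [i2 i3] := andP i23.
have ev w : wt w = m -> \sum_(j < size K | mm j == m) (e j)%:R * red m (u j) w = 0.
  move=> wm; have [z hz] := total w.
  have coef_sum (s : seq 'I_(size K)) (F : 'I_(size K) -> M) : (\sum_(j <- s) F j) w = \sum_(j <- s) F j w.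
    by elim: s => [|j s IH]; rewrite ?big_nil // !big_cons fDE IH.
  have coefMn f k : (f *+ k) w = f w *+ k.
    by elim: k => [|k IH]; rewrite ?mulr0n // !mulrS fDE IH.
  have term (j : 'I_(size K)) : exists y : int, (u j *+ (2 ^ (n - mm j) * e j)) w = 2 ^+ (n - m) * y /\
      y%:~R = (if mm j == m then (e j)%:R * red m (u j) w else 0) :> F2.
    have [_ /andP[j2 j3]] := KH j (ltn_ord j); rewrite -/(mm j) in j2 j3.
    have -> : (u j *+ (2 ^ (n - mm j) * e j)) w = 2 ^+ (n - mm j) * (e j)%:R * u j w.
      by rewrite coefMn -[LHS]mulr_natr natrM natrX mulrC.
    (* Each summand is 2^(n - m) y. A smaller weight leaves an extra factor 2 in the exponent; a
       larger one has e_j even by induction, while u_j supplies the missing powers of 2. So y is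
       even unless the weight is m. *)
    case: (ltngtP (mm j) m) => jm.
    - exists (2 * 2 ^+ (n - mm j - (n - m).+1) * (e j)%:R * u j w); split; last first.
        by rewrite !rmorphM /= (_ : (2 : int)%:~R = 2) // two_F2 !mul0r.
      have {1}-> : (n - mm j = (n - m) + (n - mm j - (n - m).+1).+1)%N by lia.
      by rewrite exprD exprS !mulrA.
    - have ej : ~~ odd (e j) by apply: (IHd (n - mm j)%N) => //; lia.
      have hu : filtd (mm j) (u j).
        have := Gdeep (mm j) 0%N j (ltn_ord j) erefl; rewrite addn0 expn0 expg1.
        by move=> /linE/filt_filtd.
      have [y hy] := hu w; exists (2 * y * (e j)./2%:R); split; last first.
        by rewrite !rmorphM /= (_ : (2 : int)%:~R = 2) // two_F2 !mul0r.
      rewrite hy wm -[in (e j)%:R](odd_double_half (e j)) (negbTE ej) add0n -mul2n natrM.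
      have -> : (n - m = (mm j - m) + (n - mm j))%N by lia.
      rewrite exprD; move: (2 ^+ (mm j - m) : int) (2 ^+ (n - mm j) : int) ((e j)./2%:R : int) => A B C.
      by ring.
    - exists ((e j)%:R * u j w); rewrite jm; split; first by rewrite mulrA.
      by rewrite rmorphM rmorph_nat /red wm eqxx.
  have [y hy] := choice term.
  have sy : \sum_j y j = 2 * z.
    apply: (@mulfI _ (2 ^+ (n - m))); first by rewrite expf_neq0.
    rewrite mulr_sumr mulrCA mulrA -exprS mulrC.
    have <- : (n.+1 - wt w = (n - m).+1)%N by rewrite wm subSn.
    rewrite [RHS]mulrC -hz coef_sum; apply: eq_bigr => j _.
    by have [-> _] := hy j; rewrite mulrC.
  rewrite big_mkcond /= -(eq_bigr _ (fun j _ => (hy j).2)) -rmorph_sum /= sy.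
  by rewrite rmorphM /= (_ : (2 : int)%:~R = 2) // two_F2 mul0r.
have := @free_indep _ _ (fun x : nat * (Gt * op) => coords m (x.2.2 unit_fn))
  (fun x => x.1 == m) x0 K (hfree m i23) (fun j => (e j)%:R) _ i ik (eqxx _).
rewrite -/(mm i) => hfin; have {hfin} : (e i)%:R = 0 :> F2.
  apply: hfin; apply/rowP => k; rewrite summxE mxE.
  rewrite -[RHS](ev (nth [::] (words m) k)); last by apply/eqP; rewrite -mem_words mem_nth.
  apply: eq_bigr => j /eqP jm; rewrite !mxE; congr (_ * _).
  by rewrite -(red_u j (ltn_ord j)) /mm jm.
by move=> /eqP; rewrite -(dvdn_pcharf (pchar_Fp (isT : prime 2))) dvdn2.
Qed.

End Symbols.

#[local] Arguments Gamma : simpl never.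
#[local] Arguments subgroup_set : simpl never.

(** * Elimination inside a group whose squares go deeper *)

Section Spanning.
Local Open Scope group_scope.
Variable G : groupType.
Hypothesis Gsq : forall n g, (2 <= n)%N -> Gamma G n g -> Gamma G n.+1 (g * g).

Lemma Gam_pow2 m j g : (2 <= m)%N -> Gamma G m g -> Gamma G (m + j) (g ^+ (2 ^ j)).
Proof.
move=> m2 hg; elim: j => [|j IH]; first by rewrite addn0 expn0 expg1.
rewrite addnS expnS mul2n -addnn expgnDr; apply: Gsq => //.
by apply: leq_trans m2 _; exact: leq_addr.
Qed.

Section Span.
Variables (X : seq (nat * G)).
Hypothesis hX : forall x : nat * G, x \in X -> (2 <= x.1)%N /\ Gamma G x.1 x.2.

(** The group counterpart of the degree n part of a restricted Lie algebra generated by X: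
    commutators add degrees, squaring raises the degree by one, and Gamma_{n+1} counts as zero. *)
Inductive lie_span : nat -> G -> Prop :=
| lie_deep n g : (2 <= n)%N -> Gamma G n.+1 g -> lie_span n g
| lie_mul n g h : lie_span n g -> lie_span n h -> lie_span n (g * h)
| lie_inv n g : lie_span n g -> lie_span n g^-1
| lie_gen x : x \in X -> lie_span x.1 x.2
| lie_comm m n g h : lie_span m g -> lie_span n h -> lie_span (m + n) [~ g, h]
| lie_sq n g : lie_span n g -> lie_span n.+1 (g * g).

Lemma lie_Gam n g : lie_span n g -> (2 <= n)%N /\ Gamma G n g.
Proof.
elim=> {n g} [n g n2 /Gamma_anti //|n g h _ [n2 hg] _ [_ hh]|n g _ [n2 hg]|x /hX //|
    m n g h _ [m2 hg] _ [n2 hh]|n g _ [n2 hg]].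
- by split=> //; exact: GamM.
- by split=> //; exact: GamV.
- split; first by apply: leq_trans m2 _; exact: leq_addr.
  by apply: Gam_commM => //; [exact: ltnW m2|exact: ltnW n2].
- by split; [exact: ltnW|exact: Gsq].
Qed.

Lemma lie_one n : (2 <= n)%N -> lie_span n 1.
Proof. by move=> n2; apply: lie_deep => //; exact: Gam1. Qed.

Lemma lie_conj n g y : lie_span n g -> lie_span n (g ^ y).
Proof.
move=> hg; have [n2 gg] := lie_Gam hg; rewrite conjg_comm; apply: lie_mul => //.
by apply: lie_deep => //; apply: Gam_comm1r => //; exact: ltnW n2.
Qed.

Lemma lie_sym n g h : lie_span n [~ g, h] -> lie_span n [~ h, g].
Proof. by move=> hg; rewrite -invgR; exact: lie_inv. Qed.

Lemma lie_commVl n g h : lie_span n [~ g, h] -> lie_span n [~ g^-1, h].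
Proof. by move=> hg; rewrite commVg; apply: lie_conj; exact: lie_inv. Qed.

Lemma lie_commVr n g h : lie_span n [~ g, h] -> lie_span n [~ g, h^-1].
Proof. by move=> hg; rewrite commgV; apply: lie_conj; exact: lie_inv. Qed.

Lemma lie_Jacobi n g h x : lie_span n [~ h^-1, x^-1, g] -> lie_span n [~ x, g^-1, h^-1] ->
  lie_span n [~ g, h, x].
Proof.
move=> h1 h2; rewrite -[[~ _, _, _]](conjgK h^-1) invgK; apply: lie_conj.
set w := _ ^ h^-1.
have -> : w = ([~ h^-1, x^-1, g] ^ x * [~ x, g^-1, h^-1] ^ g)^-1.
  by apply/eqP; rewrite -mulg_eq1 mulgA; apply/eqP; exact: Hall_Witt.
by apply/lie_inv/lie_mul; exact: lie_conj.
Qed.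

(* The square of c and the bracket correction coming from c ^ z * c. *)
Lemma lie_conj_sq n i c z : lie_span n c -> (2 <= i)%N -> Gamma G i z ->
  lie_span n.+1 (c ^ z * c).
Proof.
move=> hc i2 hz; have [n2 gc] := lie_Gam hc.
have -> : c ^ z * c = c * c * [~ c, z] ^ c by rewrite conjg_comm /conjg !gnorm.
apply: lie_mul; first exact: lie_sq.
apply: lie_conj; apply: lie_deep; first exact: ltnW.
apply: (@Gam_le _ _ (n + i)); first by lia.
by apply: Gam_commM => //; [exact: ltnW n2|exact: ltnW i2].
Qed.

(** Bracketing with x behaves as a derivation up to deeper terms: it is additive on products, obeys
    the Jacobi identity on commutators, and sends g^2 to [g, x]^g [g, x], which is a square up to a
    deeper factor. *)
Lemma lie_deriv N d x : (1 <= d)%N -> Gamma G d x ->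
  (forall y : nat * G, y \in X -> (y.1 + d <= N)%N -> lie_span (y.1 + d) [~ y.2, x]) ->
  forall n h, lie_span n h -> (n + d <= N)%N -> lie_span (n + d) [~ h, x].
Proof.
move=> d1 gx hgen n h; elim=> {n h} [n g n2 hg|n g h _ IHg _ IHh|n g _ IH|y yX|
    m n g h hg IHg hh IHh|n g hg IH] le.
- apply: lie_deep; first by apply: leq_trans n2 _; exact: leq_addr.
  by rewrite -addSn; apply: Gam_commM.
- by rewrite commMg; apply: lie_mul; [apply: lie_conj; exact: IHg|exact: IHh].
- by apply: lie_commVl; exact: IH.
- exact: hgen.
- apply: lie_Jacobi.
    rewrite addnAC -addnA addnC; apply: lie_comm => //; apply: lie_commVl; apply: lie_commVr.
    by rewrite addnC; apply: IHh; lia.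
  rewrite addnAC; apply: lie_commVr; apply: lie_comm => //; apply: lie_sym; apply: lie_commVl.
  by apply: IHg; lia.
- rewrite addSn commMg; have [n2 gg] := lie_Gam hg; apply: (lie_conj_sq _ n2 gg).
  by apply: IH; lia.
Qed.

End Span.

Section Step.
Variables (N : nat) (x : nat * G) (Y X : seq (nat * G)).
Hypothesis hX : forall x : nat * G, x \in X -> (2 <= x.1)%N /\ Gamma G x.1 x.2.
Hypothesis pX : perm_eq X (x :: Y).
Let X' := elim_list (@commg G) N x Y.

Let hx : (2 <= x.1)%N /\ Gamma G x.1 x.2.
Proof. by apply: hX; rewrite (perm_mem pX) inE eqxx. Qed.

Let x20 : (2 <= x.1)%N. Proof. by case: hx. Qed.
Let x0 : (0 < x.1)%N. Proof. exact: ltnW. Qed.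

Lemma elim_list_Gam (y : nat * G) : y \in X' -> (2 <= y.1)%N /\ Gamma G y.1 y.2.
Proof.
move=> /elim_listP[z [k [zY _ ->]]] /=.
have [z2 gz] : (2 <= z.1)%N /\ Gamma G z.1 z.2.
  by apply: hX; rewrite (perm_mem pX) inE zY orbT.
split; first by apply: leq_trans z2 _; exact: leq_addr.
elim: k => [|k IH]; first by rewrite mul0n addn0.
rewrite mulSnr addnA; apply: Gam_commM => //; last by case: hx.
by rewrite addn_gt0 (ltnW z2).
Qed.

Definition step_pow (n : nat) : G :=
  if (x.1 <= n)%N then x.2 ^+ (2 ^ (n - x.1)) else 1.

Lemma step_pow_Gam n : (2 <= n)%N -> Gamma G n (step_pow n).
Proof.
move=> n2; rewrite /step_pow; case: leqP => h; last exact: Gam1.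
by rewrite -{1}(subnKC h); apply: Gam_pow2; case: hx.
Qed.

Lemma lie_step_comm j h : lie_span X' j h -> (x.1 + j <= N)%N ->
  lie_span X' (x.1 + j) [~ x.2, h].
Proof.
move=> hh le; apply: lie_sym; rewrite addnC.
apply: (lie_deriv elim_list_Gam (N := N)) => //; [by case: hx| |by rewrite addnC].
move=> y /elim_listP[z [k [zY _ ->]]] /= le'.
have := @mem_elim_list _ (@commg G) N x z k.+1 Y x0 zY.
by rewrite mulSnr addnA => /(_ le'); exact: lie_gen.
Qed.

Lemma lie_step_pow i j e h : (2 <= i)%N -> lie_span X' j h -> (i + j <= N)%N ->
  lie_span X' (i + j) [~ step_pow i ^+ e, h].
Proof.
move=> i2 hh le; have [j2 gh] := lie_Gam elim_list_Gam hh.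
have ij2 : (2 <= i + j)%N by apply: leq_trans i2 _; exact: leq_addr.
have h1 : lie_span X' (i + j) [~ step_pow i, h].
  rewrite /step_pow; case: leqP => xi; last by rewrite comm1g; exact: lie_one.
  rewrite -{1}(subnKC xi); move: le; rewrite -{1}(subnKC xi).
  elim: (i - x.1)%N => [|k IH] le.
    by rewrite addn0 expn0 expg1; apply: lie_step_comm => //; rewrite addn0 in le.
  rewrite addnS addSn expnS mul2n -addnn expgnDr commMg.
  apply: (lie_conj_sq elim_list_Gam (i := (x.1 + k)%N)).
  - by apply: IH; lia.
  - by apply: leq_trans x20 _; exact: leq_addr.
  - by apply: Gam_pow2; case: hx.
elim: e => [|e IH]; first by rewrite expg0 comm1g; exact: lie_one.
rewrite expgS commMg; apply: lie_mul => //; exact: (lie_conj elim_list_Gam).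
Qed.

(** The group form of [gspan_elim]: the powers of x are collected on the left, [step_pow n] being x
    squared repeatedly up to degree n. Commutators of such powers with the eliminated span stay in
    that span, and two powers of x commute. *)
Lemma lie_elim n g : lie_span X n g -> (n <= N)%N ->
  exists e h, lie_span X' n h /\ g = step_pow n ^+ e * h.
Proof.
have cJ := lie_conj elim_list_Gam.
elim=> {n g} [n g n2 hg|n g g' _ IH _ IH'|n g hg IH|y yX|
    m n g g' hg IH hg' IH'|n g hg IH] le.
- by exists 0%N, g; rewrite expg0 mul1g; split=> //; exact: lie_deep.
- have [e [h [hh ->]]] := IH le; have [e' [h' [hh' ->]]] := IH' le.
  exists (e + e')%N, (h ^ (step_pow n ^+ e') * h'); split.
    by apply: lie_mul => //; exact: (cJ).
  by rewrite expgnDr /conjg !mulgA !gnorm.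
- have [n2 _] := lie_Gam hX hg; have [e [h [hh ->]]] := IH le.
  exists e, ((step_pow n ^+ (e + e))^-1 * h^-1 ^ (step_pow n ^+ e)^-1); split.
    apply: lie_mul; last by apply: (cJ); exact: lie_inv.
    apply/lie_inv/lie_deep => //; rewrite expgnDr; apply: Gsq => //.
    exact/GamX/step_pow_Gam.
  by rewrite expgnDr /conjg !gnorm.
- move: yX; rewrite (perm_mem pX) inE => /predU1P[->|yY].
    exists 1%N, 1; rewrite expg1 mulg1 /step_pow leqnn subnn expn0 expg1; split=> //.
    exact: lie_one.
  exists 0%N, y.2; rewrite expg0 mul1g; split=> //.
  have := @mem_elim_list _ (@commg G) N x y 0 Y x0 yY.
  by rewrite mul0n addn0 => /(_ le); exact: lie_gen.
- have [m2 _] := lie_Gam hX hg; have [n2 _] := lie_Gam hX hg'.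
  have [|e [h [hh ->]]] := IH; first by lia.
  have [|e' [h' [hh' ->]]] := IH'; first by lia.
  exists 0%N; eexists; split; last by rewrite expg0 mul1g.
  rewrite commMg; apply: lie_mul.
    apply: (cJ); rewrite commgM; apply: lie_mul; first exact: lie_step_pow.
    apply: (cJ); rewrite (_ : [~ _, _] = 1); first by apply: lie_one; lia.
    apply/eqP/commgP; rewrite /step_pow.
    case: leqP => _; case: leqP => _; rewrite ?expg1n; try exact: commute1;
      try exact/commute_sym/commute1.
    by do 2!apply: commuteX2; exact: commute_refl.
  rewrite commgM; apply: lie_mul; first exact: lie_comm.
  apply: (cJ); apply: lie_sym; rewrite addnC.
  by apply: lie_step_pow => //; rewrite addnC.
- have [n2 _] := lie_Gam hX hg; have [|e [h [hh ->]]] := IH; first exact: ltnW.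
  set p := step_pow n ^+ e.
  have -> : p * h * (p * h) = p * p * (h ^ p * h) by rewrite /conjg !mulgA !gnorm.
  have hq : lie_span X' n.+1 (h ^ p * h).
    by apply: (lie_conj_sq elim_list_Gam _ n2) => //; exact/GamX/step_pow_Gam.
  rewrite /p /step_pow; case: (leqP x.1 n) => xn.
    exists e; eexists; split; first exact: hq.
    rewrite (leq_trans xn) // subSn // expnS mul2n -addnn expgnDr.
    by rewrite expgMn // /p /step_pow xn.
  exists 0%N; eexists; split; first exact: hq.
  rewrite expg0 expg1n !mul1g /p /step_pow leqNgt xn expg1n //.
Qed.

End Step.

(** Iterate [lie_elim]. Elements of weight above n contribute trivial powers, and once all remaining
    generators have weight above N the span in degree n <= N is contained in Gamma_{n+1}. *)
Lemma lie_hall N X H : Hall (@commg G) N X H ->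
  (forall x : nat * G, x \in X -> (2 <= x.1)%N /\ Gamma G x.1 x.2) ->
  forall n g, lie_span X n g -> (n <= N)%N ->
  let K := [seq x <- H | (x.1 <= n)%N] in
  exists e : nat -> nat, exists2 h, Gamma G n.+1 h &
    g = \prod_(i < size K) (nth (0%N, 1) K i).2 ^+ (2 ^ (n - (nth (0%N, 1) K i).1) * e i) * h.
Proof.
elim=> [{}X /allP XN hX n g hg le /=|{}X x Y {}H pX _ IH hX n g hg le K].
  exists (fun=> 0%N), g; last by rewrite big_ord0 mul1g.
  elim: hg le => {n g} [n g n2 hg|n g h _ IHg _ IHh|n g _ IHg|y yX|
    m n g h hg IHg hh IHh|n g hg IHg] le.
  - by [].
  - by apply: GamM; [exact: IHg|exact: IHh].
  - by apply: GamV; exact: IHg.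
  - by have /= := XN _ yX; rewrite ltnNge le.
  - have [m2 _] := lie_Gam hX hg; have [n2 gh] := lie_Gam hX hh.
    rewrite -addSn; apply: Gam_commM => //; first exact: ltnW.
    by apply: IHg; lia.
  - by have [n2 _] := lie_Gam hX hg; apply: Gsq => //; [exact: ltnW|apply: IHg; lia].
have [e [h [hh ->]]] := lie_elim hX pX hg le.
have [e' [h' gh' ->]] := IH (elim_list_Gam hX pX) n h hh le.
rewrite /K /= /step_pow; case: leqP => xn; last first.
  by exists e', h' => //; rewrite expg1n mul1g.
exists (fun i => if i is k.+1 then e' k else e), h' => //.
by rewrite /= big_ord_recl /= mulgA expgnA.
Qed.

End Spanning.

#[local] Arguments Gamma : simpl never.
#[local] Arguments subgroup_set : simpl never.

(** * The lower central quotients of Z2 * Z *)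

Section Z2StarZQuotient.
Local Open Scope group_scope.
Local Notation Gt := Z2_star_Z.
Local Notation br := (@commg Gt).
Local Notation wop := ((seq bool -> 'F_2) -> (seq bool -> 'F_2)).

Definition sq_deep n : set Gt := [set g | Gamma Gt n g /\ Gamma Gt n.+1 (g * g)].

Lemma sq_deep_subgroup n : (0 < n)%N -> is_subgroup (sq_deep n).
Proof.
move=> n0.
have M x y : sq_deep n x -> sq_deep n y -> sq_deep n (x * y).
  move=> [gx gxx] [gy gyy]; split; first exact: GamM.
  have -> : x * y * (x * y) = x * x * (y * y) * [~ y, x] ^ y.
    by rewrite /commg /conjg !mulgA !gnorm.
  apply: GamM; first exact: GamM.
  by apply: GamJ; exact: Gam_comm1.
split=> [|x y hx [gy gyy]]; first by split; rewrite ?mulg1; exact: Gam1.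
apply: M => //; split; first exact: GamV.
by rewrite -invgM; exact: GamV.
Qed.

Lemma sq_deepJ n g x : sq_deep n g -> sq_deep n (g ^ x).
Proof. by move=> [h1 h2]; split; [|rewrite -conjMg]; exact: GamJ. Qed.

(** In degree 2, c = [a, y] satisfies c^a c = [a^2, y] = 1, so c^2 is a conjugate of the inverse of
    [c, a]; the commutators [t, y] reduce to this by expanding y in the generators. In higher
    degree, [x, y]^2 = [x, y^2] [x, y, y]^-1 and y^2 is already deeper. *)
Lemma Z2_star_Z_sq n (g : Gt) : (2 <= n)%N -> Gamma Gt n g -> Gamma Gt n.+1 (g * g).
Proof.
suff h m : Gamma Gt m.+2 `<=` sq_deep m.+2 by case: n => [|[|n]] // _ /h[].
elim: m {n g} => [|n IH]; apply: generated_sub; try exact: sq_deep_subgroup.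
  have sV g : sq_deep 2 g -> sq_deep 2 g^-1 := @sgrV _ _ (sq_deep_subgroup (isT : (0 < 2)%N)) g.
  have sM := @sgrM _ _ (sq_deep_subgroup (isT : (0 < 2)%N)).
  have s1 := sgr1 (sq_deep_subgroup (isT : (0 < 2)%N)).
  have ha y : sq_deep 2 [~ za, y].
    split; first exact: Gam_comm1.
    set c := [~ za, y]; have e : c ^ za * c = 1 by rewrite /c -commMg za2 comm1g.
    have -> : c * c = ([~ c, za] ^ c)^-1.
      have e2 : c ^ za * c = c * c * [~ c, za] ^ c by rewrite conjg_comm /conjg !gnorm.
      by apply/eqP; rewrite -mulg_eq1 -e2 e.
    by apply: GamV; apply: GamJ; apply: Gam_comm1r => //; exact: Gam_comm1.
  have ht y : sq_deep 2 [~ zt, y].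
    have hS : is_subgroup [set y | sq_deep 2 [~ zt, y]].
      split=> [|u v hu hv] /=; first by rewrite commg1.
      by rewrite commgM commgV; apply: sM; [apply: sq_deepJ; exact: sV|exact: sq_deepJ].
    apply: (Z2_star_Z_gen hS) => /=; last by rewrite commgg.
    by rewrite -invgR; apply: sV; exact: ha.
  move=> _ [x [y [_ ->]]].
  have hS : is_subgroup [set x | sq_deep 2 [~ x, y]].
    split=> [|u v hu hv] /=; first by rewrite comm1g.
    by rewrite commMg commVg; apply: sM; apply: sq_deepJ => //; exact: sV.
  exact: (Z2_star_Z_gen hS (ha y) (ht y) x).
move=> _ [x [y [gy ->]]]; split; first exact: Gam_comm1.
have -> : [~ x, y] * [~ x, y] = [~ x, y * y] * ([~ x, y, y])^-1.
  rewrite commgM conjg_comm; move: [~ x, y, y] [~ x, y] => c d.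
  by rewrite mulgA mulgK.
have [_ gyy] := IH _ gy.
apply: GamM; first exact: Gam_comm1.
by apply: GamV; apply: Gam_comm1r => //; exact: Gam_comm1.
Qed.

Let t1 : nat * Gt := (1%N, zt).
Let v2 : nat * Gt := (2%N, [~ zt, za]).

Section Generate.
Variable N : nat.
Let X := elim_list br N t1 [:: v2].

Let vk k : Gt := ad_iter br zt k [~ zt, za].

Lemma vkS k : vk k.+1 = [~ vk k, zt]. Proof. by []. Qed.

Lemma start_mem (k : nat) : (k + 2 <= N)%N -> ((k + 2)%N, vk k) \in X.
Proof.
move=> le; have := @mem_elim_list _ br N t1 v2 k [:: v2] isT (mem_head _ _).
by rewrite /= muln1 addnC => /(_ le).
Qed.

Lemma vk_Gam k : Gamma Gt (k + 2) (vk k).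
Proof.
elim: k => [|k IH]; first exact: Gam_comm1.
by rewrite vkS addSn; apply: Gam_comm1r => //; rewrite addn2.
Qed.

Lemma start_inv (x : nat * Gt) : x \in X -> exists k, (k + 2 <= N)%N /\ x = ((k + 2)%N, vk k).
Proof.
move=> /elim_listP[y [k [yv le ->]]]; move: yv le; rewrite inE => /eqP -> /=.
by rewrite muln1 addnC => le; exists k.
Qed.

Lemma start_Gam (x : nat * Gt) : x \in X -> (2 <= x.1)%N /\ Gamma Gt x.1 x.2.
Proof.
by move=> /start_inv[k [_ ->]]; split; [rewrite addn2|exact: vk_Gam].
Qed.

Local Notation sp := (lie_span X).

Lemma start_gen k : (k + 2 <= N)%N -> sp (k + 2) (vk k).
Proof. by move=> le; exact: (@lie_gen _ X ((k + 2)%N, vk k) (start_mem le)). Qed.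

Lemma start_deriv_t n h : sp n h -> (n + 1 <= N)%N -> sp (n + 1) [~ h, zt].
Proof.
apply: (lie_deriv Z2_star_Z_sq start_Gam (N := N)) => // y /start_inv[k [_ ->]] /= le.
rewrite -vkS (_ : (k + 2 + 1 = k.+1 + 2)%N); last by lia.
apply: start_gen; lia.
Qed.

(** Expanding both entries in a and t leaves only [t, a]; the conjugations that appear stay in the
    span by [lie_conj]. *)
Lemma start_Gam2 g : (2 <= N)%N -> Gamma Gt 2 g -> sp 2 g.
Proof.
move=> N2; have sS : is_subgroup [set g | sp 2 g].
  split=> [|x y hx hy] /=; first exact: lie_one.
  by apply: lie_mul => //; exact: lie_inv.
have cJ := lie_conj Z2_star_Z_sq start_Gam.
apply: (generated_sub sS) => _ [x [y [_ ->]]] /=.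
have hta : sp 2 [~ zt, za] by exact: (@start_gen 0).
have hS z : sp 2 [~ z, za] -> sp 2 [~ z, zt] -> forall y, sp 2 [~ z, y].
  move=> ha ht; apply: Z2_star_Z_gen => //.
  split=> [|u w hu hw] /=; first by rewrite commg1; exact: lie_one.
  rewrite commgM commgV; apply: lie_mul; last exact: (cJ).
  by apply: (cJ); exact: lie_inv.
have hT : is_subgroup [set x | sp 2 [~ x, y]].
  split=> [|u w hu hw] /=; first by rewrite comm1g; exact: lie_one.
  rewrite commMg commVg; apply: lie_mul; apply: (cJ) => //.
  by apply: lie_inv.
apply: (Z2_star_Z_gen hT) => /=; apply: hS; rewrite ?commgg; try exact: lie_one.
  exact: lie_sym.
by [].
Qed.

(** By [lie_deriv] only the generators [vk k] matter. For k = 0, conjugation by a inverts [t, a], so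
    [[t, a], a] is the inverse of a square. The step from k to k + 1 is the Jacobi identity, with
    [t^-1, a^-1] in Gamma_2. *)
Lemma start_deriv_a n h : sp n h -> (n + 1 <= N)%N -> sp (n + 1) [~ h, za].
Proof.
apply: (lie_deriv Z2_star_Z_sq start_Gam (N := N)) => // y /start_inv[k [_ ->]] /=.
have zaV : za^-1 = za :> Gt by apply: mulg1_eq; exact: za2.
elim: k => [|k IH] le.
  have -> : [~ vk 0, za] = (vk 0 * vk 0)^-1.
    have va : vk 0 ^ za = (vk 0)^-1.
      rewrite -[vk 0]/[~ zt, za] invgR /commg /conjg !mulgA.
      by rewrite -(mulgA _ za za) za2 mulg1 !zaV.
    by rewrite [LHS]commgEl va [RHS]invgM.
  apply: lie_inv; rewrite addn1; apply: lie_sq.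
  by apply: (@start_gen 0); lia.
have N2 : (2 <= N)%N by lia.
have hk : sp (k + 2) (vk k) by apply: start_gen; lia.
rewrite vkS (_ : (k.+1 + 2 + 1 = 2 + (k + 2))%N); last by lia.
apply: (lie_Jacobi Z2_star_Z_sq start_Gam).
  by apply: lie_comm => //; apply: start_Gam2 => //; exact: Gam_comm1.
rewrite (_ : (2 + (k + 2) = (k + 2 + 1) + 1)%N); last by lia.
apply: (lie_commVr Z2_star_Z_sq start_Gam); apply: start_deriv_t; last by lia.
by apply: lie_sym; apply: (lie_commVl Z2_star_Z_sq start_Gam); apply: IH; lia.
Qed.

(** Gamma_{n+1} is generated by commutators with elements of Gamma_n, and bracketing with a and with
    t preserves the span. *)
Lemma start_span n g : (2 <= n <= N)%N -> Gamma Gt n g -> sp n g.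
Proof.
case: n => [|[|n]] // /andP[_]; elim: n g => [|n IH] g le; first exact: start_Gam2.
have cJ := lie_conj Z2_star_Z_sq start_Gam.
have sS : is_subgroup [set g | sp n.+3 g].
  split=> [|x y hx hy] /=; first exact: lie_one.
  by apply: lie_mul => //; exact: lie_inv.
apply: (generated_sub sS) => _ [x [y [/IH hy ->]]] /=.
have {}hy := hy (ltnW le).
have hT : is_subgroup [set x | sp n.+3 [~ x, y]].
  split=> [|u w hu hw] /=; first by rewrite comm1g; exact: lie_one.
  rewrite commMg commVg; apply: lie_mul; apply: (cJ) => //.
  by apply: lie_inv.
apply: (Z2_star_Z_gen hT) => /=; apply: lie_sym; rewrite -addn1.
  by apply: start_deriv_a => //; rewrite addn1.
by apply: start_deriv_t => //; rewrite addn1.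
Qed.

End Generate.

Lemma hall_Gam N X H : Hall br N X H ->
  (forall x : nat * Gt, x \in X -> (2 <= x.1)%N /\ Gamma Gt x.1 x.2) ->
  forall x : nat * Gt, x \in H -> (2 <= x.1)%N /\ Gamma Gt x.1 x.2.
Proof.
elim=> // {}X z Y {}H pX _ IH XG x; rewrite inE => /predU1P[->|xH].
  by apply: XG; rewrite (perm_mem pX) inE eqxx.
by apply: IH xH; exact: (elim_list_Gam XG pX).
Qed.

Theorem Z2_star_Z_quotient n : (2 <= n)%N ->
  exists r : nat, r%:R = rank_R n /\ isomorphic (Gamma_quotient Gt n) (Z2_power r).
Proof.
move=> n2; pose xt : nat * (Gt * wop) := (1%N, (zt, shift false)).
pose xv : nat * (Gt * wop) := (2%N, ([~ zt, za], shift true)).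
have [|H' hH'] := @Hall_exists _ pair_br n (elim_list pair_br n xt [:: xv]).
  move=> _ /elim_listP[y [k [yv le ->]]]; move: yv; rewrite inE => /eqP -> /=.
  exact: ltn_addr.
(* t is eliminated first: the remaining generators all have weight at least 2, where squares go
   deeper and [lie_hall] applies. *)
pose H := xt :: H'.
have hH : Hall pair_br n hall_start H by apply: (@Hall_step _ _ _ _ xt [:: xv]).
pose p1 (x : Gt * wop) := x.1; have p1M : {morph p1 : x y / pair_br x y >-> br x y} by [].
have hG' : Hall br n (elim_list br n t1 [:: v2]) [seq (x.1, x.2.1) | x <- H'].
  have := Hall_map p1M hH'; congr (Hall _ _ _ _).
  rewrite /elim_list /= !cats0 -!map_comp; apply: eq_map => k /=; congr (_, _).
  by rewrite /ad_iter; elim: k => //= k <-.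
have HGam (x : nat * (Gt * wop)) : x \in H' -> (2 <= x.1)%N /\ Gamma Gt x.1 x.2.1.
  move=> xH'; apply: (hall_Gam hG' (@start_Gam n) (x := (x.1, x.2.1))).
  exact: (map_f (fun x : nat * (Gt * wop) => (x.1, x.2.1))).
pose K := [seq x <- H | (2 <= x.1 <= n)%N]; pose r := size K.
exists r; split.
  rewrite /r size_filter; apply: (Hall_count_rank hH _) => //.
  by rewrite n2 leqnn.
(* The candidate basis: each Hall element of weight m is raised to the power 2^(n - m), which brings
   it into Gamma_n. *)
pose q (i : nat) : Gt := (nth xt K i).2.1 ^+ (2 ^ (n - (nth xt K i).1)).
have KH i : (i < r)%N -> nth xt K i \in H' /\ (2 <= (nth xt K i).1 <= n)%N.
  move=> ir; have := mem_nth xt ir; rewrite mem_filter => /andP[h1 h2]; split=> //.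
  by move: h2; rewrite inE => /predU1P[h|//]; move: h1; rewrite h.
have qG i : (i < r)%N -> Gamma Gt n (q i).
  move=> /KH[/HGam[w2 gw] /andP[_ wn]]; rewrite /q -{1}(subnKC wn).
  exact: (Gam_pow2 Z2_star_Z_sq).
pose Q := Gamma_quotient Gt n.
pose pr (g : Gt) (hg : Gamma Gt n g) : Q := \pi_(quotient_group (Gamma_next Gt n)) (gam_in hg).
have prM g h (hg : Gamma Gt n g) (hh : Gamma Gt n h) (hgh : Gamma Gt n (g * h)) :
    pr _ hgh = pr _ hg * pr _ hh.
  rewrite [RHS]quot_mulE; congr (\pi_(quotient_group _) _); exact: val_inj.
have pr1 g (hg : Gamma Gt n g) : pr g hg = 1 <-> Gamma Gt n.+1 g.
  have -> : (1 : Q) = pr 1 (Gam1 Gt n).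
    by congr (\pi_(quotient_group _) _); exact: val_inj.
  split=> [/gam_quotP|h]; rewrite /= ?mulg1; first by move=> /GamV; rewrite invgK.
  by apply/gam_quotP; rewrite /= mulg1; exact: GamV.
have prS (x : Q) : exists g (hg : Gamma Gt n g), x = pr g hg.
  elim/quotW: x => x; exists (val x), (gam_valP x); congr (\pi_(quotient_group _) _).
  exact: val_inj.
have Qc (x y : Q) : commute x y.
  have [g [hg ->]] := prS x; have [h [hh ->]] := prS y.
  rewrite /commute -!(prM _ _ _ _ (GamM _ _)); apply/gam_quotP; rewrite /= invgM.
  have -> : h^-1 * g^-1 * (h * g) = [~ h, g] by rewrite /commg /conjg !mulgA.
  by apply: Gam_comm1 => //; exact: ltnW.
have Qsq (x : Q) : x * x = 1.
  have [g [hg ->]] := prS x; rewrite -(prM _ _ _ _ (GamM hg hg)).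
  by apply/pr1; exact: Z2_star_Z_sq.
pose z (i : 'I_r) : Q := pr _ (qG i (ltn_ord i)).
pose F (e : Z2_power r) : Q := \prod_(i < r) z2_pow (z i) (e i).
have FM : {morph F : e e' / e * e'}.
  move=> e e'; rewrite /F -prodgM_commute; last by move=> *; exact: Qc.
  by apply: eq_bigr => i _; rewrite ffunE z2_pow_morph.
pose P (x : Q) (g : Gt) := exists hg : Gamma Gt n g, x = pr g hg.
have PM x g y h : P x g -> P y h -> P (x * y) (g * h).
  by move=> [hg ->] [hh ->]; exists (GamM hg hh); rewrite -(prM _ _ _ _ (GamM hg hh)).
have P1 : P 1 1 by exists (Gam1 Gt n); apply/esym/pr1; exact: Gam1.
have PX x g k : P x g -> P (x ^+ k) (g ^+ k).
  by move=> h; elim: k => [|k IH]; rewrite ?expg0 // !expgS; exact: PM.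
have FE (e : 'I_r -> nat) : P (\prod_(i < r) z i ^+ e i) (\prod_(i < r) q i ^+ e i).
  apply: (big_ind2 P) => // i _.
  by apply: PX; exists (qG i (ltn_ord i)).
apply: isomorphic_sym; apply: (isomorphic_of_bij FM).
- have F1 : F 1 = 1 by apply: (mulIg (F 1)); rewrite -FM !mul1g.
  have Finj e : F e = 1 -> e = 1.
    have [hg] := FE (fun i => (e i : 'Z_2)); rewrite -/(F e) => -> /pr1 gG.
    pose e' (i : nat) : nat := if insub i is Some j then ((e j : 'Z_2) : nat) else 0%N.
    have he' (i : 'I_r) : e' i = (e i : 'Z_2) by rewrite /e' valK.
    have H1 (x : nat * (Gt * wop)) : x \in H -> Gamma Gt x.1 x.2.1.
      by rewrite inE => /predU1P[->|/HGam[]].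
    have := hall_independent (e := e') n2 hH (Gam_pow2 Z2_star_Z_sq) H1.
    rewrite -/K -/r -/xt => hind; apply/ffunP => i; rewrite ffunE.
    have : ~~ odd (e' i).
      apply: hind => //; move: gG; congr (Gamma Gt n.+1 _); apply: eq_bigr => k _.
      by rewrite he' expgnA.
    rewrite he'; move: (e i) => [[|[|//]] k] // _; exact: val_inj.
  move=> e e' ee'; apply: divg1_eq; apply: Finj.
  by rewrite FM ee' -FM mulgV.
move=> x; have [g [hg ->]] := prS x.
have n2n : (2 <= n <= n)%N by rewrite n2 leqnn.
have [e [h hh gE]] := lie_hall Z2_star_Z_sq hG' (@start_Gam n) (start_span n2n hg) (leqnn n).
pose p (x : nat * (Gt * wop)) : nat * Gt := (x.1, x.2.1).
have KE : [seq x <- [seq (x.1, x.2.1) | x <- H'] | (x.1 <= n)%N] = map p K.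
  rewrite filter_map /K /=; congr map; apply: eq_in_filter => y /HGam[y2 _] /=.
  by rewrite y2.
exists [ffun i : 'I_r => (inZp (e i) : 'Z_2) : Z2_group].
have expmod (y : Q) k : y ^+ (k %% 2) = y ^+ k.
  rewrite [in RHS](divn_eq k 2) expgnDr mulnC expgnA expg2 Qsq expg1n mul1g //.
have -> : F [ffun i : 'I_r => (inZp (e i) : 'Z_2) : Z2_group] = \prod_(i < r) z i ^+ e i.
  by apply: eq_bigr => i _; rewrite ffunE /z2_pow /= expmod.
have [hg' ->] := FE (fun i => e i); apply/gam_quotP; rewrite !val_gam gE KE size_map -/r.
rewrite [X in _ * (X * _)](_ : _ = \prod_(i < r) q i ^+ e i) ?mulKg //.
by apply: eq_bigr => i _; rewrite (nth_map xt) // expgnA.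
Qed.

End Z2StarZQuotient.

(** * Induction along the unit interval *)

Section Cousin.
Variable R : realType.

(** The supremum s of the points x with Q 0 x satisfies Q 0 s, and the local hypothesis at s carries
    past s unless s = 1. This takes the place of subdivision by Lebesgue numbers throughout. *)
Lemma cousin (Q : R -> R -> Prop) :
  (forall x, 0 <= x <= 1 -> exists2 e, 0 < e &
     forall u v, 0 <= u -> u <= x -> x <= v -> v <= 1 -> x - e < u -> v < x + e -> Q u v) ->
  (forall u v w, 0 <= u -> u <= v -> v <= w -> w <= 1 -> Q u v -> Q v w -> Q u w) ->
  Q 0 1.
Proof.
move=> loc add.
pose S := [set x : R | 0 <= x <= 1 /\ Q 0 x].
have S0 : S 0.
  split; first by rewrite lexx ler01.
  have [|e e0 he] := loc 0; first by rewrite lexx ler01.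
  by apply: he; rewrite ?lexx ?ler01 //; lra.
have hS : has_sup S.
  by split; [exists 0|exists 1 => x [/andP[]]].
set s := sup S; have s01 : 0 <= s <= 1.
  apply/andP; split; first by apply: ub_le_sup S0; case: hS.
  by apply: ge_sup; [exists 0|move=> x [/andP[]]].
have [e e0 he] := loc s s01.
have [x [/andP[x0 x1] Qx] sx] := sup_adherent e0 hS.
have xs : x <= s by apply: ub_le_sup; [case: hS|split; rewrite ?x0].
have [s0 s1] := andP s01.
have Sy y : s <= y -> y <= 1 -> y < s + e -> S y.
  move=> sy y1 yse; split; first by rewrite y1 (le_trans s0 sy).
  by apply: (add 0 x y) => //; [exact: le_trans xs sy|apply: he].
have [sy|sy] := leP 1 (s + e / 2).
  by have [] := Sy 1 s1 (lexx _) _; first by lra.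
have : s + e / 2 <= s.
  by apply: ub_le_sup; [case: hS|apply: Sy; lra].
lra.
Qed.

Lemma locally_constant (T : Type) (h : R -> T) :
  (forall x, 0 <= x <= 1 -> exists2 e, 0 < e &
     forall u, 0 <= u <= 1 -> `|u - x| < e -> h u = h x) -> h 0 = h 1.
Proof.
move=> loc; apply: (cousin (Q := fun u v => h u = h v)) => [x x01|u v w _ _ _ _ -> //].
have [e e0 he] := loc x x01; exists e => // u v u0 ux xv v1 xu vx.
have [x0 x1] := andP x01.
rewrite !he //; try by rewrite ltr_norml; lra.
  by rewrite (le_trans x0 xv).
by rewrite u0 (le_trans ux).
Qed.

End Cousin.

(** * Paths and homotopies in a subset of a space *)

Section Paths.
Variables (R : realType) (V : topologicalType) (A : set V).
Implicit Types f g h : R -> V.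

(** Paths live on the whole line and take values in the ambient space, so neither the interval nor A
    has to be made into a space. *)
Definition is_path f : Prop := continuous f /\ forall t, A (f t).

(* Homotopy relative to the endpoints of paths defined on the whole line; only
   the values on [0, 1] matter, see hp_eq01. *)
Definition hp f g : Prop := exists F : R * R -> V,
  [/\ continuous F, forall z, A (F z), forall t, F (0, t) = f t,
      forall t, F (1, t) = g t & forall s, F (s, 0) = f 0 /\ F (s, 1) = f 1].

Definition pcat f g : R -> V := fun t => if t <= 2^-1 then f (2 * t) else g (2 * t - 1).
Definition prev f : R -> V := fun t => f (1 - t).

Lemma pair_continuous (X Y Z : topologicalType) (f : X -> Y) (g : X -> Z) :
  continuous f -> continuous g -> continuous (fun x => (f x, g x)).
Proof.
move=> cf cg x B [[P Q] /= [hP hQ] sPQ].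
have hu : nbhs x [set z | P (f z)] := cf x P hP.
have hv : nbhs x [set z | Q (g z)] := cg x Q hQ.
by apply: filterS (filterI hu hv) => z [Pz Qz]; exact: (sPQ (_, _)).
Qed.

Lemma comp_continuous (X Y Z : topologicalType) (f : X -> Y) (g : Y -> Z) :
  continuous f -> continuous g -> continuous (fun x => g (f x)).
Proof. by move=> cf cg x; apply: continuous_comp; [exact: cf|exact: cg]. Qed.

Lemma clamp0 : clamp (0 : R) = 0.
Proof. by rewrite /clamp (min_idPr ler01) maxxx. Qed.
Lemma clamp1 : clamp (1 : R) = 1.
Proof. by rewrite /clamp minxx (max_idPr ler01). Qed.
Lemma clamp_ge0 (t : R) : 0 <= clamp t. Proof. by rewrite /clamp le_max lexx. Qed.
Lemma clamp_le1 (t : R) : clamp t <= 1.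
Proof. by rewrite /clamp ge_max ler01 ge_min lexx. Qed.
Lemma clamp_id (t : R) : 0 <= t <= 1 -> clamp t = t.
Proof. by move=> /andP[t0 t1]; rewrite /clamp (min_idPr t1) (max_idPr t0). Qed.

(* Every homotopy below comes from a linear homotopy in a vector space. *)
Lemma map_hp (E : normedModType R) (K : E -> V) (p q : R -> E) :
  continuous K -> (forall z, A (K z)) -> continuous p -> continuous q ->
  p 0 = q 0 -> p 1 = q 1 -> hp (K \o p) (K \o q).
Proof.
move=> cK AK cp cq pq0 pq1.
pose h (st : R * R) : E := p st.2 + clamp st.1 *: (q st.2 - p st.2).
have c2 (k : R -> E) : continuous k -> continuous (fun st : R * R => k st.2).
  by move=> ck; apply: (comp_continuous (f := snd)) => // z; exact: cvg_snd.
have c1 : continuous (fun st : R * R => clamp st.1).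
  apply: (comp_continuous (f := fst)); last exact: clamp_continuous.
  by move=> z; exact: cvg_fst.
exists (fun st => K (h st)); split => [|//|t|t|s].
- apply: (comp_continuous (f := h)) => // st; apply: cvgD; first exact: c2.
  by apply: cvgZ; [exact: c1|apply: cvgB; exact: c2].
- by rewrite /h clamp0 scale0r addr0.
- by rewrite /h clamp1 scale1r addrC subrK.
- by rewrite /h /= pq0 pq1 !subrr !scaler0 !addr0.
Qed.

Lemma id_continuous (X : topologicalType) : continuous (fun x : X => x).
Proof. by move=> ?. Qed.

Lemma affine_fun_continuous (a b : R) : continuous (fun t : R => a * t + b).
Proof. exact: (affine_continuous (@id_continuous R)). Qed.

Lemma reparam_hp f (p q : R -> R) : is_path f -> continuous p -> continuous q ->
  p 0 = q 0 -> p 1 = q 1 -> hp (f \o p) (f \o q).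
Proof. by move=> [cf Af]; exact: (@map_hp R^o f p q). Qed.

Lemma hp_refl f : is_path f -> hp f f.
Proof. by move=> hf; apply: (reparam_hp hf) => //; exact: id_continuous. Qed.

Lemma hp_sym f g : hp f g -> hp g f.
Proof.
move=> [F [cF AF F0 F1 Fs]].
have [e0 e1] : f 0 = g 0 /\ f 1 = g 1.
  by rewrite -!F1; split; [rewrite (proj1 (Fs 1))|rewrite (proj2 (Fs 1))].
exists (fun z => F (1 - z.1, z.2)); split => [|//|t|t|s] /=.
- apply: (comp_continuous (f := fun z : R * R => (1 - z.1, z.2))) => //.
  apply: pair_continuous; last by move=> z; exact: cvg_snd.
  by apply: compl_continuous => z; exact: cvg_fst.
- by rewrite subr0.
- by rewrite subrr.
- by rewrite -e0 -e1; exact: Fs.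
Qed.

Lemma hp_path f g : hp f g -> is_path f /\ is_path g.
Proof.
move=> [F [cF AF F0 F1 Fs]]; split; split.
- have -> : f = fun t => F (0, t) by apply/funext => t; rewrite F0.
  apply: (@comp_continuous _ _ _ (fun t : R => (0, t)) F) => //.
  by apply: pair_continuous; [move=> z; exact: cvg_cst|exact: id_continuous].
- by move=> t; rewrite -F0.
- have -> : g = fun t => F (1, t) by apply/funext => t; rewrite F1.
  apply: (@comp_continuous _ _ _ (fun t : R => (1 : R, t)) F) => //.
  by apply: pair_continuous; [move=> z; exact: cvg_cst|exact: id_continuous].
- by move=> t; rewrite -F1.
Qed.

Lemma hp_ends f g : hp f g -> f 0 = g 0 /\ f 1 = g 1.
Proof.
move=> [F [cF AF F0 F1 Fs]].
by rewrite -!F1; split; [rewrite (proj1 (Fs 1))|rewrite (proj2 (Fs 1))].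
Qed.

Lemma half_eq : 2 * 2^-1 = 1 :> R. Proof. by rewrite mulfV ?pnatr_eq0. Qed.

Lemma paste_half (X : topologicalType) (u : X -> R) (F G : X -> V) :
  continuous u -> continuous F -> continuous G -> (forall x, u x = 2^-1 -> F x = G x) ->
  continuous (fun x => if u x <= 2^-1 then F x else G x).
Proof. by move=> *; exact: paste_continuous. Qed.

Lemma hp_trans g f h : hp f g -> hp g h -> hp f h.
Proof.
move=> hfg hgh; have [e0 e1] := hp_ends hfg.
move: hfg hgh => [F [cF AF F0 F1 Fs]] [G [cG AG G0 G1 Gs]].
have c2 : continuous (fun z : R * R => z.2) by move=> z; exact: cvg_snd.
have c1 : continuous (fun z : R * R => z.1) by move=> z; exact: cvg_fst.
exists (fun z => if z.1 <= 2^-1 then F (2 * z.1, z.2) else G (2 * z.1 - 1, z.2)).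
split => [|z|t|t|s] /=.
- apply: (paste_half (u := fst)) => //.
  + apply: (comp_continuous (f := fun z : R * R => (2 * z.1, z.2))) => //.
    by apply: pair_continuous => //; exact: (Defs.scale_continuous c1).
  + apply: (comp_continuous (f := fun z : R * R => (2 * z.1 - 1, z.2))) => //.
    by apply: pair_continuous => //; exact: (affine_continuous c1).
  + by move=> z ->; rewrite half_eq subrr F1 G0.
- by case: ifP.
- by rewrite invr_ge0 ler0n mulr0 F0.
- rewrite ifF; last by apply/negbTE; rewrite -ltNge; lra.
  by rewrite (_ : 2 * 1 - 1 = 1 :> R) ?G1 //; lra.
- by case: ifP => _; rewrite ?(proj1 (Fs _)) ?(proj2 (Fs _)) ?(proj1 (Gs _)) ?(proj2 (Gs _)).
Qed.

Lemma hp_eq01 f g : is_path f -> is_path g -> (forall t, 0 <= t <= 1 -> f t = g t) -> hp f g.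
Proof.
move=> hf hg fg; have cc : continuous (@clamp R) := @clamp_continuous R.
have e : f \o (@clamp R) = g \o (@clamp R).
  by apply/funext => t /=; apply: fg; rewrite clamp_ge0 clamp_le1.
apply: (hp_trans (g := f \o @clamp R)).
  by apply: (reparam_hp (p := id) hf) => //; [exact: id_continuous|rewrite clamp0|rewrite clamp1].
rewrite e; apply: (reparam_hp (q := id) hg) => //; [exact: id_continuous|exact: clamp0|exact: clamp1].
Qed.

Lemma pcat_path f g : is_path f -> is_path g -> f 1 = g 0 -> is_path (pcat f g).
Proof.
move=> [cf Af] [cg Ag] fg; split=> [|t]; last by rewrite /pcat; case: ifP.
apply: (paste_half (u := id)); first exact: id_continuous.
- by apply: (comp_continuous (g := f)) => //; apply: Defs.scale_continuous; exact: id_continuous.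
- by apply: (comp_continuous (g := g)) => //; exact: affine_fun_continuous.
- by move=> t ->; rewrite half_eq subrr.
Qed.

Lemma pcat0 f g : pcat f g 0 = f 0.
Proof. by rewrite /pcat invr_ge0 ler0n mulr0. Qed.
Lemma pcat1 f g : pcat f g 1 = g 1.
Proof.
rewrite /pcat ifF; last by apply/negbTE; rewrite -ltNge; lra.
by congr g; lra.
Qed.

Lemma prev_path f : is_path f -> is_path (prev f).
Proof.
move=> [cf Af]; split=> [|t]; last exact: Af.
apply: (@comp_continuous _ _ _ (fun t : R => 1 - t) f) => //.
by apply: compl_continuous; exact: id_continuous.
Qed.
Lemma prev0 f : prev f 0 = f 1. Proof. by rewrite /prev subr0. Qed.
Lemma prev1 f : prev f 1 = f 0. Proof. by rewrite /prev subrr. Qed.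
Lemma prevK f : prev (prev f) = f.
Proof. by apply/funext => t; rewrite /prev opprB addrC subrK. Qed.

Lemma cst_path a : A a -> is_path (fun=> a).
Proof. by move=> Aa; split=> // t; exact: cvg_cst. Qed.

Lemma hp_pcat f f' g g' : hp f f' -> hp g g' -> f 1 = g 0 -> hp (pcat f g) (pcat f' g').
Proof.
move=> [F [cF AF F0 F1 Fs]] [G [cG AG G0 G1 Gs]] fg.
have c2 : continuous (fun z : R * R => z.2) by move=> z; exact: cvg_snd.
have c1 : continuous (fun z : R * R => z.1) by move=> z; exact: cvg_fst.
exists (fun z => if z.2 <= 2^-1 then F (z.1, 2 * z.2) else G (z.1, 2 * z.2 - 1)).
split => [|z|t|t|s] /=.
- apply: (paste_half (u := snd)) => //.
  + apply: (comp_continuous (f := fun z : R * R => (z.1, 2 * z.2))) => //.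
    by apply: pair_continuous => //; exact: (Defs.scale_continuous c2).
  + apply: (comp_continuous (f := fun z : R * R => (z.1, 2 * z.2 - 1))) => //.
    by apply: pair_continuous => //; exact: (affine_continuous c2).
  + by move=> z ->; rewrite half_eq subrr (proj2 (Fs _)) (proj1 (Gs _)).
- by case: ifP.
- by rewrite /pcat F0 G0.
- by rewrite /pcat F1 G1.
- rewrite pcat0 pcat1 invr_ge0 ler0n mulr0 (proj1 (Fs _)); split=> //.
  rewrite ifF; last by apply/negbTE; rewrite -ltNge; lra.
  by rewrite (_ : 2 * 1 - 1 = 1 :> R) ?(proj2 (Gs _)) //; lra.
Qed.

Lemma hp_prev f g : hp f g -> hp (prev f) (prev g).
Proof.
move=> [F [cF AF F0 F1 Fs]]; exists (fun z => F (z.1, 1 - z.2)).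
split => [|//|t|t|s] /=; rewrite ?F0 ?F1 //; last first.
  by rewrite subr0 subrr prev0 prev1; case: (Fs s).
apply: (comp_continuous (f := fun z : R * R => (z.1, 1 - z.2))) => //.
apply: pair_continuous; first by move=> z; exact: cvg_fst.
by apply: compl_continuous => z; exact: cvg_snd.
Qed.

Lemma paste_real (p q : R -> R) (a : R) : continuous p -> continuous q -> p a = q a ->
  continuous (fun t => if t <= a then p t else q t).
Proof.
move=> cp cq pq; apply: (paste_continuous (u := id)) => //; first exact: id_continuous.
by move=> x ->.
Qed.

Lemma hp_assoc f g h : is_path f -> is_path g -> is_path h -> f 1 = g 0 -> g 1 = h 0 ->
  hp (pcat (pcat f g) h) (pcat f (pcat g h)).
Proof.
move=> hf hg hh fg gh.
pose q (t : R) := if t <= 2^-1 then 2^-1 * t + 0 else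
  (if t <= 3 / 4 then 1 * t + (- 4^-1) else 2 * t + (- 1)).
have -> : pcat f (pcat g h) = pcat (pcat f g) h \o q.
  apply/funext => t; rewrite /pcat /= /q.
  case: (leP t 2^-1) => t2.
    rewrite ifT; last by lra.
    by rewrite ifT; [congr f; lra|lra].
  case: (leP t (3 / 4)) => t3.
    rewrite ifT; last by lra.
    rewrite ifT; last by lra.
    by rewrite ifF; [congr g; lra|apply/negbTE; rewrite -ltNge; lra].
  rewrite ifF; last by apply/negbTE; rewrite -ltNge; lra.
  by rewrite ifF; [congr h; lra|apply/negbTE; rewrite -ltNge; lra].
apply: (reparam_hp (p := id)) => //.
- by apply: pcat_path; rewrite ?pcat1 //; exact: pcat_path.
- exact: id_continuous.
- apply: paste_real; [exact: affine_fun_continuous| |].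
    by apply: paste_real; [exact: affine_fun_continuous..|lra].
  by rewrite ifT; lra.
- by rewrite /q ifT; lra.
- by rewrite /q ifF; [rewrite ifF; [lra|apply/negbTE; rewrite -ltNge; lra]
    |apply/negbTE; rewrite -ltNge; lra].
Qed.

Lemma hp_cst_l f : is_path f -> hp (pcat (fun=> f 0) f) f.
Proof.
move=> hf; have -> : pcat (fun=> f 0) f = f \o (fun t => if t <= 2^-1 then 0 * t + 0 else 2 * t + (- 1)).
  by apply/funext => t; rewrite /pcat /=; case: leP => _; rewrite ?mul0r ?addr0.
apply: (reparam_hp (q := id)) => //.
- by apply: paste_real; [exact: affine_fun_continuous..|lra].
- exact: id_continuous.
- by rewrite ifT; lra.
- by rewrite ifF; [lra|apply/negbTE; rewrite -ltNge; lra].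
Qed.

Lemma hp_cst_r f : is_path f -> hp (pcat f (fun=> f 1)) f.
Proof.
move=> hf; have -> : pcat f (fun=> f 1) = f \o (fun t => if t <= 2^-1 then 2 * t + 0 else 0 * t + 1).
  by apply/funext => t; rewrite /pcat /=; case: leP => _; rewrite ?mul0r ?addr0 ?add0r.
apply: (reparam_hp (q := id)) => //.
- by apply: paste_real; [exact: affine_fun_continuous..|lra].
- exact: id_continuous.
- by rewrite ifT; lra.
- by rewrite ifF; [lra|apply/negbTE; rewrite -ltNge; lra].
Qed.

Lemma hp_prev_r f : is_path f -> hp (pcat f (prev f)) (fun=> f 0).
Proof.
move=> hf; have -> : pcat f (prev f) = f \o (fun t => if t <= 2^-1 then 2 * t + 0 else (- 2) * t + 2).
  apply/funext => t; rewrite /pcat /= /prev; case: leP => _; rewrite ?addr0 //.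
  by congr f; lra.
have -> : (fun=> f 0) = f \o (fun t : R => 0 * t + 0).
  by apply/funext => t /=; rewrite mul0r addr0.
apply: reparam_hp => //.
- by apply: paste_real; [exact: affine_fun_continuous..|lra].
- exact: affine_fun_continuous.
- by rewrite ifT; lra.
- by rewrite ifF; [lra|apply/negbTE; rewrite -ltNge; lra].
Qed.

Lemma hp_prev_l f : is_path f -> hp (pcat (prev f) f) (fun=> f 1).
Proof. by move=> /prev_path/hp_prev_r; rewrite prevK prev0. Qed.

End Paths.

(** * Fundamental groups and functors on path groupoids *)

Section Models.
Variable R : realType.
Local Open Scope group_scope.

Section Functor.
Variables (V V' : topologicalType) (A : set V) (A' : set V').

(** Continuity on A is tested on continuous maps into A from arbitrary spaces, again without a
    subspace topology. *)
Definition continuous_on (P : V -> V') : Prop :=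
  (forall x, A x -> A' (P x)) /\
  forall (X : topologicalType) (u : X -> V), continuous u -> (forall x, A (u x)) ->
    continuous (fun x => P (u x)).

Lemma path_map (P : V -> V') (f : R -> V) : continuous_on P -> is_path A f -> is_path A' (P \o f).
Proof. by move=> [PA cP] [cf Af]; split=> [|t]; [exact: cP|exact: PA]. Qed.

Lemma hp_map (P : V -> V') (f g : R -> V) : continuous_on P -> hp A f g -> hp A' (P \o f) (P \o g).
Proof.
move=> [PA cP] [F [cF AF F0 F1 Fs]]; exists (fun z => P (F z)); split.
- exact: cP.
- by move=> z; exact: PA.
- by move=> t; rewrite F0.
- by move=> t; rewrite F1.
- by move=> s; rewrite (proj1 (Fs s)) (proj2 (Fs s)).
Qed.
End Functor.

(* B is the fundamental group of A at a: rep b is a loop in the class b. *)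
Definition loop_model (V : topologicalType) (A : set V) (a : V) (B : groupType)
    (rep : B -> R -> V) : Prop :=
  [/\ forall b, is_path A (rep b) /\ (rep b 0%R = a /\ rep b 1%R = a),
      forall b b', hp A (rep b) (rep b') -> b = b',
      forall b b', hp A (rep (b * b')) (pcat (rep b) (rep b')) &
      forall f, is_path A f -> f 0%R = a -> f 1%R = a -> exists b, hp A (rep b) f].

Lemma loop_model_map (V V' : topologicalType) (A : set V) (A' : set V') a (B : groupType)
    (rep : B -> R -> V) (P : V -> V') (P' : V' -> V) :
  continuous_on A A' P -> continuous_on A' A P' ->
  (forall x, A x -> P' (P x) = x) -> (forall x, A' x -> P (P' x) = x) -> A a ->
  loop_model A a rep -> loop_model A' (P a) (fun b => P \o rep b).
Proof.
move=> cP cP' PK P'K Aa [r1 r2 r3 r4]; split.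
- move=> b; have [[cr Ar] [r0 r1']] := r1 b.
  by split; [exact: (path_map cP)|rewrite /= r0 r1'].
- move=> b b' /(hp_map cP') h; apply: r2; move: h.
  have e c : P' \o (P \o rep c) = rep c.
    by apply/funext => t /=; apply: PK; have [[]] := r1 c.
  by rewrite !e.
- move=> b b'; have := hp_map cP (r3 b b').
  congr (hp A' _ _); apply/funext => t; rewrite /pcat /=.
  by case: ifP.
move=> f [cf Af] f0 f1; have [||| b hb] := r4 (P' \o f).
- exact: (path_map cP').
- by rewrite /= f0 PK.
- by rewrite /= f1 PK.
exists b; have := hp_map cP hb; congr (hp A' _ _).
by apply/funext => t /=; exact: P'K.
Qed.

Section PathGroupoid.
Variables (V : topologicalType) (A : set V) (B : groupType).
Implicit Types (W : (R -> V) -> B) (f g : R -> V).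

(** A functor from the fundamental groupoid of A to the group B. *)
Definition path_hom W : Prop :=
  (forall f g, is_path A f -> is_path A g -> f 1%R = g 0%R -> W (pcat f g) = W f * W g) /\
  (forall f g, hp A f g -> W f = W g).

(** Such a functor that is fully faithful at each base point, hence identifies B with the
    fundamental group at every point of A. *)
Definition pi1_model W : Prop :=
  [/\ path_hom W,
      forall f g, is_path A f -> is_path A g -> f 0%R = g 0%R -> f 1%R = g 1%R ->
        W f = W g -> hp A f g &
      forall c b, A c -> exists f, [/\ is_path A f, f 0%R = c, f 1%R = c & W f = b]].

Variable W : (R -> V) -> B.
Hypothesis hW : path_hom W.

Lemma path_hom_cst c : A c -> W (fun=> c) = 1.
Proof.
move=> Ac; apply: (mulgI (W (fun=> c))); rewrite mulg1 -(proj1 hW) //; try exact: cst_path.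
by apply: (proj2 hW); apply: (hp_cst_l (f := fun=> c)); exact: cst_path.
Qed.

Lemma path_hom_prev f : is_path A f -> W (prev f) = (W f)^-1.
Proof.
move=> hf; apply: (mulgI (W f)); rewrite mulgV -(proj1 hW) ?prev0 //; last exact: prev_path.
rewrite (proj2 hW _ _ (hp_prev_r hf)); apply: path_hom_cst; case: hf => _; exact.
Qed.

End PathGroupoid.

Lemma hp_cancel (V : topologicalType) (A : set V) (l f m : R -> V) : is_path A l -> is_path A f -> is_path A m ->
  l 1%R = f 0%R -> m 0%R = f 1%R ->
  hp A (pcat (prev l) (pcat (pcat (pcat l f) m) (prev m))) f.
Proof.
move=> hl hf hm lf fm; have pl := prev_path hl; have pm := prev_path hm.
have plf : is_path A (pcat l f) by apply: pcat_path.
have c0 : (pcat l f) 1%R = m 0%R by rewrite pcat1.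
apply: (hp_trans (g := pcat (prev l) (pcat l f))).
  apply: hp_pcat; first exact: hp_refl; last by rewrite prev1 !pcat0.
  apply: (hp_trans (g := pcat (pcat l f) (pcat m (prev m)))).
    by apply: hp_assoc; rewrite ?prev0.
  apply: (hp_trans (g := pcat (pcat l f) (fun=> (pcat l f) 1%R))).
    apply: hp_pcat; [exact: hp_refl| |by rewrite pcat0].
    by rewrite c0; exact: hp_prev_r.
  exact: hp_cst_r.
apply: (hp_trans (g := pcat (pcat (prev l) l) f)).
  by apply: hp_sym; apply: hp_assoc; rewrite ?prev1.
apply: (hp_trans (g := pcat (fun=> f 0%R) f)); last exact: hp_cst_l.
apply: hp_pcat; [|exact: hp_refl|by rewrite pcat1].
by rewrite -lf; exact: hp_prev_l.
Qed.

(** Choose a path l_c from the base point to each c in A, and let W f be the class of the loop that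
    follows l_{f 0}, then f, then l_{f 1} backwards. *)
Lemma pi1_model_of_loops (V : topologicalType) (A : set V) a (B : groupType) (rep : B -> R -> V) :
  loop_model A a rep -> A a ->
  (forall c, A c -> exists f : R -> V, [/\ is_path A f, f 0%R = a & f 1%R = c]) ->
  exists W : (R -> V) -> B, pi1_model A W.
Proof.
move=> [r1 r2 r3 r4] Aa conn.
have conn' c : exists f : R -> V, A c -> [/\ is_path A f, f 0%R = a & f 1%R = c].
  have [/conn[f hf]|no] := pselect (A c); first by exists f.
  by exists (fun=> a).
have [l hl] := choice conn'.
have lP c : A c -> is_path A (l c) by move=> /hl[].
have l0 c : A c -> l c 0%R = a by move=> /hl[].
have l1 c : A c -> l c 1%R = c by move=> /hl[].
pose J f := pcat (pcat (l (f 0%R)) f) (prev (l (f 1%R))).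
have A0 f : is_path A f -> A (f 0%R) by case.
have A1 f : is_path A f -> A (f 1%R) by case.
have J1 f : is_path A f -> is_path A (pcat (l (f 0%R)) f).
  by move=> hf; apply: pcat_path => //; [exact/lP/A0|exact/l1/A0].
have JP f : is_path A f -> is_path A (J f).
  move=> hf; apply: pcat_path; [exact: J1|exact/prev_path/lP/A1|].
  by rewrite pcat1 prev0 l1 //; exact: A1.
have J0 f : is_path A f -> J f 0%R = a.
  by move=> hf; rewrite /J !pcat0 l0 //; exact: A0.
have JE f : is_path A f -> J f 1%R = a.
  by move=> hf; rewrite /J pcat1 prev1 l0 //; exact: A1.
have exW f : exists b, is_path A f -> hp A (rep b) (J f).
  have [hf|no] := pselect (is_path A f); last by exists 1.
  by have [b hb] := r4 _ (JP _ hf) (J0 _ hf) (JE _ hf); exists b.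
have [W hW] := choice exW.
have uniq f b : is_path A f -> hp A (rep b) (J f) -> W f = b.
  by move=> hf hb; apply: r2; apply: hp_trans (hW _ hf) (hp_sym hb).
have Whp f g : hp A f g -> W f = W g.
  move=> fg; have [hf hg] := hp_path fg; have [e0 e1] := hp_ends fg.
  apply: uniq => //; apply: hp_trans (hW _ hg) _.
  rewrite /J -e0 -e1; apply: hp_pcat.
  - apply: hp_pcat; [exact/hp_refl/lP/A0|exact: hp_sym|by rewrite -e0; exact/l1/A0].
  - exact/hp_refl/prev_path/lP/A1.
  - by rewrite pcat1 prev0 l1 //; exact: A1.
exists W; split; first split=> //.
- move=> f g hf hg fg.
  have hfg := pcat_path hf hg fg.
  apply: uniq => //; apply: hp_trans (r3 _ _) _.
  have Rf := proj2 (r1 (W f)); have Rg := proj2 (r1 (W g)).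
  apply: (hp_trans (g := pcat (J f) (J g))).
    by apply: hp_pcat; [exact: hW|exact: hW|rewrite (proj2 Rf) (proj1 Rg)].
  set lf := l (f 0%R); set lm := l (f 1%R); set lg := l (g 1%R).
  have hlf : is_path A lf by exact/lP/A0.
  have hlm : is_path A lm by exact/lP/A1.
  have hlg : is_path A lg by exact/lP/A1.
  have e1 : lf 1%R = f 0%R by exact/l1/A0.
  have e2 : lm 1%R = f 1%R by exact/l1/A1.
  have e3 : lg 1%R = g 1%R by exact/l1/A1.
  have e4 : lm 0%R = a by exact/l0/A1.
  rewrite /J -fg pcat0 pcat1 -/lf -/lm -/lg.
  have p1 := J1 _ hf; rewrite -/lf in p1.
  have pm := prev_path hlm; have pg := prev_path hlg.
  have hmg : is_path A (pcat lm g) by apply: pcat_path => //; rewrite e2.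
  have hmgg : is_path A (pcat (pcat lm g) (prev lg)) by apply: pcat_path; rewrite ?pcat1 ?prev0.
  apply: (hp_trans (g := pcat (pcat lf f) (pcat (prev lm) (pcat (pcat lm g) (prev lg))))).
    by apply: hp_assoc; rewrite ?pcat1 ?prev0 ?prev1 ?pcat0.
  apply: (hp_trans (g := pcat (pcat lf f) (pcat g (prev lg)))).
    apply: hp_pcat; [exact: hp_refl| |by rewrite pcat1 pcat0 prev0].
    apply: (hp_trans (g := pcat (pcat (prev lm) (pcat lm g)) (prev lg))).
      by apply: hp_sym; apply: hp_assoc; rewrite ?pcat1 ?prev0 ?prev1 ?pcat0.
    apply: hp_pcat; [|exact: hp_refl|by rewrite !pcat1 prev0].
    apply: (hp_trans (g := pcat (pcat (prev lm) lm) g)).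
      by apply: hp_sym; apply: hp_assoc; rewrite ?prev1 // e2.
    apply: (hp_trans (g := pcat (fun=> g 0%R) g)); last exact: hp_cst_l.
    by apply: hp_pcat; [rewrite -fg -e2; exact: hp_prev_l|exact: hp_refl|rewrite pcat1 e2].
  apply: (hp_trans (g := pcat (pcat (pcat lf f) g) (prev lg))).
    by apply: hp_sym; apply: hp_assoc; rewrite ?pcat1 ?prev0.
  apply: hp_pcat; [|exact: hp_refl|by rewrite pcat1 prev0].
  by apply: hp_assoc.
- move=> f g hf hg e0 e1 e.
  have hJ : hp A (J f) (J g).
    by apply: hp_trans (hp_sym (hW _ hf)) _; rewrite e; exact: hW.
  set lf := l (f 0%R); set lm := l (f 1%R).
  have hlf : is_path A lf by exact/lP/A0.
  have hlm : is_path A lm by exact/lP/A1.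
  have k1 : lf 1%R = f 0%R by exact/l1/A0.
  have k2 : lm 1%R = f 1%R by exact/l1/A1.
  have c1 := hp_cancel hlf hf (prev_path hlm) k1 (etrans (prev0 _) k2).
  have c2 := hp_cancel hlf hg (prev_path hlm) (etrans k1 e0) (etrans (etrans (prev0 _) k2) e1).
  apply: hp_trans (hp_sym c1) _; apply: hp_trans c2.
  apply: hp_pcat; [exact/hp_refl/prev_path| |by rewrite prev1 !pcat0].
  apply: hp_pcat; last by rewrite pcat1 prev0.
    by move: hJ; rewrite /J -e0 -e1.
  exact/hp_refl/prev_path/prev_path.
- move=> c b Ac; set lc := l c; have hlc : is_path A lc by exact: lP.
  have k0 : lc 0%R = a by exact: l0.
  have k1 : lc 1%R = c by exact: l1.
  have [hr [ra rb]] := r1 b.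
  have p1 : is_path A (pcat (prev lc) (rep b)) by apply: pcat_path => //; rewrite ?prev1 ?k0 //; exact: prev_path.
  have p2 : is_path A (pcat (pcat (prev lc) (rep b)) lc) by apply: pcat_path; rewrite ?pcat1 ?k0.
  exists (pcat (pcat (prev lc) (rep b)) lc); split=> //; rewrite ?pcat0 ?pcat1 ?prev0 //.
  apply: uniq => //; rewrite /J !pcat0 pcat1 prev0 k1 -/lc.
  apply: hp_sym.
  have := hp_cancel (prev_path hlc) hr hlc; rewrite prevK prev1 ra rb k0 => h.
  apply: hp_trans (h erefl erefl); apply: hp_assoc => //; rewrite ?pcat0 ?pcat1 ?prev0 //.
  exact: prev_path.
Qed.

Section Pi1.
Variables (T : topologicalType) (x : T).
Local Notation I := (unit_interval R).

Definition extend (p : I -> T) : R -> T := fun t => p (to01 t).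

Lemma loop_homotopic_hp (p q : loop R x) :
  loop_homotopic p q <-> hp [set: T] (extend p) (extend q).
Proof.
have p01 (r : loop R x) : extend r 0%R = x /\ extend r 1%R = x.
  by split; [exact: (path_zero (s := r))|exact: (path_one (s := r))].
split=> [[H [cH H0 H1 Hz Ho]]|[F [cF _ F0 F1 Fs]]].
  exists (fun z => H (to01 z.1, to01 z.2)); split => [|//|t|t|s] /=.
  - apply: homotopy_cts_comp => //; first by move=> z; exact: cvg_fst.
    by move=> z; exact: cvg_snd.
  - by rewrite -[to01 0]/zero H0.
  - by rewrite -[to01 1]/one H1.
  - by rewrite (proj1 (p01 p)) (proj2 (p01 p)) -[to01 0]/zero -[to01 1]/one Hz Ho.
exists (fun st => F (of01 st.1, of01 st.2)); split => [|t|t|s|s] /=.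
- apply: (comp_continuous (f := fun st : I * I => (of01 st.1, of01 st.2))) => //.
  by apply: pair_continuous; [exact: of01_fst_continuous|exact: of01_snd_continuous].
- by rewrite of01_zero F0 /extend of01K.
- by rewrite of01_one F1 /extend of01K.
- by rewrite of01_zero (proj1 (Fs _)); case: (p01 p).
- by rewrite of01_one (proj2 (Fs _)); case: (p01 p).
Qed.

Lemma extend_path (p : loop R x) : is_path [set: T] (extend p).
Proof.
split=> //; apply: (comp_continuous (f := @to01 R)); first exact: to01_continuous.
exact: cts_fun.
Qed.

Lemma pi1_loop_model : loop_model [set: T] x (fun b : pi1 R x => extend (repr b)).
Proof.
have p01 (r : loop R x) : extend r 0%R = x /\ extend r 1%R = x.
  by split; [exact: (path_zero (s := r))|exact: (path_one (s := r))].
split.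
- by move=> b; split; [exact: extend_path|exact: p01].
- by move=> b b' /loop_homotopic_hp/pi1_eqP; rewrite !reprK.
- move=> b b'; apply: (hp_trans (g := extend (loop_mul (repr b) (repr b')))).
    by apply/loop_homotopic_hp; exact: repr_pi1.
  apply: hp_eq01; [exact: extend_path| |].
    by apply: pcat_path; [exact: extend_path..|rewrite (proj2 (p01 _)) (proj1 (p01 _))].
  by move=> t t01; rewrite /extend /= /mk_path /concat /pcat to01K.
move=> f [cf _] f0 f1.
have cg : continuous (fun t : I => f (of01 t)).
  by apply: (comp_continuous (f := @of01 R)) => //; exact: of01_continuous.
have g0 : f (of01 (zero : I)) = x by rewrite of01_zero.
have g1 : f (of01 (one : I)) = x by rewrite of01_one.
pose p : loop R x := mk_path cg g0 g1.
exists (\pi_(pi1 R x) p); apply: (hp_trans (g := extend p)).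
  by apply/loop_homotopic_hp; exact: repr_pi1.
apply: hp_eq01; [exact: extend_path|by split|].
by move=> t t01; rewrite /extend /= /mk_path to01K.
Qed.

End Pi1.

End Models.

(** * Transport of a local cocycle along paths *)

Section Cocycle.
Variables (R : realType) (V : topologicalType) (A : set V) (H : groupType).
Local Open Scope group_scope.
Local Notation "0" := (0%R : R).
Local Notation "x < y" := (x < y)%R.
Local Notation "x <= y" := (x <= y)%R.
Implicit Types (f g : R -> V) (h : R -> H).

Definition good (d : V -> V -> H) (W : set V) : Prop :=
  forall a b c, A a -> A b -> A c -> W a -> W b -> W c -> d a b * d b c = d a c.

(** Such a d describes a flat bundle with fibre H: the cocycle relation is only required of points
    close to each other, and monodromy arises along longer paths. *)
Definition local_cocycle (d : V -> V -> H) : Prop :=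
  forall x, A x -> exists2 W : set V, nbhs x W & good d W.

Variable d : V -> V -> H.
Hypothesis hd : local_cocycle d.

Lemma cocycle_diag x : A x -> d x x = 1.
Proof.
move=> Ax; have [W Wx gW] := hd Ax; have := gW x x x Ax Ax Ax.
have hx : W x by exact: nbhs_singleton.
by move=> /(_ hx hx hx) e; apply: (mulgI (d x x)); rewrite e mulg1.
Qed.

Definition develops f h u v : Prop := forall t : R, u <= t <= v ->
  exists2 e : R, 0 < e & forall a b, u <= a <= v -> u <= b <= v ->
    `|a - t|%R < e -> `|b - t|%R < e -> h b = h a * d (f a) (f b).

Lemma path_near f (t : R) (W : set V) : continuous f -> nbhs (f t) W ->
  exists2 e : R, 0 < e & forall a, `|a - t|%R < e -> W (f a).
Proof.
move=> cf hW; have : nbhs t (f @^-1` W) := cf t W hW.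
move=> /nbhs_ballP[e /= e0 he]; exists e => // a ae; apply: he.
by rewrite /ball /= distrC.
Qed.

(** On a short interval around x the map t |-> d (f x) (f t) is a development; two developments on
    adjacent intervals are glued after left multiplication of the second one by a constant. *)
Lemma develop_exists f : is_path A f -> exists h, develops f h 0 1%R.
Proof.
move=> [cf Af]; apply: (cousin (Q := fun u v => exists h, develops f h u v)).
  move=> x x01; have [W hW gW] := hd (Af x).
  have [e e0 he] := path_near cf hW; exists e => // u v u0 ux xv v1 xu vx.
  exists (fun t => d (f x) (f t)) => t /andP[ut tv]; exists e => // a b.
  move=> /andP[ua av] /andP[ub bv] _ _; rewrite gW //; apply: he; rewrite ltr_norml; lra.
move=> u v w u0 uv vw w1 [h1 H1] [h2 H2].
exists (fun t => if t <= v then h1 t else h1 v * (h2 v)^-1 * h2 t) => t /andP[ut tw].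
have [W hW gW] := hd (Af t); have [e0 e00 he0] := path_near cf hW.
case: (ltrgtP t v) => tv.
- have [|e1 e10 he1] := H1 t; first by rewrite ut (ltW tv).
  exists (Num.min e1 (v - t))%R; first by rewrite lt_min e10 subr_gt0.
  move=> a b /andP[ua _] /andP[ub _]; rewrite !lt_min => /andP[a1 a2] /andP[b1 b2].
  have av : a <= v by move: a2; rewrite ltr_norml; lra.
  have bv : b <= v by move: b2; rewrite ltr_norml; lra.
  by rewrite av bv; apply: he1; rewrite ?ua ?ub.
- have [|e1 e10 he1] := H2 t; first by rewrite (ltW tv).
  exists (Num.min e1 (t - v))%R; first by rewrite lt_min e10 subr_gt0.
  move=> a b /andP[_ aw] /andP[_ bw]; rewrite !lt_min => /andP[a1 a2] /andP[b1 b2].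
  have av : v < a by move: a2; rewrite ltr_norml; lra.
  have bv : v < b by move: b2; rewrite ltr_norml; lra.
  rewrite !leNgt av bv /= -!mulgA; congr (_ * (_ * _)); apply: he1 => //.
    by rewrite (ltW av).
  by rewrite (ltW bv).
have [|e1 e10 he1] := H1 t; first by rewrite ut tv lexx.
have [|e2 e20 he2] := H2 t; first by rewrite tv lexx.
exists (Num.min e0 (Num.min e1 e2))%R; first by rewrite !lt_min e00 e10 e20.
move=> a b /andP[ua aw] /andP[ub bw]; rewrite !lt_min => /and3P[a0 a1 a2] /and3P[b0 b1 b2].
have vt : `|v - t|%R < e1 /\ `|v - t|%R < e2 by rewrite -tv subrr normr0.
have Wv : W (f v) by rewrite -tv; exact: nbhs_singleton.
have k1 c : u <= c -> c <= v -> `|c - t|%R < e1 -> h1 c = h1 v * d (f v) (f c).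
  move=> uc cv ct; apply: he1 => //; first by rewrite uv lexx.
    by rewrite uc.
  by case: vt.
have k2 c : v <= c -> c <= w -> `|c - t|%R < e2 -> h2 c = h2 v * d (f v) (f c).
  move=> vc cw ct; apply: he2 => //; first by rewrite vw lexx.
    by rewrite vc.
  by case: vt.
have key c : u <= c <= w -> `|c - t|%R < e0 -> `|c - t|%R < e1 -> `|c - t|%R < e2 ->
    (if c <= v then h1 c else h1 v * (h2 v)^-1 * h2 c) = h1 v * d (f v) (f c).
  move=> /andP[uc cw] c0 c1 c2; case: leP => cv; first exact: k1.
  rewrite (k2 c (ltW cv) cw c2) -mulgA; congr (_ * _); exact: mulKg.
rewrite !key ?ua ?ub // -mulgA gW //; exact: he0.
Qed.

(** On short intervals (h u)^-1 (h v) equals d (f u) (f v) for every development h, and such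
    quotients multiply along the interval. *)
Lemma develop_unique f h h' : develops f h 0 1%R -> develops f h' 0 1%R ->
  (h 0)^-1 * h 1%R = (h' 0)^-1 * h' 1%R.
Proof.
move=> hh hh'; apply: (cousin (Q := fun u v => (h u)^-1 * h v = (h' u)^-1 * h' v)).
  move=> x x01; have [e e0 he] := hh x x01; have [e' e0' he'] := hh' x x01.
  exists (Num.min e e')%R; first by rewrite lt_min e0.
  move=> u v u0 ux xv v1 xu vx; have [x0 x1] := andP x01.
  have u01 : 0 <= u <= 1%R by rewrite u0 (le_trans ux).
  have v01 : 0 <= v <= 1%R by rewrite v1 (le_trans x0).
  have ux' : `|u - x|%R < Num.min e e' by rewrite ltr_norml; lra.
  have vx' : `|v - x|%R < Num.min e e' by rewrite ltr_norml; lra.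
  move: ux' vx'; rewrite !lt_min => /andP[u1 u2] /andP[v2 v3].
  by rewrite (he u v) // (he' u v) // !mulKg.
move=> u v w _ _ _ _ e1 e2.
have split3 (k : R -> H) : (k u)^-1 * k w = ((k u)^-1 * k v) * ((k v)^-1 * k w).
  by rewrite -mulgA mulVKg.
by rewrite split3 e1 e2 -split3.
Qed.

Lemma transport_exists : exists c : (R -> V) -> H, forall f h,
  is_path A f -> develops f h 0 1%R -> c f = (h 0)^-1 * h 1%R.
Proof.
have ex f : exists c : H, is_path A f -> forall h, develops f h 0 1%R -> c = (h 0)^-1 * h 1%R.
  have [hf|no] := pselect (is_path A f); last by exists 1.
  have [h hh] := develop_exists hf; exists ((h 0)^-1 * h 1%R) => _ h' hh'.
  exact: (develop_unique hh hh').
by have [c hc] := choice ex; exists c => f h hf hh; exact: hc.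
Qed.

Lemma develop_rescale f g h (a b : R) : develops f h 0 1%R -> 0 <= a -> 0 <= b -> (a + b)%R <= 1%R ->
  0 < a -> (forall t, 0 <= t <= 1%R -> g t = f (a * t + b)%R) ->
  develops g (fun t => h (a * t + b)%R) 0 1%R.
Proof.
move=> hh a0 b0 ab apos gf t /andP[t0 t1].
have in01 s : 0 <= s <= 1%R -> 0 <= (a * s + b)%R <= 1%R.
  move=> /andP[s0 s1]; have : (a * s <= a)%R by rewrite ler_piMr.
  by have := mulr_ge0 a0 s0; lra.
have [|e e0 he] := hh (a * t + b)%R; first by apply: in01; rewrite t0.
exists (e / a)%R; first by rewrite divr_gt0.
move=> u v u01 v01 ut vt; rewrite !gf //; apply: he; try exact: in01.
  have -> : (a * u + b - (a * t + b) = a * (u - t))%R by ring.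
  by rewrite normrM gtr0_norm // mulrC -ltr_pdivlMr.
have -> : (a * v + b - (a * t + b) = a * (v - t))%R by ring.
by rewrite normrM gtr0_norm // mulrC -ltr_pdivlMr.
Qed.

Lemma half_le (t : R) : t <= 1%R -> (2^-1 * t + 0 <= 2^-1)%R.
Proof. by move=> t1; lra. Qed.

Lemma half_eq0 (t : R) : 0 <= t -> (2^-1 * t + 2^-1 <= 2^-1)%R -> t = 0.
Proof. by move=> t0 t1; lra. Qed.

(** Developments restrict to the two halves of a concatenation. Along a homotopy, the transport is
    locally constant in the parameter, hence constant. *)
Lemma transport_hom (c : (R -> V) -> H) :
  (forall f h, is_path A f -> develops f h 0 1%R -> c f = (h 0)^-1 * h 1%R) -> path_hom A c.
Proof.
move=> hc; split=> [f g hf hg fg|f g [F [cF AF F0 F1 Fs]]].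
  have hfg := pcat_path hf hg fg; have [h hh] := develop_exists hfg.
  rewrite (hc _ _ hfg hh).
  have i0 : 0 <= (2^-1 : R)%R by rewrite invr_ge0 ler0n.
  have i1 : (2^-1 + 0 <= 1 :> R)%R by rewrite addr0 invf_le1 ?ler1n ?ltr0n.
  have i2 : 0 < (2^-1 : R)%R by rewrite invr_gt0 ltr0n.
  have i3 : (2^-1 + 2^-1 <= 1 :> R)%R by rewrite -[X in (_ <= X)%R]half_eq mulr_natl.
  have d1 : develops f (fun t => h (2^-1 * t + 0)%R) 0 1%R.
    apply: (develop_rescale hh i0 (lexx _) i1 i2) => t /andP[t0 t1]; rewrite /pcat ifT; last by lra.
    by congr f; field.
  have d2 : develops g (fun t => h (2^-1 * t + 2^-1)%R) 0 1%R.
    apply: (develop_rescale hh i0 i0 i3 i2) => t /andP[t0 t1]; rewrite /pcat; case: leP => ht.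
      have -> : t = 0 by exact: half_eq0.
      by rewrite -fg; congr f; field.
    by congr g; field.
  rewrite (hc _ _ hf d1) (hc _ _ hg d2).
  have -> : (2^-1 * 0 + 0 = 0 :> R)%R by ring.
  have -> : (2^-1 * 1 + 0 = 2^-1 * 0 + 2^-1 :> R)%R by ring.
  have -> : (2^-1 * 1 + 2^-1 = 1 :> R)%R by field.
  by rewrite -mulgA mulVKg.
pose Fs' s t := F (s, t).
have pF s : is_path A (Fs' s).
  split=> [|t]; last exact: AF.
  apply: (@comp_continuous _ _ _ (fun t : R => (s, t)) F) => //.
  by apply: pair_continuous; [move=> z; exact: cvg_cst|exact: id_continuous].
have -> : f = Fs' 0 by apply/funext => t; rewrite -F0.
have -> : g = Fs' 1%R by apply/funext => t; rewrite -F1.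
apply: (locally_constant (h := fun s => c (Fs' s))) => s0 s001.
have [h hh] := develop_exists (pF s0).
have near_good t : exists2 e : R, 0 < e & exists2 W, good d W &
    forall s a, `|s - s0|%R < e -> `|a - t|%R < e -> W (F (s, a)).
  have [W hW gW] := hd (AF (s0, t)).
  have : nbhs (s0, t) (F @^-1` W) := cF _ W hW.
  move=> /nbhs_ballP[e /= e0 he]; exists e => //; exists W => // s a se ae.
  by apply: he; split; rewrite /ball /= distrC.
(* A development along one stage s0 is carried to a nearby stage s by multiplication with the
   cocycle across the strip; at the fixed endpoints this factor is 1. *)
pose dev s t := h t * d (F (s0, t)) (F (s, t)).
have strip : exists2 e : R, 0 < e & forall s, `|s - s0|%R < e -> develops (Fs' s) (dev s) 0 1%R.
  pose Q u v := exists2 e : R, 0 < e & forall s, `|s - s0|%R < e -> forall t, u <= t <= v ->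
    exists2 e' : R, 0 < e' & forall a b, 0 <= a <= 1%R -> 0 <= b <= 1%R ->
    `|a - t|%R < e' -> `|b - t|%R < e' -> dev s b = dev s a * d (F (s, a)) (F (s, b)).
  suff [e e0 he] : Q 0 1%R by exists e.
  apply: cousin => [x x01|u v w u0 uv vw w1 [e1 e10 he1] [e2 e20 he2]]; last first.
    exists (Num.min e1 e2)%R; first by rewrite lt_min e10.
    move=> s; rewrite lt_min => /andP[s1 s2] t /andP[ut tw].
    have [tv|tv] := leP t v; first by apply: he1; rewrite ?ut.
    by apply: he2; rewrite ?(ltW tv).
  have [e1 e10 [W gW hW]] := near_good x; have [e2 e20 he2] := hh x x01.
  pose e := (Num.min e1 e2)%R; have e0 : 0 < e by rewrite lt_min e10.
  exists (e / 2)%R; first by rewrite divr_gt0.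
  move=> u v u0 ux xv v1 xu vx; exists e => // s se t /andP[ut tv].
  exists (e / 2)%R; first by rewrite divr_gt0.
  move=> a b a01 b01 at' bt.
  have tx : `|t - x|%R < (e / 2)%R by rewrite ltr_norml; lra.
  have ax : `|a - x|%R < e.
    by apply: le_lt_trans (ler_distD t a x) _; lra.
  have bx : `|b - x|%R < e.
    by apply: le_lt_trans (ler_distD t b x) _; lra.
  move: se ax bx; rewrite !lt_min => /andP[s1 s2] /andP[a1 a2] /andP[b1 b2].
  have z0 : `|s0 - s0|%R < e1 by rewrite subrr normr0.
  have Wa := hW s a s1 a1; have Wb := hW s b s1 b1.
  have Wa0 := hW s0 a z0 a1; have Wb0 := hW s0 b z0 b1.
  rewrite /dev (he2 a b) // -!mulgA; congr (_ * _).
  by rewrite /Fs' gW // gW.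
have [e e0 he] := strip; exists e => // s s01 se.
rewrite (hc _ _ (pF s) (he s se)) (hc _ _ (pF s0) hh) /dev.
rewrite !(proj1 (Fs _)) !(proj2 (Fs _)) !cocycle_diag ?mulg1 //.
  by rewrite -(proj2 (Fs 0)).
by rewrite -(proj1 (Fs 0)).
Qed.

End Cocycle.

(** * The complex plane as a topological field *)

Definition cplx (R : realType) : numFieldType := R[i].

Section ComplexTopology.
Variable R : realType.
Local Notation C := (cplx R).
Implicit Types (z w : C) (X : topologicalType).
Local Notation Re := (@complex.Re R).
Local Notation Im := (@complex.Im R).

Definition rc (t : R) : C := (t +i* 0)%C.
Definition ii : C := (0 +i* 1)%C.

Lemma eq_complex2 z w : Re z = Re w -> Im z = Im w -> z = w.
Proof. by case: z w => [a b] [c d] /= -> ->. Qed.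

Lemma rcE t z : rc t * z = (t * Re z +i* (t * Im z))%C.
Proof. by case: z => a b; apply: eq_complex2 => /=; ring. Qed.
Lemma rcD s t : rc (s + t) = rc s + rc t. Proof. by apply: eq_complex2 => /=; ring. Qed.
Lemma rcM s t : rc (s * t) = rc s * rc t. Proof. by apply: eq_complex2 => /=; ring. Qed.
Lemma rcN s : rc (- s) = - rc s. Proof. by apply: eq_complex2 => /=; ring. Qed.
Lemma rc0 : rc 0 = 0. Proof. by []. Qed.
Lemma rc1 : rc 1 = 1. Proof. by []. Qed.

Lemma normE z : `|z| = rc (Num.sqrt (Re z ^+ 2 + Im z ^+ 2)).
Proof. by case: z. Qed.

Lemma ltrc s t : (rc s < rc t) = (s < t). Proof. by rewrite /rc ltcR. Qed.
Lemma lerc s t : (rc s <= rc t) = (s <= t). Proof. by rewrite /rc lecR. Qed.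

Lemma rc_gt0 (e : C) : 0 < e -> exists2 d : R, 0 < d & e = rc d.
Proof.
by case: e => a b; rewrite ltcE /= => /andP[/eqP -> a0]; exists a.
Qed.

Lemma norm_Re z : rc `|Re z| <= `|z|.
Proof. by rewrite normE lerc -sqrtr_sqr ler_wsqrtr // lerDl sqr_ge0. Qed.
Lemma norm_Im z : rc `|Im z| <= `|z|.
Proof. by rewrite normE lerc -sqrtr_sqr ler_wsqrtr // lerDr sqr_ge0. Qed.

Lemma norm_le_ReIm z : `|z| <= rc (`|Re z| + `|Im z|).
Proof.
rewrite normE lerc; have h : 0 <= `|Re z| + `|Im z| by rewrite addr_ge0.
rewrite -(ger0_norm h) -sqrtr_sqr ler_wsqrtr // sqrrD !real_normK ?num_real //.
by rewrite -addrA [_ *+ 2 + _]addrC addrA lerDl mulrn_wge0 // mulr_ge0.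
Qed.

Lemma Re_continuous : continuous (Re : C -> R).
Proof.
move=> z A /nbhs_ballP[e /= e0 hA].
apply/nbhs_ballP; exists (rc e) => /=; first by rewrite -[0]/(rc 0) ltrc.
move=> w; rewrite /ball /= => zw; apply: hA; rewrite /ball /= -ltrc; apply: le_lt_trans zw.
by have := norm_Re (z - w); congr (rc `|_| <= _); case: (z) (w) => ? ? [].
Qed.

Lemma Im_continuous : continuous (Im : C -> R).
Proof.
move=> z A /nbhs_ballP[e /= e0 hA].
apply/nbhs_ballP; exists (rc e) => /=; first by rewrite -[0]/(rc 0) ltrc.
move=> w; rewrite /ball /= => zw; apply: hA; rewrite /ball /= -ltrc; apply: le_lt_trans zw.
by have := norm_Im (z - w); congr (rc `|_| <= _); case: (z) (w) => ? ? [].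
Qed.

Lemma complex_continuous X (f : X -> C) :
  continuous (fun x => Re (f x)) -> continuous (fun x => Im (f x)) -> continuous f.
Proof.
move=> cf cg x; apply/cvgrPdist_lt => e /rc_gt0[d d0 ->].
have d2 : 0 < d / 2 by rewrite divr_gt0.
have h1 : nbhs x (fun y => ball (Re (f x)) (d / 2) (Re (f y))) := cf x _ (nbhsx_ballx (Re (f x)) _ d2).
have h2 : nbhs x (fun y => ball (Im (f x)) (d / 2) (Im (f y))) := cg x _ (nbhsx_ballx (Im (f x)) _ d2).
apply: filterS (filterI h1 h2) => y [k1 k2].
apply: le_lt_trans (norm_le_ReIm _) _; rewrite ltrc.
have -> : Re (f x - f y) = Re (f x) - Re (f y) by case: (f x) (f y) => ? ? [].
have -> : Im (f x - f y) = Im (f x) - Im (f y) by case: (f x) (f y) => ? ? [].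
by rewrite [d](splitr d) ltrD.
Qed.

Lemma rc_continuous X (f : X -> R) : continuous f -> continuous (fun x => rc (f x)).
Proof. by move=> cf; apply: complex_continuous => //= x; exact: cvg_cst. Qed.

Lemma Dc X (f g : X -> C) : continuous f -> continuous g -> continuous (fun x => f x + g x).
Proof. by move=> cf cg x; apply: (@cvgD C C); [exact: cf|exact: cg]. Qed.
Lemma Mc X (f g : X -> C) : continuous f -> continuous g -> continuous (fun x => f x * g x).
Proof. by move=> cf cg x; apply: (@cvgM C); [exact: cf|exact: cg]. Qed.
Lemma Nc X (f : X -> C) : continuous f -> continuous (fun x => - f x).
Proof. by move=> cf x; apply: (@cvgN C C); exact: cf. Qed.
Lemma Vc X (f : X -> C) : (forall x, f x != 0) -> continuous f -> continuous (fun x => (f x)^-1).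
Proof. by move=> f0 cf x; apply: (@cvgV C) => //; exact: cf. Qed.
Lemma Kc X (Y : topologicalType) (y : Y) : continuous (fun _ : X => y).
Proof. by move=> x; exact: cvg_cst. Qed.

Definition eit (t : R) : C := (cos t +i* sin t)%C.

Lemma eitD s t : eit (s + t) = eit s * eit t.
Proof. by apply: eq_complex2; rewrite /= ?cosD ?sinD; ring. Qed.
Lemma eit0 : eit 0 = 1. Proof. by apply: eq_complex2; rewrite /= ?cos0 ?sin0. Qed.
Lemma eit_neq0 t : eit t != 0.
Proof.
apply/eqP => h; have := cos2Dsin2 t; have [-> ->] : cos t = 0 /\ sin t = 0 by case: h.
by rewrite expr0n addr0 => /esym/eqP; rewrite oner_eq0.
Qed.
Lemma eit_pi : eit pi = -1. Proof. by apply: eq_complex2; rewrite /= ?cospi ?sinpi ?oppr0. Qed.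
Lemma eit_continuous X (f : X -> R) : continuous f -> continuous (fun x => eit (f x)).
Proof.
by move=> cf; apply: complex_continuous => /=; apply: (comp_continuous cf);
  [exact: continuous_cos|exact: continuous_sin].
Qed.

End ComplexTopology.

(** * Segments, star-shaped sets and pieces of paths *)

Section Plane.
Variable R : realType.
Local Notation C := (cplx R).
Local Notation Re := (@complex.Re R).
Local Notation Im := (@complex.Im R).
Local Notation rc := (@rc R).
Local Notation i := (@ii R).
Implicit Types (z w k : C) (t : R).

Lemma ReD z w : Re (z + w) = Re z + Re w. Proof. by case: z w => ? ? []. Qed.
Lemma ImD z w : Im (z + w) = Im z + Im w. Proof. by case: z w => ? ? []. Qed.
Lemma ReN z : Re (- z) = - Re z. Proof. by case: z. Qed.
Lemma ImN z : Im (- z) = - Im z. Proof. by case: z. Qed.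
Lemma ReM z w : Re (z * w) = Re z * Re w - Im z * Im w. Proof. by case: z w => ? ? []. Qed.
Lemma ImM z w : Im (z * w) = Re z * Im w + Im z * Re w.
Proof. by case: z w => ? ? [? ?] /=; rewrite addrC. Qed.
Definition cE := (ReD, ImD, ReN, ImN, ReM, ImM).

Definition line k z : R -> C := fun t => k + rc (clamp t) * (z - k).

Lemma line0 k z : line k z 0 = k.
Proof. by rewrite /line clamp0 rc0 mul0r addr0. Qed.
Lemma line1 k z : line k z 1 = z.
Proof. by rewrite /line clamp1 rc1 mul1r addrC subrK. Qed.
Lemma lineN k z t : - line k z t = line (- k) (- z) t.
Proof. by rewrite /line; ring. Qed.

Definition star (U : set C) k : Prop :=
  forall z t, U z -> 0 <= t <= 1 -> U (k + rc t * (z - k)).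

Lemma clamp01 t : 0 <= clamp t <= 1. Proof. by rewrite clamp_ge0 clamp_le1. Qed.

Lemma clampc (X : topologicalType) (f : X -> R) : continuous f -> continuous (fun x => clamp (f x)).
Proof. by move=> cf; apply: (comp_continuous cf); exact: clamp_continuous. Qed.

Lemma line_path U k z : star U k -> U z -> is_path U (line k z).
Proof.
move=> sU Uz; split=> [|t]; last by apply: sU => //; exact: clamp01.
apply: Dc; first exact: Kc.
by apply: Mc; [apply/rc_continuous/clampc/id_continuous|exact: Kc].
Qed.

Lemma fst_c (X Z : topologicalType) : continuous (@fst X Z).
Proof. by move=> z; exact: cvg_fst. Qed.
Lemma snd_c (X Z : topologicalType) : continuous (@snd X Z).
Proof. by move=> z; exact: cvg_snd. Qed.

Lemma add_c (X : topologicalType) (f g : X -> R) :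
  continuous f -> continuous g -> continuous (fun x => f x + g x).
Proof. by move=> cf cg x; apply: (@cvgD R R^o); [exact: cf|exact: cg]. Qed.
Lemma mul_c (X : topologicalType) (f g : X -> R) :
  continuous f -> continuous g -> continuous (fun x => f x * g x).
Proof. by move=> cf cg x; apply: (@cvgM R); [exact: cf|exact: cg]. Qed.
Lemma opp_c (X : topologicalType) (f : X -> R) :
  continuous f -> continuous (fun x => - f x).
Proof. by move=> cf x; apply: (@cvgN R R^o); exact: cf. Qed.

(* Two straight-line homotopies: first pull g t towards k by the factor t, then
   let the point g t run to g 1. *)
Lemma star_hp U k (g : R -> C) : star U k -> is_path U g -> g 0 = k -> hp U g (line k (g 1)).
Proof.
move=> sU [cg Ug] g0.
have c1 : continuous (fun x : R * R => clamp x.1) by apply: clampc; exact: fst_c.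
have c2 : continuous (fun x : R * R => clamp x.2) by apply: clampc; exact: snd_c.
have o2 : continuous (fun x : R * R => x.2) by exact: snd_c.
have o1 : continuous (fun x : R * R => 1 - clamp x.1).
  by apply: add_c; [exact: Kc|exact: opp_c].
apply: (hp_trans (g := fun t => k + rc (clamp t) * (g t - k))).
  exists (fun x => k + rc ((1 - clamp x.1) + clamp x.1 * clamp x.2) * (g x.2 - k)).
  split=> [|x|t|t|s] /=.
  - apply: Dc; first exact: Kc.
    apply: Mc; first by apply: rc_continuous; apply: add_c => //; exact: mul_c.
    by apply: Dc; [exact: comp_continuous|exact: Kc].
  - apply: sU => //; have /andP[? ?] := clamp01 x.1; have /andP[? ?] := clamp01 x.2; nra.
  - by rewrite clamp0 mul0r subr0 addr0 rc1 mul1r addrC subrK.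
  - by rewrite clamp1 mul1r subrr add0r.
  rewrite clamp0 clamp1 g0 subrr mulr0 addr0 mulr1 subrK rc1; split=> //.
  by rewrite mul1r addrC subrK.
exists (fun x => k + rc (clamp x.2) * (g ((1 - clamp x.1) * x.2 + clamp x.1) - k)).
split=> [|x|t|t|s] /=.
- apply: Dc; first exact: Kc.
  apply: Mc; first exact: rc_continuous.
  apply: Dc; last exact: Kc.
  by apply: (comp_continuous _ cg); apply: add_c => //; exact: mul_c.
- by apply: sU => //; exact: clamp01.
- by rewrite clamp0 subr0 mul1r addr0.
- by rewrite clamp1 subrr mul0r add0r.
by rewrite !clamp0 !clamp1 rc0 !mul0r mulr1 subrK.
Qed.

Lemma path_sub (V : topologicalType) (U A : set V) (f : R -> V) : U `<=` A -> is_path U f -> is_path A f.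
Proof. by move=> UA [cf Uf]; split=> // t; exact: UA. Qed.

Lemma hp_sub (V : topologicalType) (U A : set V) (f g : R -> V) : U `<=` A -> hp U f g -> hp A f g.
Proof. by move=> UA [F [? UF ? ? ?]]; exists F; split=> // z; exact: UA. Qed.

Definition sub (V : Type) (f : R -> V) (u v : R) : R -> V := fun t => f (u + clamp t * (v - u)).

Lemma sub_path (V : topologicalType) (A : set V) (f : R -> V) u v : is_path A f -> is_path A (sub f u v).
Proof.
move=> [cf Af]; split=> [|t]; last exact: Af.
apply: (comp_continuous (g := f)) => //; apply: add_c; first exact: Kc.
by apply: mul_c; [apply: clampc; exact: id_continuous|exact: Kc].
Qed.

Lemma sub0 (V : Type) (f : R -> V) u v : sub f u v 0 = f u.
Proof. by rewrite /sub clamp0 mul0r addr0. Qed.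
Lemma sub1 (V : Type) (f : R -> V) u v : sub f u v 1 = f v.
Proof. by rewrite /sub clamp1 mul1r addrC subrK. Qed.

Local Open Scope group_scope.

Lemma path_hom_sub (V : topologicalType) (A : set V) (G : groupType) (c : (R -> V) -> G) (f : R -> V) (u v w : R) :
  path_hom A c -> is_path A f -> c (sub f u w) = c (sub f u v) * c (sub f v w).
Proof.
move=> [cM ch] hf; rewrite -cM ?sub1 ?sub0 //; try exact: sub_path.
apply: ch.
pose q (t : R) := (if t <= 2^-1 then u + clamp (2 * t) * (v - u) else v + clamp (2 * t - 1) * (w - v))%R.
have -> : pcat (sub f u v) (sub f v w) = f \o q.
  by apply/funext => t; rewrite /pcat /q /sub /=; case: ifP.
apply: (reparam_hp (p := fun t => (u + clamp t * (w - u))%R)) => //.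
- apply: add_c; first exact: Kc.
  by apply: mul_c; [apply: clampc; exact: id_continuous|exact: Kc].
- apply: paste_real.
  + apply: add_c; first exact: Kc.
    by apply: mul_c; [apply: clampc; apply: mul_c; [exact: Kc|exact: id_continuous]|exact: Kc].
  + apply: add_c; first exact: Kc.
    by apply: mul_c; [apply: clampc; exact: affine_fun_continuous|exact: Kc].
  + by rewrite half_eq subrr clamp1 clamp0; ring.
- by rewrite /q ifT ?mulr0 ?clamp0 ?invr_ge0 ?ler0n //; ring.
- rewrite /q ifF; last by apply/negbTE; rewrite -ltNge invf_lt1 ?ltr1n ?ltr0n.
  have -> : (2 * 1 - 1 = 1 :> R)%R by ring.
  by rewrite clamp1; ring.
Qed.

(** In a star-shaped set any path from the centre is homotopic to a segment. *)
Lemma path_hom_line (A U : set C) k (G : groupType) (c : (R -> C) -> G) (f : R -> C) :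
  path_hom A c -> U `<=` A -> star U k -> is_path U f ->
  c (line k (f 0%R)) * c f = c (line k (f 1%R)).
Proof.
move=> [cM ch] UA sU hf; have [_ Uf] := hf.
have hl : is_path U (line k (f 0%R)) by apply: line_path => //.
have e : line k (f 0%R) 1%R = f 0%R by exact: line1.
rewrite -cM //; [|exact: path_sub hl|exact: path_sub hf].
apply: ch; apply: (hp_sub UA).
have := star_hp sU (pcat_path hl hf e); rewrite pcat0 line0 pcat1; exact.
Qed.

End Plane.

(** * Loops in the plane punctured at 2 and -2 *)

Section TwicePunctured.
Variable R : realType.
Local Notation C := (cplx R).
Local Notation Re := (@complex.Re R).
Local Notation Im := (@complex.Im R).
Local Notation rc := (@rc R).
Local Notation i := (@ii R).
Implicit Types (z w k : C) (t : R).

Definition punct2 : set C := [set y | y != rc 2 /\ y != rc (- 2)].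
Local Notation Y := punct2.

(* Charts of Y covering it: the plane minus two rays (None), the plane minus one
   ray starting at 2 or at -2 and containing the other puncture (Some). *)
Definition side (b : bool) : R := if b then 1 else -1.
Definition chart (j : option bool) : set C :=
  [set z | Im z != 0 \/ if j is Some b then 2 < side b * Re z else - 2 < Re z < 2].
Definition center (j : option bool) : C := if j is Some b then rc (3 * side b) else 0.

Lemma side_sq b : side b * side b = 1. Proof. by case: b; rewrite /side; ring. Qed.

Lemma chart_sub j : chart j `<=` Y.
Proof.
move=> z hz; split; apply/eqP => e; move: hz; rewrite e {e} => -[/eqP //|];
  case: j => [[]|] /=; rewrite /side => h; try (move/andP: h => [? ?]); lra.
Qed.

Lemma convex_gt0 t (x : R) : 0 < x -> 0 <= t -> t <= 1 -> 0 < t * x + (1 - t).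
Proof.
move=> x0 t0 t1; have [->|tn] := eqVneq t 0; first by rewrite mul0r subr0 add0r.
by rewrite ltr_wpDr ?subr_ge0 // mulr_gt0 // lt_def tn.
Qed.

Lemma chart_star j : star (chart j) (center j).
Proof.
move=> z t [Iz|Rz] /andP[t0 t1].
  have Ic : Im (center j) = 0 by case: j.
  have [->|tn0] := eqVneq t 0.
    rewrite rc0 mul0r addr0; right; case: j {Ic} => [b|] /=; last by lra.
    by case: b; rewrite /side; lra.
  by left; rewrite !cE Ic /= oppr0 !addr0 add0r mul0r addr0 mulf_neq0.
case: j Rz => [b|] Rz; right; rewrite !cE /=.
  suff : 0 < t * (side b * Re z - 2) + (1 - t).
    by move: Rz; case: b; rewrite /side => Rz; lra.
  by apply: convex_gt0 => //; rewrite subr_gt0.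
have /andP[? ?] := Rz; rewrite mul0r !subr0; apply/andP; split; nra.
Qed.

Lemma chart_center j : chart j (center j).
Proof. by right; case: j => [[]|] /=; rewrite ?/side; lra. Qed.

Lemma near_gt (h : R -> R) (a x : R) : continuous h -> a < h x ->
  exists2 e : R, 0 < e & forall t, `|t - x| < e -> a < h t.
Proof.
move=> ch ax; apply: (path_near (W := [set y | a < y]) ch).
exact: (open_nbhs_nbhs (conj (@open_gt R a) ax)).
Qed.

Lemma chart_cover (f : R -> C) (x : R) : continuous f -> Y (f x) ->
  exists2 e : R, 0 < e & exists j, forall t, `|t - x| < e -> chart j (f t).
Proof.
move=> cf [y1 y2].
have cR : continuous (fun t => Re (f t)) by apply: (comp_continuous cf); exact: Re_continuous.
have cI : continuous (fun t => Im (f t)) by apply: (comp_continuous cf); exact: Im_continuous.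
have [I0|I0] := eqVneq (Im (f x)) 0; last first.
  have h : 0 < Im (f x) * Im (f x) by rewrite -expr2 lt_def sqrf_eq0 I0 sqr_ge0.
  have [e e0 he] := near_gt (mul_c cI cI) h.
  exists e => //; exists None => t /he ht; left; apply/eqP => ht0.
  by move: ht; rewrite ht0 mulr0 ltxx.
have r1 : Re (f x) != 2.
  by apply: contra y1 => /eqP e; apply/eqP; exact: eq_complex2.
have r2 : Re (f x) != - 2.
  by apply: contra y2 => /eqP e; apply/eqP; exact: eq_complex2.
case: (ltgtP (Re (f x)) 2) => h; last by move/eqP: r1.
  case: (ltgtP (- 2) (Re (f x))) => h'; last by rewrite -h' eqxx in r2.
    have k : 0 < 4 - Re (f x) * Re (f x) by nra.
    have [e e0 he] := near_gt (add_c (fun x => @Kc _ _ (4 : R) x) (opp_c (mul_c cR cR))) k.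
    exists e => //; exists None => t /he ht; right; apply/andP; split; nra.
  have k : 2 < - Re (f x) by lra.
  have [e e0 he] := near_gt (opp_c cR) k.
  by exists e => //; exists (Some false) => t /he ht; right; rewrite /side mulN1r.
have [e e0 he] := near_gt cR h.
by exists e => //; exists (Some true) => t /he ht; right; rewrite /side mul1r.
Qed.

Local Open Scope group_scope.

Variables (G : groupType) (c : (R -> C) -> G).
Hypothesis hc : path_hom Y c.
Local Notation sc b := (rc (side b)).

(* The value of c on the loop that runs from 0 through i, 3 and -i back to 0, or
   on its image under the half turn. *)
Definition lasso (b : bool) : G :=
  c (line 0 (sc b * i)%R) * (c (line (center (Some b)) (sc b * i)%R))^-1 *
  c (line (center (Some b)) (- (sc b * i))%R) * (c (line 0 (- (sc b * i))%R))^-1.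

Definition base (j : option bool) : G :=
  if j is Some b then c (line 0 (sc b * i)%R) * (c (line (center j) (sc b * i)%R))^-1 else 1.
(** The value of c on a path from 0 to z that reaches the centre of the chart j by a fixed route and
    then stays in the chart. *)
Definition potential j z : G := base j * c (line (center j) z).

Lemma half_plane_path (z w : C) : (0 < Im z * Im w)%R ->
  is_path (fun x : C => Im x != 0%R) (line z w).
Proof.
move=> zw; apply: (path_sub (U := fun x : C => 0 < Im x * Im z)%R).
  by move=> x /=; apply: contraTN => /eqP ->; rewrite mul0r ltxx.
have z2 : (0 < Im z * Im z)%R.
  rewrite -expr2 lt_def sqrf_eq0 sqr_ge0 andbT.
  by apply: contraTN zw => /eqP ->; rewrite mul0r ltxx.
apply: line_path => [x t /= xz /andP[t0 t1]|/=]; last by rewrite mulrC.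
rewrite !cE /= mul0r addr0.
have -> : ((Im z + t * (Im x - Im z)) * Im z = (1 - t) * (Im z * Im z) + t * (Im x * Im z))%R by ring.
have [->|tn] := eqVneq t 0%R; first by rewrite subr0 mul1r mul0r addr0.
apply: ltr_wpDl; first by rewrite mulr_ge0 ?subr_ge0 // ltW.
by rewrite mulr_gt0 // lt_def tn.
Qed.

(** An open half plane lies in every chart, so moving from z to w inside it changes both segments by
    the same factor. *)
Lemma line_ratio j (z w : C) : (0 < Im z * Im w)%R ->
  c (line 0 z) * (c (line (center j) z))^-1 = c (line 0 w) * (c (line (center j) w))^-1.
Proof.
move=> /half_plane_path hp.
have sub j' : (fun x : C => is_true (Im x != 0%R)) `<=` chart j' by move=> x Ix; left.
have h j' := path_hom_line hc (@chart_sub j') (@chart_star j') (path_sub (@sub j') hp).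
have := h None; have := h j; rewrite line0 line1 => <- <-.
by rewrite invgM mulgA mulgK.
Qed.

Variable S : set G.
Hypothesis hS : is_subgroup S.
Hypothesis Slasso : forall b, S (lasso b).

(** The quotient depends only on the half plane containing z: it is 1 on the side through which
    [base] enters the chart, and the inverse of [lasso b] on the other. *)
Lemma potential_None j z : chart None z -> chart j z ->
  S (potential None z * (potential j z)^-1).
Proof.
case: j => [b|]; last by rewrite mulgV => *; exact: (sgr1 hS).
rewrite /potential /base mul1g => zN zb.
have Iz : Im z != 0%R.
  case: zN => // /= /andP[h1 h2]; case: zb => //=; case: b; rewrite /side; lra.
rewrite invgM mulgA.
have := @line_ratio (Some b) z.
have [hz|hz] : (0 < Im z * Im (sc b * i)%R)%R \/ (0 < Im z * Im (- (sc b * i))%R)%R.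
- rewrite !cE /=; case: (ltgtP (Im z) 0%R) Iz => // h _; case: (b); rewrite /side; [right|left|left|right]; lra.
- by move=> /(_ _ hz) ->; rewrite mulgV; exact: (sgr1 hS).
move=> /(_ _ hz) ->; set p := c (line 0 _); set q := c (line _ _).
have -> : p * q^-1 * (c (line 0 (sc b * i)%R) * (c (line (center (Some b)) (sc b * i)%R))^-1)^-1 = (lasso b)^-1.
  by rewrite /lasso -/p -/q !invgM !invgK !mulgA.
exact: (sgrV hS).
Qed.

Lemma potential_ratio (j k : option bool) z : chart j z -> chart k z ->
  S (potential j z * (potential k z)^-1).
Proof.
have [h|h] : chart None z \/ (~ chart None z).
- by have [?|?] := pselect (chart None z); [left|right].
- move=> zj zk; have h1 := potential_None h zj; have h2 := potential_None h zk.
  have := sgrM hS (sgrV hS h1) h2; rewrite invgM invgK.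
  by rewrite -mulgA mulKg.
move=> zj zk; have -> : j = k; last by rewrite mulgV; exact: (sgr1 hS).
case: j k zj zk => [b|] [b'|] // [h1|h1] [h2|h2]; try by exfalso; apply: h; left.
by congr Some; move: h1 h2; case: (b); case: (b') => //; rewrite /side; lra.
Qed.

(** The generation half of van Kampen's theorem. On a piece of the loop inside one chart, c is the
    quotient of the potentials at the ends; changing the chart at a division point costs an element
    of S. *)
Lemma punct2_generated f : is_path Y f -> f 0%R = 0%R -> f 1%R = 0%R -> S (c f).
Proof.
move=> hf f0 f1; have [cf Yf] := hf.
have cov x := chart_cover cf (Yf x).
pose Q (u v : R) := forall j k : option bool, chart j (f u) -> chart k (f v) ->
  S (potential j (f u) * c (sub f u v) * (potential k (f v))^-1).
have Q01 : Q 0%R 1%R.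
  apply: cousin => [x x01|u v w u0 uv vw w1 h1 h2 j k uj wk].
    have [e e0 [m he]] := cov x; exists e => // u v u0 ux xv v1 xu vx j k uj vk.
    have mu t : (u <= t <= v)%R -> chart m (f t).
      by move=> /andP[ut tv]; apply: he; rewrite ltr_norml; lra.
    have uv : (u <= v)%R by lra.
    have um : chart m (f u) by apply: mu; rewrite lexx.
    have vm : chart m (f v) by apply: mu; rewrite lexx uv.
    have hs : is_path (chart m) (sub f u v).
      split=> [|t]; first by case: (sub_path u v hf).
      by apply: mu; have /andP[? ?] := clamp01 t; apply/andP; split; nra.
    have key : potential m (f u) * c (sub f u v) = potential m (f v).
      rewrite /potential -mulgA; congr (_ * _).
      by have := path_hom_line hc (@chart_sub m) (@chart_star m) hs; rewrite sub0 sub1.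
    have := sgrM hS (potential_ratio uj um) (potential_ratio vm vk).
    by rewrite -key; move: (potential m (f u)) => p; rewrite !mulgA mulgVK.
  have [e e0 [m he]] := cov v.
  have vm : chart m (f v) by apply: he; rewrite subrr normr0.
  have := sgrM hS (h1 j m uj vm) (h2 m k vm wk).
  by rewrite (path_hom_sub u v w hc hf); move: (potential m (f v)) => p; rewrite !mulgA mulgVK.
have c0 : chart None (0%R : C) by exact: (@chart_center None).
have := Q01 None None; rewrite f0 f1 => /(_ c0 c0).
have -> : c (sub f 0%R 1%R) = c f.
  apply: (proj2 hc).
  apply: hp_eq01; [exact: sub_path|exact: hf|].
  by move=> t t01; rewrite /sub clamp_id // subr0 mulr1 add0r.
have -> : potential None (0%R : C) = 1.
  rewrite /potential /base mul1g -(path_hom_cst hc (chart_sub c0)); congr c.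
  by apply/funext => t; rewrite /line /center subrr mulr0 addr0.
by rewrite mul1g invg1 mulg1.
Qed.

End TwicePunctured.

(** * Continuous logarithms along paths *)

Section Lift.
Variable R : realType.
Local Notation C := (cplx R).
Local Notation Re := (@complex.Re R).
Local Notation Im := (@complex.Im R).
Local Notation rc := (@rc R).
Local Notation eit := (@eit R).
Implicit Types (z w : C) (t : R).

Definition nonzero : set C := [set z | z != 0].

Lemma rc_neq0 t : (rc t != 0) = (t != 0).
Proof. by apply/idP/idP; apply: contra => /eqP e; apply/eqP; [rewrite e|case: e]. Qed.

Lemma eit_norm t : Re (eit t) ^+ 2 + Im (eit t) ^+ 2 = 1.
Proof. exact: cos2Dsin2. Qed.

Lemma eitN t : eit (- t) = (eit t)^-1.
Proof.
by apply: (mulIf (eit_neq0 t)); rewrite -eitD addNr eit0 mulVf ?eit_neq0.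
Qed.

Lemma eit_atan z : 0 < Re z -> Re z ^+ 2 + Im z ^+ 2 = 1 -> z = eit (atan (Im z / Re z)).
Proof.
move=> a0 h.
have e : Num.sqrt (1 + (Im z / Re z) ^+ 2) = (Re z)^-1.
  have -> : 1 + (Im z / Re z) ^+ 2 = ((Re z)^-1) ^+ 2.
    have -> : 1 + (Im z / Re z) ^+ 2 = (Re z ^+ 2 + Im z ^+ 2) / Re z ^+ 2.
      by field; rewrite gt_eqF.
    by rewrite h mul1r exprVn.
  by rewrite sqrtr_sqr gtr0_norm // invr_gt0.
have ec : cos (atan (Im z / Re z)) = Re z by rewrite cos_atan e invrK.
apply: eq_complex2 => //=; rewrite ?ec //.
have c0 : cos (atan (Im z / Re z)) != 0 by rewrite ec gt_eqF.
have : tan (atan (Im z / Re z)) = Im z / Re z by exact: atanK.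
by rewrite /tan ec => /(congr1 ( *%R^~ (Re z))); rewrite !divfK ?gt_eqF.
Qed.

Lemma eit_int (n : int) : eit (n%:~R * pi) ^+ 2 = 1.
Proof.
have h (m : nat) : eit (m%:R * pi) ^+ 2 = 1.
  elim: m => [|m IH]; first by rewrite mul0r eit0 expr1n.
  by rewrite -addn1 natrD mulrDl mul1r eitD eit_pi exprMn IH sqrrN expr1n mulr1.
case: n => m; first exact: h.
by rewrite NegzE mulrNz mulNr eitN exprVn h invr1.
Qed.

Lemma eit_sqr1 x : eit x ^+ 2 = 1 -> exists n : int, x = n%:~R * pi.
Proof.
move=> hx; pose n := Num.floor (x / pi); exists n.
have pi0 : 0 < pi :> R := pi_gt0 R.
pose y := x - n%:~R * pi.
have y0 : 0 <= y by rewrite subr_ge0 -ler_pdivlMr // Num.Theory.floor_le.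
have y1 : y < pi.
  rewrite ltrBlDr -{1}[pi]mul1r -mulrDl -ltr_pdivrMr // addrC.
  by have := Num.Theory.floorD1_gt (x / pi); rewrite -/n intrD.
have hy : eit y ^+ 2 = 1.
  by rewrite /y eitD exprMn hx mul1r eitN exprVn eit_int invr1.
have sy : sin y = 0.
  move/eqP: hy; rewrite sqrf_eq1 => /orP[] /eqP /(congr1 Im) //= ->.
  by rewrite oppr0.
apply/eqP; rewrite -subr_eq0 -/y; apply/negPn/negP => yn.
have : 0 < sin y by apply: sin_gt0_pi; rewrite lt_def yn y0.
by rewrite sy ltxx.
Qed.

(** The universal covering of the nonzero complex numbers; with [R^o] its source is a normed module,
    as [map_hp] requires. *)
Definition expo (x : R^o * R^o) : C := rc (expR x.1) * eit x.2.

Lemma expo_continuous : continuous expo.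
Proof.
apply: Mc; last by apply: eit_continuous; exact: snd_c.
by apply: rc_continuous; apply: (comp_continuous (@fst_c R R)); exact: continuous_expR.
Qed.

Lemma expo_nz x : nonzero (expo x).
Proof. by rewrite /nonzero /= mulf_neq0 ?eit_neq0 // rc_neq0 gt_eqF // expR_gt0. Qed.

(** Near x the quotient g t / g x has positive real part a t and imaginary part b t, and atan (b /
    a) is a continuous argument; the local arguments are glued by [cousin]. *)
Lemma unit_lift (g : R -> C) : continuous g -> (forall t, Re (g t) ^+ 2 + Im (g t) ^+ 2 = 1) ->
  exists2 th : R -> R, continuous th & forall t, 0 <= t <= 1 -> g t = g 0 * eit (th t).
Proof.
move=> cg g1.
have cR : continuous (fun t => Re (g t)) by apply: (comp_continuous cg); exact: Re_continuous.
have cI : continuous (fun t => Im (g t)) by apply: (comp_continuous cg); exact: Im_continuous.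
apply: (cousin (Q := fun u v => exists2 th : R -> R, continuous th &
  forall t, u <= t <= v -> g t = g u * eit (th t))).
  move=> x x01.
  pose a t := Re (g t) * Re (g x) + Im (g t) * Im (g x).
  pose b t := Im (g t) * Re (g x) - Re (g t) * Im (g x).
  have ca : continuous a by apply: add_c; (apply: mul_c => //; exact: Kc).
  have cb : continuous b.
    by apply: add_c; [|apply: opp_c]; (apply: mul_c => //; exact: Kc).
  have ax : 0 < a x by rewrite /a -!expr2 g1.
  have [e e0 he] := near_gt ca ax; exists e => // u v u0 ux xv v1 xu vx.
  (* Clamping to the interval [u, v], where a is positive, makes the local argument continuous on
     the whole line. *)
  pose k t := Num.max u (Num.min t v).
  have ck : continuous k.
    rewrite -[k]/((cst u) \max (id \min cst v)); apply: max_fun_continuous; first exact: cst_continuous.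
    by apply: min_fun_continuous; [exact: id_continuous|exact: cst_continuous].
  have kuv t : u <= k t <= v.
    by rewrite /k le_max lexx ge_max ge_min lexx orbT (le_trans ux xv).
  have kid t : u <= t <= v -> k t = t.
    by move=> /andP[ut tv]; rewrite /k (min_idPl tv) (max_idPr ut).
  have apos t : 0 < a (k t).
    by apply: he; have /andP[? ?] := kuv t; rewrite ltr_norml; lra.
  have gE t : g t = g x * (a t +i* b t)%C.
    have := g1 x => h; apply: eq_complex2; rewrite !cE /= /a /b.
      by rewrite -[LHS]mulr1 -h; ring.
    by rewrite -[LHS]mulr1 -h; ring.
  have ab t : a t ^+ 2 + b t ^+ 2 = 1.
    rewrite -[1]mulr1 -{1}(g1 t) -{1}(g1 x) /a /b; ring.
  have lift t : g (k t) = g x * eit (atan (b (k t) / a (k t))).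
    by rewrite gE; congr (_ * _); apply: (@eit_atan (_ +i* _)%C) => //=.
  exists (fun t => atan (b (k t) / a (k t)) - atan (b (k u) / a (k u))).
    apply: add_c; last exact: Kc.
    move=> t; apply: continuous_comp; last exact: continuous_atan.
    apply: (@cvgM R); first by apply: (comp_continuous ck).
    by apply: (@cvgV R); [rewrite gt_eqF|exact: (comp_continuous ck)].
  move=> t tuv.
  have Lt : g t = g x * eit (atan (b (k t) / a (k t))) by rewrite -lift kid.
  have Lu : g u = g x * eit (atan (b (k u) / a (k u))).
    by rewrite -lift kid // lexx (le_trans ux xv).
  rewrite Lt Lu eitD eitN -mulrA; congr (_ * _).
  by rewrite mulrCA mulfV ?mulr1 // eit_neq0.
move=> u v w u0 uv vw w1 [th1 c1 h1] [th2 c2 h2].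
have v1 : eit (th2 v) = 1.
  have := h2 v; rewrite lexx vw => /(_ erefl) /esym h.
  have gv : g v != 0.
    by apply/eqP => g0; have := g1 v; rewrite g0 /= expr0n addr0 => /esym/eqP; rewrite oner_eq0.
  by apply: (mulfI gv); rewrite mulr1.
exists (fun t => if t <= v then th1 t else th1 v + (th2 t - th2 v)).
  apply: paste_real => //; last by rewrite subrr addr0.
  by apply: add_c; [exact: Kc|apply: add_c => //; exact: Kc].
move=> t /andP[ut tw]; case: leP => tv; first by apply: h1; rewrite ut.
rewrite h2 ?tw ?ltW // (h1 v) ?uv ?lexx // -mulrA -eitD; congr (_ * _).
by rewrite !eitD eitN v1 invr1 mulr1.
Qed.

Lemma nz_lift (f : R -> C) : is_path nonzero f -> f 0 = 1 ->
  exists l th : R -> R, [/\ continuous l, continuous th, l 0 = 0, th 0 = 0 &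
    forall t, 0 <= t <= 1 -> f t = expo (l t, th t)].
Proof.
move=> [cf fn] f0.
have cR : continuous (fun t => Re (f t)) by apply: (comp_continuous cf); exact: Re_continuous.
have cI : continuous (fun t => Im (f t)) by apply: (comp_continuous cf); exact: Im_continuous.
pose s t := Re (f t) ^+ 2 + Im (f t) ^+ 2.
have sp t : 0 < s t.
  rewrite lt_def addr_ge0 ?sqr_ge0 // andbT paddr_eq0 ?sqr_ge0 // !sqrf_eq0.
  by apply: contra (fn t) => /andP[/eqP a /eqP b]; apply/eqP; exact: eq_complex2.
have cs : continuous s by apply: add_c; exact: mul_c.
pose l t := ln (Num.sqrt (s t)).
have cl : continuous l.
  move=> t; apply: continuous_comp; last by apply: continuous_ln; rewrite sqrtr_gt0.
  by apply: continuous_comp; [exact: cs|exact: sqrt_continuous].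
have lK t : expR (l t) = Num.sqrt (s t) by rewrite /l lnK // posrE sqrtr_gt0.
pose g t := rc (expR (- l t)) * f t.
have cg : continuous g.
  apply: Mc; last exact: cf.
  apply: rc_continuous; apply: (comp_continuous (opp_c cl)); exact: continuous_expR.
have g1 t : Re (g t) ^+ 2 + Im (g t) ^+ 2 = 1.
  rewrite /g rcE /= !exprMn -mulrDr -/(s t) expRN lK exprVn sqr_sqrtr ?ltW //.
  by rewrite mulVf // gt_eqF.
have [th ct hth] := unit_lift cg g1.
have l0 : l 0 = 0 by rewrite /l /s f0 /= expr0n expr1n addr0 sqrtr1 ln1.
have g0 : g 0 = 1 by rewrite /g l0 oppr0 expR0 rc1 mul1r.
have e0 : eit (th 0) = 1 by have := hth 0; rewrite lexx ler01 g0 mul1r => /(_ erefl).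
exists l, (fun t => th t - th 0); split=> //; last 1 first.
- move=> t t01; have := hth t t01; rewrite g0 mul1r /expo /= eitD eitN e0 invr1 mulr1 => <-.
  by rewrite /g mulrA -rcM expRN mulfV ?rc1 ?mul1r // gt_eqF // expR_gt0.
- by apply: add_c => //; exact: Kc.
- by rewrite subrr.
Qed.

End Lift.

(** * The double cover (r, y) |-> (r y, r^2) *)

Section SquareMap.
Variable R : realType.
Local Notation C := (cplx R).
Local Notation Re := (@complex.Re R).
Local Notation Im := (@complex.Im R).
Local Notation rc := (@rc R).
Local Notation eit := (@eit R).
Local Notation Y := (@punct2 R).
Local Notation nz := (@nonzero R).
Implicit Types (z w : C) (t : R) (f g : R -> C).

(* Pairs (sum, product) of two distinct nonzero complex numbers. *)
Definition sum_prod : set (C * C) := [set x | x.2 != 0 /\ x.1 ^+ 2 != rc 4 * x.2].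
Local Notation A := sum_prod.

Definition sq (x : C * C) : C * C := (x.1 * x.2, x.1 ^+ 2).

Lemma rc4 : rc 4 = rc 2 * rc 2. Proof. by rewrite -rcM; congr rc; ring. Qed.

Lemma punct2E y : Y y <-> y ^+ 2 != rc 4.
Proof.
have -> : (y ^+ 2 != rc 4) = (y != rc 2) && (y != rc (- 2)).
  rewrite rc4 rcN -expr2 -subr_eq0 subr_sqr mulf_eq0 negb_or.
  by rewrite subr_eq0 addr_eq0.
by split=> [[-> ->]|/andP[]].
Qed.

(** With s = r y and p = r^2 the condition s^2 != 4 p reads y^2 != 4. *)
Lemma sum_prodE r y : nz r -> A (sq (r, y)) <-> Y y.
Proof.
move=> r0; rewrite punct2E /A /sq /=.
have r2 : r ^+ 2 != 0 by rewrite sqrf_eq0.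
rewrite exprMn [rc 4 * _]mulrC (inj_eq (mulfI r2)).
by split=> [[]|].
Qed.

Definition nzY : set (C * C) := [set x | nz x.1 /\ Y x.2].

Lemma sqr_c (X : topologicalType) (f : X -> C) : continuous f -> continuous (fun x => f x ^+ 2).
Proof. by move=> cf; exact: Mc. Qed.

Lemma sq_on : continuous_on nzY A sq.
Proof.
split=> [[r y] [/= r0 Yy]|X u cu _]; first exact/sum_prodE.
have c1 : continuous (fun x => (u x).1) by apply: (comp_continuous cu); exact: fst_c.
have c2 : continuous (fun x => (u x).2) by apply: (comp_continuous cu); exact: snd_c.
exact: (pair_continuous (Mc c1 c2) (sqr_c c1)).
Qed.

Lemma hp_pair (f f' g g' : R -> C) : hp nz f f' -> hp Y g g' ->
  hp nzY (fun t => (f t, g t)) (fun t => (f' t, g' t)).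
Proof.
move=> [F [cF AF F0 F1 Fs]] [G [cG AG G0 G1 Gs]].
exists (fun x => (F x, G x)); split=> [|x|t|t|s].
- exact: pair_continuous.
- by split; [exact: AF|exact: AG].
- by rewrite F0 G0.
- by rewrite F1 G1.
by rewrite (proj1 (Fs s)) (proj2 (Fs s)) (proj1 (Gs s)) (proj2 (Gs s)).
Qed.

Lemma sq_hp (f f' g g' : R -> C) : hp nz f f' -> hp Y g g' ->
  hp A (fun t => sq (f t, g t)) (fun t => sq (f' t, g' t)).
Proof. by move=> hf hg; have := hp_map sq_on (hp_pair hf hg). Qed.

Lemma sq_path f g : is_path nz f -> is_path Y g -> is_path A (fun t => sq (f t, g t)).
Proof. by move=> /hp_refl hf /hp_refl hg; have [] := hp_path (sq_hp hf hg). Qed.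

Lemma pcat_sq f f' g g' :
  (fun t => sq (pcat f f' t, pcat g g' t)) = pcat (fun t => sq (f t, g t)) (fun t => sq (f' t, g' t)).
Proof. by apply/funext => t; rewrite /pcat; case: ifP. Qed.

(** The two points with this sum and product are opposite to each other, and [rho pi] exchanges them
    by a half turn. *)
Definition rho (a : R) : R -> C * C := fun t => sq (eit (a * t), 0).
Definition iota (g : R -> C) : R -> C * C := fun t => (g t, 1).

Lemma iotaE g : iota g = fun t => sq (1, g t).
Proof. by apply/funext => t; rewrite /sq /= mul1r expr1n. Qed.

Lemma iotaN g : iota (fun t => - g t) = fun t => sq (-1, g t).
Proof. by apply/funext => t; rewrite /sq /= mulN1r sqrrN expr1n. Qed.

Lemma Y0 : Y 0. Proof. by rewrite punct2E expr0n eq_sym rc_neq0 pnatr_eq0. Qed.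
Lemma YN y : Y y -> Y (- y). Proof. by rewrite !punct2E sqrrN. Qed.
Lemma nz1 : nz 1. Proof. exact: oner_neq0. Qed.
Lemma nzN1 : nz (-1). Proof. by rewrite /nonzero /= oppr_eq0 oner_neq0. Qed.

Lemma iota_path g : is_path Y g -> is_path A (iota g).
Proof. by rewrite iotaE; apply: sq_path; apply: cst_path; exact: nz1. Qed.

Lemma iota_hp f g : hp Y f g -> hp A (iota f) (iota g).
Proof. by rewrite !iotaE; apply: sq_hp; apply/hp_refl/cst_path; exact: nz1. Qed.

Lemma scale_t (a : R) : continuous (fun t : R => a * t).
Proof. by apply: mul_c; [exact: Kc|exact: id_continuous]. Qed.

Lemma expo_path (l th : R -> R) : continuous l -> continuous th ->
  is_path nz (fun t => expo (l t, th t)).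
Proof.
move=> cl ct; split=> [|t]; last exact: expo_nz.
by apply: (comp_continuous (pair_continuous cl ct)); exact: expo_continuous.
Qed.

Lemma expo_hp (l th l' th' : R -> R) : continuous l -> continuous th -> continuous l' -> continuous th' ->
  l 0 = l' 0 -> th 0 = th' 0 -> l 1 = l' 1 -> th 1 = th' 1 ->
  hp nz (fun t => expo (l t, th t)) (fun t => expo (l' t, th' t)).
Proof.
move=> cl ct cl' ct' l0 t0 l1 t1.
apply: (map_hp (E := (R^o * R^o)%type) (K := @expo R) (p := fun t => (l t, th t)) (q := fun t => (l' t, th' t))).
- exact: expo_continuous.
- exact: expo_nz.
- exact: pair_continuous.
- exact: pair_continuous.
- by rewrite l0 t0.
- by rewrite l1 t1.
Qed.

Lemma expo0 x : expo (0 : R, x) = eit x. Proof. by rewrite /expo /= expR0 rc1 mul1r. Qed.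

Lemma eit_hp (th th' : R -> R) : continuous th -> continuous th' ->
  th 0 = th' 0 -> th 1 = th' 1 -> hp nz (fun t => eit (th t)) (fun t => eit (th' t)).
Proof.
move=> ct ct' t0 t1.
have := @expo_hp (fun=> 0) th (fun=> 0) th' (fun x => @Kc _ _ _ x) ct (fun x => @Kc _ _ _ x) ct' erefl t0 erefl t1.
by congr (hp _ _ _); apply/funext => t; rewrite expo0.
Qed.

Lemma eit_path (th : R -> R) : continuous th -> is_path nz (fun t => eit (th t)).
Proof. by move=> ct; have [] := hp_path (eit_hp ct ct erefl erefl). Qed.

Lemma rho_path a : is_path A (rho a).
Proof. by apply: sq_path; [apply: eit_path; exact: scale_t|apply: cst_path; exact: Y0]. Qed.

Lemma connected_sum_prod x : A x ->
  exists f : R -> C * C, [/\ is_path A f, f 0 = (0, 1) & f 1 = x].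
Proof.
case: x => s p [/= p0 sp].
pose r : C := sqrtc p.
have rp : r ^+ 2 = p by exact: sqr_sqrtc.
have r0 : r != 0 by apply: contra p0 => /eqP r0; rewrite -rp r0 expr0n.
have hx : sq (r, s / r) = (s, p) by rewrite /sq /= rp mulrC divfK.
have Yy : Y (s / r) by apply/(@sum_prodE r) => //; rewrite hx.
have [m [hm m0 m1]] : exists m : R -> C, [/\ is_path Y m, m 0 = 0 & m 1 = s / r].
  have seg (j : option bool) z : chart j z -> is_path Y (line (center R j) z).
    by move=> cz; apply: (path_sub (@chart_sub R j)); apply: line_path => //; exact: chart_star.
  have [j cj] : exists j : option bool, chart j (s / r).
    have [e e0 [j hj]] := chart_cover (x := 0) (fun x => @Kc R C (s / r) x) Yy.
    by exists j; apply: (hj 0); rewrite subrr normr0.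
  have ci (j' : option bool) : chart j' (@ii R) by left => /=; rewrite oner_neq0.
  have h1 := seg None _ (ci None); have h2 := seg j _ (ci j); have h3 := seg j _ cj.
  have h12 : is_path Y (pcat (line (center R None) (@ii R)) (prev (line (center R j) (@ii R)))).
    by apply: pcat_path => //; [exact: prev_path|rewrite prev0 !line1].
  exists (pcat (pcat (line (center R None) (@ii R)) (prev (line (center R j) (@ii R)))) (line (center R j) (s / r))).
  split; rewrite ?pcat0 ?pcat1 ?line0 ?line1 //.
  by apply: pcat_path => //; rewrite pcat1 prev1 !line0.
have [l [hl l0 l1]] : exists l : R -> C, [/\ is_path nz l, l 0 = 1 & l 1 = r].
  (* The principal root has nonnegative real part, and the closed right half plane without 0 is
     star-shaped around 1. *)
  pose U : set C := [set z | 0 < Re z \/ Re z = 0 /\ z != 0].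
  have sU : star U 1.
    move=> z t Uz /andP[t0 t1]; rewrite /U /= !cE /= mul0r subr0.
    have [tl|tl] := ltP t 1.
      left; have : 0 <= Re z by case: Uz => [/ltW //|[-> _]].
      by move=> hz; have := mulr_ge0 t0 hz; lra.
    have -> : t = 1 by apply/eqP; rewrite eq_le t1.
    by rewrite rc1 !mul1r addrC subrK [1 + _]addrC subrK.
  have Ur : U r.
    suff h : 0 <= Re r.
      by move: h; rewrite le_eqVlt => /orP[/eqP h|h]; [right|left].
    rewrite /r; case: (p) => a b /=.
    exact: sqrtr_ge0.
  have Un : U `<=` nz.
    move=> z [h|[_ //]]; rewrite /nonzero /=; apply: contraTN h => /eqP ->; by rewrite ltxx.
  exists (line 1 r); split; [|exact: line0|exact: line1].
  by apply: (path_sub Un); exact: line_path.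
exists (fun t => sq (l t, m t)); split; first exact: sq_path.
  by rewrite l0 m0 /sq /= mulr0 expr1n.
by rewrite l1 m1.
Qed.

Local Open Scope group_scope.
Variables (G : groupType) (c : (R -> C * C) -> G).
Hypothesis hc : path_hom A c.

Lemma iota_hom : path_hom Y (fun g => c (iota g)).
Proof.
split=> [f g hf hg fg|f g /iota_hp]; last exact: (proj2 hc).
rewrite -(proj1 hc); [|exact: iota_path|exact: iota_path|by rewrite /iota fg].
by congr c; apply/funext => t; rewrite /iota /pcat; case: ifP.
Qed.

Lemma rhoS (n : int) : c (rho ((n + 1)%:~R * pi)%R) = c (rho (n%:~R * pi)%R) * c (rho pi).
Proof.
rewrite -(proj1 hc); [|exact: rho_path|exact: rho_path|]; last first.
  by rewrite /rho mulr1 mulr0 eit0 /sq /= !mulr0 eit_int expr1n.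
apply: (proj2 hc).
have cq : continuous (fun t : R => if t <= 2^-1 then n%:~R * pi * (2 * t) else n%:~R * pi + pi * (2 * t - 1))%R.
  apply: paste_real.
  - by apply: mul_c; [exact: Kc|exact: scale_t].
  - by apply: add_c; [exact: Kc|apply: mul_c; [exact: Kc|exact: affine_fun_continuous]].
  - by rewrite half_eq subrr mulr0 addr0 mulr1.
have := sq_hp (eit_hp (@scale_t ((n + 1)%:~R * pi)%R) cq _ _) (hp_refl (cst_path R Y0)).
have -> : pcat (rho (n%:~R * pi)%R) (rho pi) =
    fun t : R => sq (eit (if (t <= 2^-1)%R then n%:~R * pi * (2 * t) else n%:~R * pi + pi * (2 * t - 1))%R, 0%R).
  apply/funext => t; rewrite /pcat /rho; case: ifP => // _.
  by rewrite /sq /= !mulr0 eitD exprMn eit_int mul1r.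
apply.
  by rewrite invr_ge0 ler0n !mulr0.
rewrite ifF; last by apply/negbTE; rewrite -ltNge invf_lt1 ?ltr1n ?ltr0n.
by rewrite intrD; ring.
Qed.

Lemma rho_int (S : set G) (n : int) : is_subgroup S -> S (c (rho pi)) -> S (c (rho (n%:~R * pi)%R)).
Proof.
move=> hS Sr.
have h (m : nat) : S (c (rho (m%:R * pi)%R)) /\ S (c (rho ((- (m%:Z))%:~R * pi)%R)).
  elim: m => [|m [IH1 IH2]].
    have -> : rho (0%:R * pi)%R = fun=> (0%R, 1%R).
      by apply/funext => t; rewrite /rho !mul0r eit0 /sq /= mulr0 expr1n.
    rewrite (path_hom_cst hc); first by split; exact: (sgr1 hS).
    by split => /=; rewrite ?oner_neq0 // expr0n mulr1 eq_sym rc_neq0 pnatr_eq0.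
  have e1 := rhoS m%:Z; have e2 := rhoS (- (m.+1%:Z)).
  split.
    have -> : (m.+1%:R : R) = (m%:Z + 1)%:~R by rewrite intrD -addn1 natrD.
    by rewrite e1; exact: (sgrM hS).
  have := sgrM hS IH2 (sgrV hS Sr).
  have -> : (- m%:Z = - m.+1%:Z + 1)%R by lia.
  by rewrite e2 mulgK.
by case: n => m; [have [] := h m|rewrite NegzE; have [] := h m.+1].
Qed.

(** Both sides are images of paths in the cover: r turns from 1 to -1 and y runs along g, in either
    order. At r = -1, running y along g traces [iota] of -g. *)
Lemma rho_conj g : is_path Y g -> g 0%R = 0%R -> g 1%R = 0%R ->
  c (rho pi) * c (iota (fun t => - g t)%R) = c (iota g) * c (rho pi).
Proof.
move=> hg g0 g1; have p1 := cst_path R (V := C) nz1; have pN := cst_path R (V := C) nzN1.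
have pr : is_path nz (fun t => eit (pi * t)%R) by apply: eit_path; exact: scale_t.
have py := cst_path R Y0.
have hgN : is_path Y (fun t => - g t)%R.
  by case: hg => cg Yg; split=> [|t]; [exact: Nc|exact: YN].
have j1 : rho pi 1%R = iota (fun t => - g t)%R 0%R.
  by rewrite /rho mulr1 eit_pi /iota g0 oppr0 /sq /= mulr0 sqrrN expr1n.
have j2 : iota g 1%R = rho pi 0%R.
  by rewrite /iota g1 /rho mulr0 eit0 /sq /= mulr0 expr1n.
rewrite -(proj1 hc _ _ (rho_path pi) (iota_path hgN) j1).
rewrite -(proj1 hc _ _ (iota_path hg) (rho_path pi) j2).
apply: (proj2 hc); rewrite iotaN (iotaE g) -!pcat_sq; apply: sq_hp.
  have e1 : pcat (fun t => eit (pi * t)%R) (fun=> (-1)%R) = fun t : R => eit (if (t <= 2^-1)%R then pi * (2 * t) else pi)%R.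
    by apply/funext => t; rewrite /pcat; case: ifP; rewrite ?eit_pi.
  have e2 : pcat (fun=> (1%R : C)) (fun t => eit (pi * t)%R) = fun t : R => eit (if (t <= 2^-1)%R then 0 else pi * (2 * t - 1))%R.
    by apply/funext => t; rewrite /pcat; case: ifP; rewrite ?eit0.
  rewrite e1 e2; apply: eit_hp.
  - apply: paste_real; [by apply: mul_c; [exact: Kc|exact: scale_t]|exact: Kc|].
    by rewrite half_eq mulr1.
  - apply: paste_real; [exact: Kc|by apply: mul_c; [exact: Kc|exact: affine_fun_continuous]|].
    by rewrite half_eq subrr mulr0.
  - by rewrite invr_ge0 ler0n !mulr0.
  - have -> : (1 <= 2^-1 :> R)%R = false by apply/negbTE; rewrite -ltNge invf_lt1 ?ltr1n ?ltr0n.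
    ring.
apply: (hp_trans (g := g)).
  by have := hp_cst_l hg; rewrite g0.
by apply: hp_sym; have := hp_cst_r hg; rewrite g1.
Qed.

(** The loop lifts to (r, y). Up to homotopy r is a rotation by a multiple n pi, so the loop is the
    n-th power of [rho pi] followed by a loop of y at r = 1 or r = -1, to which [punct2_generated]
    applies. *)
Lemma sum_prod_generated (S : set G) (f' : R -> C * C) : is_subgroup S -> S (c (rho pi)) ->
  (forall b, S (lasso (fun g => c (iota g)) b)) ->
  is_path A f' -> f' 0%R = (0%R, 1%R) -> f' 1%R = (0%R, 1%R) -> S (c f').
Proof.
move=> hS Sr Sl hf' f'0 f'1.
pose f t := f' (clamp t).
have hf : is_path A f.
  case: hf' => cf Af; split=> [|t]; last exact: Af.
  by apply: (comp_continuous _ cf); exact: clamp_continuous.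
have -> : c f' = c f.
  by apply: (proj2 hc); apply: hp_eq01 => // t t01; rewrite /f clamp_id.
have f0 : f 0%R = (0%R, 1%R) by rewrite /f clamp0.
have f1 : f 1%R = (0%R, 1%R) by rewrite /f clamp1.
have [cf' Af'] := hf'.
have hp2 : is_path nz (fun t => (f' t).2).
  by split=> [|t]; [apply: (comp_continuous cf'); exact: snd_c|case: (Af' t)].
have [l [th [cl ct l0 t0 lt]]] := nz_lift hp2 (congr1 snd f'0).
(* A continuous square root of the product p, obtained by halving its logarithm. *)
pose r t := expo (l (clamp t) / 2, th (clamp t) / 2)%R.
have cl' : continuous (fun t => l (clamp t) / 2)%R.
  by apply: mul_c; [apply: (comp_continuous _ cl); exact: clamp_continuous|exact: Kc].
have ct' : continuous (fun t => th (clamp t) / 2)%R.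
  by apply: mul_c; [apply: (comp_continuous _ ct); exact: clamp_continuous|exact: Kc].
have hr : is_path nz r by apply: (expo_path cl' ct').
have rsq t : (r t ^+ 2)%R = (f t).2.
  rewrite /f lt ?clamp01 // /r /expo /= exprMn !expr2 -!rcM -expRD -eitD.
  by rewrite -!splitr.
have r_n0 t : r t != 0%R by case: hr => _; apply.
pose y t := ((f t).1 / r t)%R.
have fE t : f t = sq (r t, y t).
  by rewrite /sq /= rsq /y mulrC divfK //; case: (f t).
have hy : is_path Y y.
  split=> [|t]; last first.
    by apply/(@sum_prodE (r t)); [exact: r_n0|rewrite -fE; case: hf].
  apply: Mc; first by apply: (comp_continuous (proj1 hf)); exact: fst_c.
  by apply: Vc => //; case: hr.
have y0 : y 0%R = 0%R by rewrite /y f0 mul0r.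
have y1 : y 1%R = 0%R by rewrite /y f1 mul0r.
pose a := (th 1 / 2)%R.
have h1 : expo (l 1%R, th 1%R) = 1%R :> C by rewrite -lt ?ler01 ?lexx // f'1.
have l1 : l 1%R = 0%R.
  have := h1; rewrite /expo /= => e.
  have : rc (expR (l 1%R) ^+ 2)%R = rc 1%R.
    have e1 := congr1 Re e; have e2 := congr1 Im e.
    move: e1 e2; rewrite rcE /= => e1 e2; congr rc.
    have := cos2Dsin2 (th 1%R) => h.
    have -> : (expR (l 1%R) ^+ 2 = (expR (l 1%R) * cos (th 1%R)) ^+ 2 + (expR (l 1%R) * sin (th 1%R)) ^+ 2)%R.
      by rewrite !exprMn -mulrDr h mulr1.
    by rewrite e1 e2 expr0n addr0 expr1n.
  move=> [] /eqP; rewrite sqrf_eq1 => /orP[/eqP|/eqP] h; last by have := expR_gt0 (l 1%R); rewrite h oppr_gt0 ltr10.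
  by apply: expR_inj; rewrite expR0.
have ea : (eit a ^+ 2 = 1)%R.
  by rewrite expr2 -eitD -splitr -[RHS]h1 l1 expo0.
have [n an] := eit_sqr1 ea.
have hr2 : hp nz r (pcat (fun t => eit (a * t)%R) (fun=> eit a)).
  have -> : pcat (fun t => eit (a * t)%R) (fun=> eit a) =
      fun t : R => expo (0%R, if (t <= 2^-1)%R then a * (2 * t) else a)%R.
    by apply/funext => t; rewrite expo0 /pcat; case: ifP.
  apply: (@expo_hp (fun t => l (clamp t) / 2)%R (fun t => th (clamp t) / 2)%R).
  - exact: cl'.
  - exact: ct'.
  - exact: Kc.
  - apply: paste_real; [by apply: mul_c; [exact: Kc|exact: scale_t]|exact: Kc|].
    by rewrite half_eq mulr1.
  - by rewrite clamp0 l0 mul0r.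
  - by rewrite clamp0 t0 mul0r invr_ge0 ler0n !mulr0.
  - by rewrite clamp1 l1 mul0r.
  - rewrite clamp1 -/a; have -> : (1 <= 2^-1 :> R)%R = false by apply/negbTE; rewrite -ltNge invf_lt1 ?ltr1n ?ltr0n.
    by [].
have hy2 : hp Y y (pcat (fun=> 0%R) y) by apply: hp_sym; have := hp_cst_l hy; rewrite y0.
have -> : c f = c (rho a) * c (fun t => sq (eit a, y t)).
  rewrite -(proj1 hc); last first.
  - by rewrite /rho mulr1 y0.
  - by apply: sq_path => //; apply: cst_path; exact: eit_neq0.
  - exact: rho_path.
  apply: (proj2 hc); rewrite -pcat_sq.
  have := sq_hp hr2 hy2; congr (hp _ _ _).
  by apply/funext => t; rewrite fE.
apply: (sgrM hS); first by rewrite an; exact: rho_int.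
have Sy (g : R -> C) : is_path Y g -> g 0%R = 0%R -> g 1%R = 0%R -> S (c (iota g)).
  exact: (punct2_generated iota_hom hS Sl).
move/eqP: ea; rewrite sqrf_eq1 => /orP[] /eqP ->.
  by rewrite -iotaE; exact: Sy.
rewrite -iotaN; apply: Sy; rewrite ?y0 ?y1 ?oppr0 //.
case: hy => cy Yy; split=> [|t]; [exact: Nc|exact: YN].
Qed.

End SquareMap.

(** * A cocycle on the space of sums and products *)

Section Cocycles.
Variables (R : realType) (H : groupType).
Local Notation C := (cplx R).
Local Notation Re := (@complex.Re R).
Local Notation Im := (@complex.Im R).
Local Notation rc := (@rc R).
Local Notation eit := (@eit R).
Local Notation Y := (@punct2 R).
Local Notation nz := (@nonzero R).
Implicit Types (z w y : C).

Local Open Scope group_scope.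

(* A path of nonzero complex numbers picks up g when it crosses the positive real
   axis downwards. *)
Definition side_value (g : H) z : H := if (0 <= Im z)%R then 1 else g.
Definition crossing (g : H) z w : H :=
  if (0 < Re z)%R && (0 < Re w)%R then (side_value g z)^-1 * side_value g w else 1.

Lemma crossing_side g z w : (Re z <= 0)%R \/ side_value g z = side_value g w -> crossing g z w = 1.
Proof.
rewrite /crossing => -[h|->]; first by rewrite ltNge h.
by rewrite mulVg; case: ifP.
Qed.

Lemma nbhs_lt (h : C -> R) (z : C) (a : R) : continuous h -> (a < h z)%R ->
  nbhs z [set w | (a < h w)%R].
Proof.
move=> ch az; apply: (ch z [set b | (a < b)%R]).
exact: (open_nbhs_nbhs (conj (@open_gt R a) az)).
Qed.

Lemma nbhs_pair (X Z : topologicalType) (x : X * Z) (P : set X) (Q : set Z) :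
  nbhs x.1 P -> nbhs x.2 Q -> nbhs x [set y | P y.1 /\ Q y.2].
Proof. by move=> hP hQ; exists (P, Q). Qed.

(** The crossing is trivial near a point off the positive real axis, and near a point of that axis
    it is the coboundary of [side_value]. *)
Lemma crossing_cocycle g : local_cocycle nz (crossing g).
Proof.
move=> z z0; have cR := @Re_continuous R; have cI := @Im_continuous R.
have side1 (W : set C) : nbhs z W -> (forall w w', W w -> W w' -> crossing g w w' = 1) ->
    exists2 W : set C, nbhs z W & good nz (crossing g) W.
  by move=> hW h1; exists W => // a b c _ _ _ Wa Wb Wc; rewrite !h1 // mulg1.
case: (ltgtP (Im z) 0%R) => Iz.
- apply: (side1 _ (nbhs_lt (opp_c cI) (_ : (0 < - Im z)%R))); first by rewrite oppr_gt0.
  move=> w w' /=; rewrite !oppr_gt0 => h h'; apply: crossing_side; right.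
  by rewrite /side_value !leNgt h h'.
- apply: (side1 _ (nbhs_lt cI Iz)) => w w' /= h h'; apply: crossing_side; right.
  by rewrite /side_value !ltW.
case: (ltgtP (Re z) 0%R) => Rz.
- apply: (side1 _ (nbhs_lt (opp_c cR) (_ : (0 < - Re z)%R))); first by rewrite oppr_gt0.
  by move=> w w' /=; rewrite !oppr_gt0 => h h'; apply: crossing_side; left; exact: ltW.
- exists [set w | (0 < Re w)%R]; first exact: nbhs_lt.
  by move=> a b c _ _ _ /= ha hb hc; rewrite /crossing ha hb hc /= -mulgA mulVKg.
by move: z0; rewrite /nonzero /= (_ : z = 0%R) ?eqxx //; exact: eq_complex2.
Qed.

Lemma cocycle_pullback (V V' : topologicalType) (A : set V) (A' : set V') (P : V -> V')
    (d : V' -> V' -> H) : continuous P -> (forall x, A x -> A' (P x)) -> local_cocycle A' d ->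
  local_cocycle A (fun x x' => d (P x) (P x')).
Proof.
move=> cP PA hd x /PA/hd[W hW gW]; exists (P @^-1` W); first exact: cP.
by move=> a b c /PA Pa /PA Pb /PA Pc; exact: gW.
Qed.

Variables a t : H.
Hypothesis aa : a * a = 1.

(* The second factor is the image of the first under the half turn y -> -y. *)
Definition cocycleY y y' : H :=
  crossing t (y - rc 2)%R (y' - rc 2)%R *
  (a * crossing t (- y - rc 2)%R (- y' - rc 2)%R * a).

Lemma cocycleY_right y y' : (- 2 < Re y)%R -> cocycleY y y' = crossing t (y - rc 2)%R (y' - rc 2)%R.
Proof.
move=> hy; rewrite /cocycleY (@crossing_side _ (- y - rc 2)%R); last by left; rewrite !cE /=; lra.
by rewrite mulg1 aa mulg1.
Qed.

Lemma cocycleY_left y y' : (Re y < 2)%R -> cocycleY y y' = a * crossing t (- y - rc 2)%R (- y' - rc 2)%R * a.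
Proof.
move=> hy; rewrite /cocycleY (@crossing_side _ (y - rc 2)%R); last by left; rewrite !cE /=; lra.
by rewrite mul1g.
Qed.

Lemma aJ (x y : H) : a * x * a * (a * y * a) = a * (x * y) * a.
Proof. by rewrite !mulgA -(mulgA (a * x) a a) aa mulg1. Qed.

(** One factor is trivial where Re y > -2 and the other where Re y < 2. The half turn y |-> -y
    exchanges them up to conjugation by a; this symmetry is what makes [cocycleA] a cocycle. *)
Lemma cocycleY_near y : Y y -> exists W : set C, [/\ nbhs y W, good Y cocycleY W &
  forall w w', W w -> W w' -> cocycleY (- w)%R (- w')%R = a * cocycleY w w' * a].
Proof.
move=> Yy; have cR := @Re_continuous R.
have c1 : continuous (fun w : C => w - rc 2)%R by apply: Dc; [exact: id_continuous|exact: Kc].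
have c2 : continuous (fun w : C => - w - rc 2)%R.
  by apply: Dc; [apply: Nc; exact: id_continuous|exact: Kc].
have [h|h] := ltP (- 2)%R (Re y).
  have Y1 w : Y w -> nz (w - rc 2)%R by move=> [h1 _]; rewrite /nonzero /= subr_eq0.
  have [W hW gW] := cocycle_pullback c1 Y1 (crossing_cocycle t) Yy.
  exists (W `&` [set w | (- 2 < Re w)%R]); split.
  - by apply: filterI => //; exact: nbhs_lt.
  - move=> u v w Yu Yv Yw [Wu hu] [Wv hv] [Ww hw]; rewrite !cocycleY_right //.
    exact: gW.
  move=> w w' [_ hw] [_ hw'] /=; rewrite cocycleY_left; last by rewrite !cE; move: hw => /=; lra.
  by rewrite cocycleY_right // !opprK.
have h' : (Re y < 2)%R by lra.
have Y2 w : Y w -> nz (- w - rc 2)%R.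
  by move=> [_ h2]; rewrite /nonzero /= subr_eq0 eqr_oppLR -rcN.
have [W hW gW] := cocycle_pullback c2 Y2 (crossing_cocycle t) Yy.
exists (W `&` [set w | (- 2 < - Re w)%R]); split.
- by apply: filterI => //; apply: nbhs_lt; [exact: opp_c|rewrite ltrN2].
- move=> u v w Yu Yv Yw [Wu hu] [Wv hv] [Ww hw].
  move: hu hv hw => /=; rewrite !ltrN2 => hu hv hw; rewrite !cocycleY_left //.
  by rewrite aJ gW.
move=> w w' [_ hw] [_ hw'] /=; move: hw hw' => /=; rewrite !ltrN2 => hw hw'.
rewrite cocycleY_right; last by rewrite !cE; lra.
by rewrite (cocycleY_left _ hw) !mulgA aa mul1g -mulgA aa mulg1.
Qed.

Lemma cocycleY_cocycle : local_cocycle Y cocycleY.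
Proof. by move=> y /cocycleY_near[W [hW gW _]]; exists W. Qed.

Definition inner z w : R := (Re z * Re w + Im z * Im w)%R.

(* The double cover (r, y) -> (r y, r^2) of sum_prod has deck transformation
   (r, y) -> (-r, -y); changing sheet multiplies by a. *)
Definition cocycleA (x x' : C * C) : H :=
  let r := sqrtc x.2 : C in let r' := sqrtc x'.2 : C in
  if (0 < inner r r')%R then cocycleY (x.1 / r)%R (x'.1 / r')%R
  else cocycleY (x.1 / r)%R (- (x'.1 / r'))%R * a.

Lemma innerNl z w : inner (- z)%R w = (- inner z w)%R.
Proof. by rewrite /inner !cE; ring. Qed.
Lemma innerNr z w : inner z (- w)%R = (- inner z w)%R.
Proof. by rewrite /inner !cE; ring. Qed.

Lemma inner_c (X : topologicalType) (f g : X -> C) : continuous f -> continuous g ->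
  continuous (fun x => inner (f x) (g x)).
Proof.
move=> cf cg; apply: add_c; apply: mul_c.
- by apply: (comp_continuous cf); exact: Re_continuous.
- by apply: (comp_continuous cg); exact: Re_continuous.
- by apply: (comp_continuous cf); exact: Im_continuous.
- by apply: (comp_continuous cg); exact: Im_continuous.
Qed.

(** The norm of r^2 - r0^2 is the product of the norms of r0 - r and r0 + r, so one of them is
    small: square roots are continuous up to sign. *)
Lemma sqr_close (r r0 : C) (e : R) : (0 <= e)%R -> `|r ^+ 2 - r0 ^+ 2|%R < rc (e ^+ 2) ->
  `|r0 - r|%R < rc e \/ `|r0 + r|%R < rc e.
Proof.
move=> e0 h; have [h1|h1] := pselect (`|r0 - r|%R < rc e)%R; first by left.
right; have nr z : (`|z| = rc (Num.sqrt (Re z ^+ 2 + Im z ^+ 2)))%R by exact: normE.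
move: h h1; rewrite subr_sqr normrM distrC [(r + r0)%R]addrC !nr -rcM !ltrc => h /negP.
rewrite -leNgt => h1.
rewrite ltNge; apply/negP => h2; move: h; rewrite ltNge => /negP; apply.
by rewrite expr2; apply: ler_pM.
Qed.

Lemma sum_prod_root (x : C * C) : sum_prod x ->
  nz (sqrtc x.2) /\ Y (x.1 / (sqrtc x.2 : C))%R.
Proof.
move=> Ax; have [p0 _] := Ax; have rp : ((sqrtc x.2 : C) ^+ 2 = x.2)%R by exact: sqr_sqrtc.
have r0 : nz (sqrtc x.2).
  by rewrite /nonzero /=; apply: contra p0 => /eqP r0; rewrite -rp r0 expr0n.
split=> //; apply/(@sum_prodE R (sqrtc x.2)) => //.
by rewrite /sq /= rp mulrC divfK // -surjective_pairing.
Qed.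

(** The principal root jumps across the negative axis. Relative to the branch that stays close to
    the root r0 at x0, [cocycleA] is [cocycleY] multiplied on each side by 1 or a, according to
    whether the principal root is that branch; these factors cancel since a^2 = 1. *)
Lemma cocycleA_cocycle : local_cocycle (@sum_prod R) cocycleA.
Proof.
move=> x0 Ax0; have [r00 Yy0] := sum_prod_root Ax0.
set r0 : C := sqrtc x0.2 in r00 Yy0 *; set y0 := (x0.1 / r0)%R in Yy0 *.
have [WY [nWY gWY symWY]] := cocycleY_near Yy0.
have [P1 nP1 hP1] : exists2 U : set C, nbhs r0 U & forall z w, U z -> U w -> (0 < inner z w)%R.
  have ci : continuous (fun u : C * C => inner u.1 u.2) by apply: inner_c; [exact: fst_c|exact: snd_c].
  have i0 : (0 < inner r0 r0)%R.
    rewrite /inner -!expr2 lt_def addr_ge0 ?sqr_ge0 // andbT paddr_eq0 ?sqr_ge0 // !sqrf_eq0.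
    by apply: contra r00 => /andP[/eqP h1 /eqP h2]; apply/eqP; exact: eq_complex2.
  have : nbhs (r0, r0) [set u : C * C | (0 < inner u.1 u.2)%R].
    apply: (ci (r0, r0) [set b | (0 < b)%R]).
    exact: (open_nbhs_nbhs (conj (@open_gt R 0%R) i0)).
  move=> [[U1 U2] /= [n1 n2] s12]; exists (U1 `&` U2); first exact: filterI.
  by move=> z w [Uz _] [_ Uw]; exact: (s12 (z, w)).
have [B1 nB1 [B2 nB2 hB]] : exists2 B1 : set C, nbhs x0.1 B1 & exists2 B2 : set C, nbhs r0 B2 &
    forall s r, B1 s -> B2 r -> WY (s / r)%R.
  have cd : (fun u : C * C => u.1 / u.2)%R @ (x0.1, r0) --> y0.
    by apply: cvgM; [exact: cvg_fst|apply: cvgV => //; exact: cvg_snd].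
  have := cd _ nWY; move=> [[U1 U2] /= [n1 n2] s12].
  by exists U1 => //; exists U2 => // s r Us Ur; exact: (s12 (s, r)).
have hn : nbhs r0 (P1 `&` B2) by exact: filterI.
have [e /= /rc_gt0[d d0 ->] hU] := (nbhs_ballP r0 (P1 `&` B2)).1 hn.
pose U := (P1 `&` B2).
exists [set x | B1 x.1 /\ ball x0.2 (rc (d ^+ 2)) x.2].
  apply: nbhs_pair; first exact: nB1.
  by apply: nbhsx_ballx; rewrite -[0%R]/(rc 0) ltrc exprn_gt0.
(* [q] tells whether the principal root is the branch near r0; [yt] is the value of y on that branch
   and [ep] the correcting factor. *)
pose q (x : C * C) := `[< U (sqrtc x.2) >].
pose yt (x : C * C) := if q x then (x.1 / (sqrtc x.2 : C))%R else (- (x.1 / (sqrtc x.2 : C)))%R.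
pose ep (x : C * C) := if q x then 1 else a.
have hq x : ball x0.2 (rc (d ^+ 2)) x.2 -> q x \/ (~~ q x /\ U (- (sqrtc x.2 : C))%R).
  have rp z : ((sqrtc z : C) ^+ 2 = z)%R by exact: sqr_sqrtc.
  rewrite /ball /= -{1}(rp x0.2) -{1}(rp x.2) -/r0 distrC => /(sqr_close (ltW d0))[h|h].
    by left; apply/asboolP; exact: hU.
  have [hx|hx] := boolP (q x); [by left|right; split=> //].
  by apply: hU; rewrite /ball /= opprK.
have key x x' : sum_prod x -> sum_prod x' -> B1 x.1 -> B1 x'.1 ->
    ball x0.2 (rc (d ^+ 2)) x.2 -> ball x0.2 (rc (d ^+ 2)) x'.2 ->
    [/\ Y (yt x), WY (yt x) & cocycleA x x' = ep x * cocycleY (yt x) (yt x') * ep x'].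
  move=> /sum_prod_root[_ Yx] _ Bx Bx' /hq hx /hq hx'.
  have Yt : Y (yt x) by rewrite /yt; case: ifP => // _; exact: YN.
  have WYt (z : C * C) : B1 z.1 -> q z \/ (~~ q z /\ U (- (sqrtc z.2 : C))%R) -> WY (yt z).
    move=> Bz [hz|[hz [_ Uz]]].
      by rewrite /yt hz; apply: hB => //; move/asboolP: hz => -[].
    by rewrite /yt (negbTE hz) -mulrN -invrN; exact: hB.
  have w1 := WYt x Bx hx; have w2 := WYt x' Bx' hx'; split=> //.
  move: w1 w2; rewrite /cocycleA /ep /yt.
  case: hx => [hx|[hx [Px _]]]; [move: (hx) => /asboolP[Px _]|];
  case: hx' => [hx'|[hx' [Px' _]]]; [move: (hx') => /asboolP[Px' _]| |move: (hx') => /asboolP[Px' _]|];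
    have := hP1 _ _ Px Px'; rewrite ?hx ?hx' ?(negbTE hx) ?(negbTE hx') ?innerNl ?innerNr ?opprK => i0 w1 w2.
  - by rewrite i0 mul1g mulg1.
  - by rewrite ifF ?mul1g //; apply/negbTE; rewrite -leNgt -oppr_ge0 ltW.
  - rewrite ifF; last by apply/negbTE; rewrite -leNgt -oppr_ge0 ltW.
    by rewrite -[X in cocycleY X]opprK symWY // -!mulgA aa mulg1.
  by rewrite i0; have := symWY _ _ w1 w2; rewrite !opprK.
move=> u v w Au Av Aw [Bu bu] [Bv bv] [Bw bw].
have [Yu Wu ->] := key u v Au Av Bu Bv bu bv.
have [Yv Wv ->] := key v w Av Aw Bv Bw bv bw.
have [_ _ ->] := key u w Au Aw Bu Bw bu bw.
have [Yw Ww _] := key w w Aw Aw Bw Bw bw bw.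
have ee : ep v * ep v = 1 by rewrite /ep; case: ifP; rewrite ?mulg1.
by rewrite -(gWY _ _ _ Yu Yv Yw Wu Wv Ww) -!mulgA (mulgA (ep v) (ep v)) ee mul1g.
Qed.

End Cocycles.

(** * Transport along the generating loops *)

Section Evaluation.
Variables (R : realType) (H : groupType).
Local Notation C := (cplx R).
Local Notation Re := (@complex.Re R).
Local Notation Im := (@complex.Im R).
Local Notation rc := (@rc R).
Local Notation eit := (@eit R).
Local Notation Y := (@punct2 R).
Implicit Types (z w y : C).
Local Open Scope group_scope.

Definition transports (V : topologicalType) (A : set V) (d : V -> V -> H) (c : (R -> V) -> H) : Prop :=
  forall f h, is_path A f -> develops d f h 0%R 1%R -> c f = (h 0%R)^-1 * h 1%R.

Lemma eit_sin (x : R) : Im (eit x) = sin x. Proof. by []. Qed.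

(** The product runs once counterclockwise around 0 and meets the positive axis from below at the
    end, which is an upward crossing. *)
Lemma winding_rho (g : H) (c : (R -> C * C) -> H) :
  transports (@sum_prod R) (fun x x' => crossing g x.2 x'.2) c -> c (rho pi) = g^-1.
Proof.
move=> hc; pose h (s : R) := if (s < 1)%R then 1 else g^-1.
have pE s : (rho pi s).2 = eit (2 * pi * s)%R.
  by rewrite /rho /sq /= expr2 -eitD; congr eit; ring.
rewrite (hc _ h) /h; [by rewrite ltxx ltr01 invg1 mul1g|exact: rho_path|].
move=> s /andP[s0 s1]; have pi0 : (0 < pi :> R)%R := pi_gt0 R.
have up (a : R) : (0 <= a <= 2^-1)%R -> side_value g (rho pi a).2 = 1.
  move=> /andP[a0 a1]; rewrite pE /side_value eit_sin ifT //; apply: sin_ge0_pi.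
  by apply/andP; split; nra.
have dn (a : R) : (2^-1 < a < 1)%R -> side_value g (rho pi a).2 = g.
  move=> /andP[a0 a1]; rewrite pE /side_value eit_sin ifF //; apply/negbTE; rewrite -ltNge.
  have -> : (2 * pi * a = (2 * pi * a - pi) + pi)%R by ring.
  by rewrite sinDpi oppr_lt0; apply: sin_gt0_pi; apply/andP; split; nra.
case: (ltgtP s 2^-1%R) => s2.
- exists (2^-1 - s)%R; first by rewrite subr_gt0.
  move=> a b /andP[a0 _] /andP[b0 _]; rewrite !ltr_norml => /andP[_ a2] /andP[_ b2].
  have ah : (a <= 2^-1)%R by lra.
  have bh : (b <= 2^-1)%R by lra.
  rewrite crossing_side; last by right; rewrite !up ?a0 ?b0.
  by rewrite !ifT ?mulg1 //; lra.
- have [s1'|s1'] := ltP s 1%R.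
    exists (Num.min (s - 2^-1) (1 - s))%R; first by rewrite lt_min !subr_gt0 s2.
    move=> a b _ _; rewrite !lt_min !ltr_norml => /andP[/andP[a1 _] /andP[_ a2]] /andP[/andP[b1 _] /andP[_ b2]].
    have ah : (2^-1 < a < 1)%R by apply/andP; split; lra.
    have bh : (2^-1 < b < 1)%R by apply/andP; split; lra.
    rewrite crossing_side; last by right; rewrite !dn.
    by case/andP: ah => _ ->; case/andP: bh => _ ->; rewrite mulg1.
  have -> : s = 1%R by lra.
  exists (4^-1)%R; first by rewrite invr_gt0 ltr0n.
  have pos (a : R) : (`|a - 1| < 4^-1)%R -> (0 < Re (rho pi a).2)%R.
    rewrite ltr_norml pE => /andP[a1 a2] /=.
    have -> : (2 * pi * a = (2 * pi * a - 2 * pi + pi) + pi)%R by ring.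
    rewrite cosDpi cosDpi opprK; apply: cos_gt0_pihalf.
    by apply/andP; split; nra.
  have sv (a : R) : (0 <= a <= 1)%R -> (`|a - 1| < 4^-1)%R ->
      side_value g (rho pi a).2 = if (a < 1)%R then g else 1.
    move=> /andP[a0 a1] ah; case: (ltgtP a 1%R) => a1'.
    - by apply: dn; rewrite a1' andbT; move: ah; rewrite ltr_norml => /andP[]; lra.
    - by move: a1; rewrite leNgt a1'.
    rewrite a1' pE mulr1 /side_value eit_sin.
    have -> : (2 * pi = pi + pi :> R)%R by ring.
    by rewrite sinDpi sinpi oppr0 lexx.
  move=> a b a01 b01 ha hb; rewrite /crossing !pos // !sv //=.
  by case: ifP => _; case: ifP => _; rewrite ?invg1 ?mulg1 ?mul1g ?mulVg ?mulg1.
exists (4^-1)%R; first by rewrite invr_gt0 ltr0n.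
have neg (a : R) : (`|a - s| < 4^-1)%R -> (Re (rho pi a).2 <= 0)%R /\ (a < 1)%R.
  rewrite s2 ltr_norml pE => /andP[a1 a2] /=; split; last by lra.
  have -> : (2 * pi * a = (2 * pi * a - pi) + pi)%R by ring.
  rewrite cosDpi oppr_le0; apply/ltW/cos_gt0_pihalf.
  by apply/andP; split; nra.
move=> a b _ _ /neg[ha ->] /neg[hb ->].
by rewrite crossing_side ?mulg1 //; left.
Qed.

Variables a t : H.
Hypothesis aa : a * a = 1.
Variables (cY : (R -> C) -> H) (cA : (R -> C * C) -> H).
Hypothesis hY : transports Y (@cocycleY R H a t) cY.
Hypothesis hA : transports (@sum_prod R) (@cocycleA R H a t) cA.

Lemma sqrtc1C : sqrtc (1%R : C) = 1%R :> C. Proof. exact: sqrtc1. Qed.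

Lemma transport_iota f : is_path Y f -> cA (iota f) = cY f.
Proof.
move=> hf; have [h hh] := develop_exists (cocycleY_cocycle t aa) hf.
rewrite (hY hf hh) (hA (h := h)) //; first exact: iota_path.
move=> s s01; have [e e0 he] := hh s s01; exists e => // u v u01 v01 us vs.
rewrite (he u v) //; congr (_ * _); rewrite /cocycleA -[(iota f u).2]/(1%R : C) -[(iota f v).2]/(1%R : C) sqrtc1C ifT ?divr1 //.
by rewrite /inner /= mulr0 addr0 mulr1 ltr01.
Qed.

Lemma cocycleY00 : cocycleY a t (0%R : C) 0%R = 1.
Proof. by rewrite (cocycle_diag (cocycleY_cocycle t aa)) //; exact: Y0. Qed.

(** The root that starts at 1 is continued to -1, while the principal root ends at 1; y stays at 0,
    so the change of sheet contributes a single factor a. *)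
Lemma transport_rho : cA (rho pi) = a.
Proof.
pose r s : C := sqrtc (rho pi s).2.
have rE s : (r s == eit (pi * s)%R) || (r s == - eit (pi * s)%R)%R.
  rewrite -eqf_sqr; apply/eqP; rewrite -[RHS]/((rho pi s).2); exact: sqr_sqrtc.
have r1 : r 0%R = 1%R /\ r 1%R = 1%R.
  have p0 : (rho pi 0%R).2 = 1%R :> C by rewrite /rho mulr0 eit0; exact: expr1n.
  have p1 : (rho pi 1%R).2 = 1%R :> C.
    by rewrite /rho mulr1 eit_pi; exact: (etrans (sqrrN 1%R) (expr1n _ 2)).
  by rewrite /r p0 p1 sqrtc1C.
pose h s := if r s == eit (pi * s)%R then 1 else a.
rewrite (hA (h := h)); [|exact: rho_path|].
  rewrite /h (proj1 r1) (proj2 r1) mulr0 mulr1 eit0 eqxx eit_pi ifF ?invg1 ?mul1g //.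
  apply/negbTE/eqP => /(congr1 Re) /=; lra.
move=> s s01; exists (4^-1)%R; first by rewrite invr_gt0 ltr0n.
move=> u v u01 v01; rewrite !ltr_norml => /andP[u1 u2] /andP[v1 v2].
have pi0 : (0 < pi :> R)%R := pi_gt0 R.
have i0 : (0 < inner (eit (pi * u)) (eit (pi * v)))%R.
  rewrite /inner /= -cosB -mulrBr; apply: cos_gt0_pihalf; apply/andP; split; nra.
rewrite /cocycleA -/(r u) -/(r v) /= !mulr0 !mul0r oppr0 cocycleY00 mul1g /h.
have sgn x : r x != eit (pi * x)%R -> r x = (- eit (pi * x)%R)%R.
  by have /orP[->|/eqP] := rE x.
have ni x : eit x != (- eit x)%R :> C.
  by rewrite -addr_eq0 -mulr2n mulrn_eq0 /= eit_neq0.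
have [->|/sgn ->] := eqVneq (r u) (eit (pi * u)%R); have [->|/sgn ->] := eqVneq (r v) (eit (pi * v)%R);
  rewrite ?innerNl ?innerNr ?opprK.
- by rewrite i0 mulg1.
- by rewrite ifF ?mul1g //; apply/negbTE; rewrite -leNgt -oppr_ge0 opprK ltW.
- by rewrite ifF ?aa //; apply/negbTE; rewrite -leNgt -oppr_ge0 opprK ltW.
by rewrite i0 mulg1.
Qed.

Lemma transport_axis f : is_path Y f -> (forall s, Re (f s) = 0%R) -> cY f = 1.
Proof.
move=> hf f0; rewrite (hY (h := fun=> 1) hf) ?invg1 ?mulg1 // => s _.
exists 1%R => // u v _ _ _ _.
rewrite cocycleY_right ?f0 ?oppr_lt0 ?ltr0n // crossing_side ?mulg1 //.
by left; rewrite !cE /= f0; lra.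
Qed.

(** To the right of -2 and inside the chart around 3, [side_value] along the path is itself a
    development. *)
Lemma transport_right f : is_path (chart (Some true)) f -> (forall s, (- 2 < Re (f s))%R) ->
  cY f = (side_value t (f 0%R - rc 2)%R)^-1 * side_value t (f 1%R - rc 2)%R.
Proof.
move=> hf f2; have [cf chf] := hf.
rewrite (hY (h := fun s => side_value t (f s - rc 2)%R) (path_sub (@chart_sub R _) hf)) // => s _.
have cR : continuous (fun t => Re (f t)) by apply: (comp_continuous cf); exact: Re_continuous.
have cI : continuous (fun t => Im (f t)) by apply: (comp_continuous cf); exact: Im_continuous.
have im u : Im (f u - rc 2)%R = Im (f u) by rewrite !cE /= oppr0 addr0.
have near (k : R -> R) : continuous k -> (0 < k s)%R ->
   (forall u v, (0 < k u)%R -> (0 < k v)%R -> side_value t (f v - rc 2)%R =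
     side_value t (f u - rc 2)%R * crossing t (f u - rc 2)%R (f v - rc 2)%R) ->
   exists2 e : R, (0 < e)%R & forall u v, (0 <= u <= 1)%R -> (0 <= v <= 1)%R ->
    (`|u - s| < e)%R -> (`|v - s| < e)%R -> side_value t (f v - rc 2)%R =
     side_value t (f u - rc 2)%R * cocycleY a t (f u) (f v).
  move=> ck ks hk; have [e e0 he] := near_gt ck ks; exists e => // u v _ _ /he us /he vs.
  by rewrite cocycleY_right //; exact: hk.
case: (ltgtP (Im (f s)) 0%R) => Is.
- apply: (near (fun u => - Im (f u))%R); [exact: opp_c|by rewrite oppr_gt0|].
  move=> u v; rewrite !oppr_gt0 => hu hv.
  have e : side_value t (f u - rc 2)%R = side_value t (f v - rc 2)%R.
    by rewrite /side_value !im !leNgt hu hv.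
  by rewrite crossing_side ?mulg1 //; right.
- apply: (near (fun u => Im (f u))%R) => // u v hu hv.
  have e : side_value t (f u - rc 2)%R = side_value t (f v - rc 2)%R.
    by rewrite /side_value !im !ltW.
  by rewrite crossing_side ?mulg1 //; right.
apply: (near (fun u => Re (f u) - 2)%R).
- by apply: add_c => //; exact: Kc.
- by have := chf s; rewrite /chart /= Is eqxx /side mul1r => -[//|]; rewrite subr_gt0.
move=> u v hu hv; rewrite /crossing !cE /= hu hv /=.
by rewrite mulVKg.
Qed.

(** The segments on the imaginary axis contribute 1, and of the two segments that start at 3 only
    the one towards -i ends below the real axis. *)
Lemma transport_lasso : lasso cY true = t.
Proof.
have s1 : side R true = 1%R by [].
have ax z : Im z != 0%R -> Re z = 0%R -> cY (line 0%R z) = 1.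
  move=> Iz Rz; apply: transport_axis => [|s].
    apply: (path_sub (@chart_sub R None)).
    by apply: (@line_path R _ (center R None)); [exact: chart_star|left].
  by rewrite /line !cE /= Rz; ring.
have rt z : Im z != 0%R -> Re z = 0%R ->
    cY (line (center R (Some true)) z) = side_value t (z - rc 2)%R.
  move=> Iz Rz; rewrite transport_right.
  - rewrite line0 line1 /side_value !cE /= ifT ?invg1 ?mul1g //; by rewrite oppr0 addr0.
  - by apply: line_path; [exact: chart_star|left].
  move=> s; rewrite /line !cE /= Rz ?s1; have /andP[? ?] := clamp01 s; lra.
have i1 : Im (rc (side R true) * ii R)%R = 1%R by rewrite !cE /= ?s1; ring.
have r1 : Re (rc (side R true) * ii R)%R = 0%R by rewrite !cE /= ?s1; ring.
have i2 : Im (- (rc (side R true) * ii R))%R = (- 1)%R by rewrite ImN i1.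
have r2 : Re (- (rc (side R true) * ii R))%R = 0%R by rewrite ReN r1 oppr0.
rewrite /lasso !ax ?rt ?i1 ?i2 ?r1 ?r2 ?oppr_eq0 ?oner_neq0 //.
rewrite /side_value !ImD i1 i2 /= oppr0 !addr0 ler01 oppr_ge0 ler10.
by rewrite !invg1 !mul1g mulg1.
Qed.

End Evaluation.

(** * The fundamental group of the space of sums and products *)

Section ModelGroup.
Variable R : realType.
Local Notation C := (cplx R).
Local Notation rc := (@rc R).
Local Notation Y := (@punct2 R).
Local Open Scope group_scope.

(** Represent b by a loop at x and apply c; the choice is immaterial because W separates homotopy
    classes. *)
Lemma pi1_model_hom (V : topologicalType) (A : set V) (B H : groupType)
    (W : (R -> V) -> B) (c : (R -> V) -> H) (x : V) :
  pi1_model A W -> path_hom A c -> A x ->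
  exists f : {multiplicative B -> H},
    forall g, is_path A g -> g 0%R = x -> g 1%R = x -> f (W g) = c g.
Proof.
move=> [hW Winj Wsurj] hc Ax.
have [l hl] := choice (fun b => Wsurj x b Ax).
have lW g : is_path A g -> g 0%R = x -> g 1%R = x -> c (l (W g)) = c g.
  move=> hg g0 g1; have [hlg l0 l1 lb] := hl (W g); apply: (proj2 hc).
  by apply: Winj => //; rewrite ?g0 ?g1.
have lM : {morph (fun b => c (l b)) : b b' / b * b'}.
  move=> b b'; have [h0 a0 a1 a2] := hl b; have [h1 b0 b1 b2] := hl b'.
  have e : l b 1%R = l b' 0%R by rewrite a1 b0.
  rewrite -(proj1 hc _ _ h0 h1 e) -(lW _ (pcat_path h0 h1 e)) ?pcat0 ?pcat1 //.
  by rewrite (proj1 hW _ _ h0 h1 e) a2 b2.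
pose F : {multiplicative B -> H} := HB.pack (fun b => c (l b)) (isMultiplicative.Build _ _ _ lM).
by exists F.
Qed.

Definition lasso_path (b : bool) : R -> C :=
  pcat (pcat (pcat (line 0%R (rc (side R b) * ii R)%R)
                   (prev (line (center R (Some b)) (rc (side R b) * ii R)%R)))
             (line (center R (Some b)) (- (rc (side R b) * ii R))%R))
       (prev (line 0%R (- (rc (side R b) * ii R))%R)).

Lemma lasso_pathN : (fun s => - lasso_path true s)%R = lasso_path false.
Proof.
have e1 : (- (rc (side R true) * ii R) = rc (side R false) * ii R)%R by rewrite /side rcN mulNr.
have e2 : (- center R (Some true) = center R (Some false))%R by rewrite /center /side -rcN mulrN.
apply/funext => s; rewrite /lasso_path /pcat /prev.
do 3 (case: ifP => _; last by rewrite lineN ?oppr0 ?e2 ?e1 ?opprK // -e1 opprK).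
by rewrite lineN oppr0 e1.
Qed.

Lemma seg_path (j : option bool) (z : C) : (complex.Im z != 0)%R -> is_path Y (line (center R j) z).
Proof.
by move=> Iz; apply: (path_sub (@chart_sub R j)); apply: line_path; [exact: chart_star|left].
Qed.

Lemma lasso_pathE b : [/\ is_path Y (lasso_path b), lasso_path b 0%R = 0%R, lasso_path b 1%R = 0%R &
  forall (G : groupType) (c : (R -> C) -> G), path_hom Y c -> c (lasso_path b) = lasso c b].
Proof.
have i1 : complex.Im (rc (side R b) * ii R)%R != 0%R.
  by case: b; rewrite !cE /= mul0r addr0 mulr1 ?oppr_eq0 oner_neq0.
have i2 : complex.Im (- (rc (side R b) * ii R))%R != 0%R by rewrite ImN oppr_eq0.
have h1 : is_path Y (line 0%R (rc (side R b) * ii R)%R) := seg_path None i1.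
have h2 := seg_path (Some b) i1; have h3 := seg_path (Some b) i2.
have h4 : is_path Y (line 0%R (- (rc (side R b) * ii R))%R) := seg_path None i2.
have k2 := prev_path h2; have k4 := prev_path h4.
have j1 : line 0%R (rc (side R b) * ii R)%R 1%R = prev (line (center R (Some b)) (rc (side R b) * ii R)%R) 0%R.
  by rewrite prev0 !line1.
have k12 := pcat_path h1 k2 j1.
have j2 : pcat (line 0%R (rc (side R b) * ii R)%R) (prev (line (center R (Some b)) (rc (side R b) * ii R)%R)) 1%R
   = line (center R (Some b)) (- (rc (side R b) * ii R))%R 0%R.
  by rewrite pcat1 prev1 !line0.
have k123 := pcat_path k12 h3 j2.
have j3 : pcat (pcat (line 0%R (rc (side R b) * ii R)%R) (prev (line (center R (Some b)) (rc (side R b) * ii R)%R)))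
   (line (center R (Some b)) (- (rc (side R b) * ii R))%R) 1%R = prev (line 0%R (- (rc (side R b) * ii R))%R) 0%R.
  by rewrite pcat1 prev0 !line1.
split.
- exact: pcat_path.
- by rewrite /lasso_path !pcat0 line0.
- by rewrite /lasso_path pcat1 prev1 line0.
move=> G c hc.
by rewrite (proj1 hc _ _ k123 k4 j3) (proj1 hc _ _ k12 h3 j2) (proj1 hc _ _ h1 k2 j1) (path_hom_prev hc h2) (path_hom_prev hc h4).
Qed.

Lemma gpowz_Z (m : Z_group) (k : int) : gpowz m k = (m * k)%R :> int.
Proof.
elim/int_rect: k => [|n IH|n IH]; first by rewrite mulr0.
  by rewrite -addn1 PoszD gpowz_succ mulrDr mulr1 -IH.
have := gpowz_succ m (- n.+1%:Z)%R.
have -> : (- n.+1%:Z + 1 = - n%:Z)%R by lia.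
move=> e; have : (gpowz m (- n%:Z)%R : int) = (gpowz m (- n.+1%:Z)%R + m)%R by [].
by rewrite IH => e'; apply: (addIr (m : int)); rewrite -e' -addn1 PoszD; ring.
Qed.

Lemma Gamma2_abelian (G : groupType) (x : G) : (forall a b : G, a * b = b * a) -> Gamma G 2 x -> x = 1.
Proof.
move=> ab hx; apply: (generated_sub (B := [set 1]) _ _ hx).
  by split=> // u v -> ->; rewrite invg1 mulg1.
move=> _ [u [v [_ ->]]] /=; rewrite /commg /conjg (ab u v) mulKg mulVg //.
Qed.

(** f is transport of [cocycleA] with values in Z2 * Z. Its kernel consists of powers of the central
    element r^2, and the winding number of the product shows that no nontrivial one lies in
    Gamma_2. *)
Lemma sum_prod_group (B : groupType) (W : (R -> C * C) -> B) : pi1_model (@sum_prod R) W ->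
  exists f : {multiplicative B -> Z2_star_Z},
    (forall y, exists x, f x = y) /\ (forall x, Gamma B 2 x -> f x = 1 -> x = 1).
Proof.
move=> mW; have [hW Winj Wsurj] := mW.
have Ax : sum_prod (0%R : C, 1%R : C).
  by split => /=; rewrite ?oner_neq0 // expr0n mulr1 eq_sym rc_neq0 pnatr_eq0.
pose base := (0%R : C, 1%R : C).
(* The inverse generator makes the winding number of [rho pi] equal to 1, by [winding_rho]. *)
pose dw (x x' : C * C) : Z_group := crossing ((1%R : int) : Z_group)^-1 x.2 x'.2.
have cw : local_cocycle (@sum_prod R) dw.
  apply: (cocycle_pullback (P := snd) _ _ (crossing_cocycle _)); first exact: snd_c.
  by move=> x [].
have [ca hca] := transport_exists R (cocycleA_cocycle (R := R) zt za2).
have [cy hcy] := transport_exists R (cocycleY_cocycle (R := R) zt za2).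
have [cz hcz] := transport_exists R cw.
have pca := transport_hom (cocycleA_cocycle (R := R) zt za2) hca.
have pcy := transport_hom (cocycleY_cocycle (R := R) zt za2) hcy.
have pcz := transport_hom cw hcz.
have [f hf] := pi1_model_hom mW pca Ax.
have [w hw] := pi1_model_hom mW pcz Ax.
have rho01 : rho (pi : R) 0%R = base /\ rho (pi : R) 1%R = base.
  rewrite /rho mulr0 mulr1 eit0 eit_pi /sq /= !mulr0.
  by rewrite [(1 ^+ 2)%R]expr1n [((-1) ^+ 2)%R](etrans (sqrrN 1%R) (expr1n _ 2)).
pose r := W (rho pi).
have fr : f r = za.
  by rewrite /r hf; [exact: (transport_rho za2 hca)|exact: rho_path|case: rho01|case: rho01].
have wr : w r = ((1%R : int) : Z_group).
  rewrite /r hw; [|exact: rho_path|by case: rho01|by case: rho01].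
  by rewrite (winding_rho hcz) invgK.
have hi := iota_hom hW.
pose u b := lasso (fun g => W (iota g)) b.
have uE b : u b = W (iota (lasso_path b)) by have [_ _ _ e] := lasso_pathE b; rewrite /u -(e _ _ hi).
have fu : f (u true) = zt.
  have [h1 h2 h3 h4] := lasso_pathE true.
  rewrite uE hf; [|exact: iota_path|by rewrite /iota h2|by rewrite /iota h3].
  rewrite (transport_iota za2 hcy hca h1) h4 //.
  exact: (transport_lasso za2 hcy).
have conj1 : r * u false = u true * r.
  by have [h1 h2 h3 _] := lasso_pathE true; rewrite !uE -(rho_conj hW h1 h2 h3) lasso_pathN.
have conj2 : r * u true = u false * r.
  have [h1 h2 h3 _] := lasso_pathE false; rewrite !uE -(rho_conj hW h1 h2 h3).
  by congr (_ * W (iota _)); apply/funext => s; rewrite -lasso_pathN opprK.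
have gen (S : set B) : is_subgroup S -> S r -> S (u true) -> forall b, S b.
  move=> hS Sr Su b; have [g [hg g0 g1 <-]] := Wsurj base b Ax.
  apply: (sum_prod_generated hW hS Sr) => // -[] //.
  have -> : lasso (fun g => W (iota g)) false = r^-1 * (u true * r) by rewrite -conj1 mulKg.
  by apply: (sgrM hS (sgrV hS Sr)); exact: (sgrM hS).
(* Conjugation by r exchanges the two lassos in both directions, so r^2 commutes with the generators
   r and [u true]. *)
have central b : b * (r * r) = (r * r) * b.
  apply: (gen [set b | b * (r * r) = (r * r) * b]).
  - split=> [|x y /= hx hy]; first by rewrite /= mulg1 mul1g.
    have hy' : y^-1 * (r * r) = r * r * y^-1.
      by apply: (mulgI y); rewrite mulVKg mulgA hy mulgK.
    by rewrite -mulgA hy' mulgA hx mulgA.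
  - by rewrite /= mulgA.
  by rewrite /= mulgA -conj1 -mulgA -conj2 mulgA.
pose N := [set x | exists k, x = gpowz (r * r) k].
have hN : is_subgroup N.
  split; first by exists 0%R.
  move=> _ _ [k ->] [k' ->]; exists (k - k')%R; rewrite gpowzD; congr (_ * _).
  by apply: (mulIg (gpowz (r * r) k')); rewrite mulVg -gpowzD addNr.
have nN (x g : B) : N x -> N (x ^ g).
  move=> [k ->]; exists k; rewrite /conjg.
  have : g * gpowz (r * r) k = gpowz (r * r) k * g.
    elim/int_rect: k => [|n IH|n IH]; first by rewrite /= mulg1 mul1g.
      by rewrite -addn1 PoszD gpowz_succ mulgA IH -mulgA (central g) mulgA.
    have e : gpowz (r * r) (- n%:Z)%R = gpowz (r * r) (- n.+1%:Z)%R * (r * r).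
      by rewrite -gpowz_succ; congr gpowz; lia.
    apply: (mulIg (r * r)).
    by rewrite -mulgA -e IH e -[LHS]mulgA -(central g) mulgA.
  by move=> <-; rewrite mulKg.
pose NN : normal_subgroup B := @NormalSubgroup B (Subgroup hN) nN.
pose Q : groupType := quotient_group NN.
pose p (b : B) : Q := \pi_(quotient_group NN) b.
have pM : {morph p : x y / x * y} by move=> x y; rewrite /p -quot_mulE.
pose pp : {multiplicative B -> Q} := HB.pack p (isMultiplicative.Build _ _ _ pM).
have rr : pp r * pp r = 1.
  rewrite -gmulfM; apply/quot_eqP; exists (- 1)%R; by rewrite mulg1.
pose s := zmap (pp (u true)) rr.
(* Checked on generators. Hence an element of the kernel of f is trivial modulo r^2, that is, a
   power of r^2. *)
have sf b : s (f b) = pp b.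
  apply: (gen [set b | s (f b) = pp b]).
  - split=> [|x y hx hy]; first by rewrite -[_ 1]/(s (f 1) = pp 1) !gm1.
    have hx' : s (f x) = pp x := hx; have hy' : s (f y) = pp y := hy.
    by rewrite -[_ (x * y^-1)]/(s (f (x * y^-1)) = pp (x * y^-1)) !gmulfM !gmV hx' hy'.
  - by rewrite -[_ r]/(s (f r) = pp r) fr /s zmap_a.
  by rewrite -[_ (u true)]/(s (f (u true)) = pp (u true)) fu /s zmap_t.
exists f; split.
  apply: Z2_star_Z_gen; [|by exists r|by exists (u true)].
  split=> [|_ _ [x <-] [y <-]]; first by exists 1; rewrite gm1.
  by exists (x * y^-1); rewrite gmulfM gmV.
move=> x hx fx.
have : pp 1 = pp x by rewrite -(sf x) fx !gm1.
move=> /quot_eqP; rewrite invg1 mul1g => -[k xk].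
(* The target of w is abelian, so w kills Gamma_2; on (r^2)^k it takes the value 2 k, whence k =
   0. *)
have : w x = 1.
  by apply: Gamma2_abelian (Gam_map w hx) => m n; exact: (addrC (m : int) n).
rewrite xk gmZ gmulfM wr => wk.
have : (gpowz (((1%R : int) : Z_group) * ((1%R : int) : Z_group)) k : int) = 0%R by rewrite wk.
rewrite gpowz_Z => /eqP; rewrite mulf_eq0 => /orP[//|/eqP ->].
by [].
Qed.

End ModelGroup.

(** * Stereographic projection from an arbitrary point of the sphere *)

Section Stereographic.
Variable R : realType.
Local Notation C := (cplx R).
Local Notation Re := (@complex.Re R).
Local Notation Im := (@complex.Im R).
Local Notation rc := (@rc R).
Implicit Types (u v : 'rV[R]_3) (z : C).

Definition dot u v : R := \sum_(j < 3) u 0 j * v 0 j.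

Lemma dotE u v : u *m v^T = (dot u v)%:M.
Proof. by rewrite [LHS]mx11_scalar mxE; congr (_%:M); apply: eq_bigr => j _; rewrite mxE. Qed.

Lemma dotC u v : dot u v = dot v u.
Proof. by apply: eq_bigr => j _; rewrite mulrC. Qed.
Lemma dotDl u v w : dot (u + v) w = dot u w + dot v w.
Proof. by rewrite -big_split; apply: eq_bigr => j _; rewrite mxE mulrDl. Qed.
Lemma dotNl u w : dot (- u) w = - dot u w.
Proof. by rewrite -sumrN; apply: eq_bigr => j _; rewrite mxE mulNr. Qed.
Lemma dot_sphere u : sphere u <-> dot u u = 1.
Proof.
rewrite /sphere /= /dot (eq_bigr (fun j => u 0 j * u 0 j)) // => j _.
Qed.

Lemma dot_eq0 u : dot u u = 0 -> u = 0.
Proof.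
move=> h; apply/rowP => j; rewrite mxE; apply/eqP; rewrite -sqrf_eq0 expr2; apply/eqP.
have := psumr_eq0P (P := predT) (F := fun j => u 0 j * u 0 j) _ h.
by apply => // k _; rewrite -expr2 sqr_ge0.
Qed.

(* The reflection in the hyperplane orthogonal to x - e carries x to e. *)
Lemma reflection_exists x e : dot x x = 1 -> dot e e = 1 ->
  exists Q : 'M[R]_3, [/\ Q *m Q = 1%:M, Q^T = Q & x *m Q = e].
Proof.
move=> xx ee; have [->|xe] := eqVneq x e.
  by exists 1%:M; rewrite mul1mx trmx1 mulmx1.
pose u := x - e; pose n := dot u u.
have n0 : n != 0.
  by apply: contra xe => /eqP/dot_eq0/eqP; rewrite subr_eq0.
have uE : u *m u^T = n%:M := dotE u u.
have xu : x *m u^T = (n / 2)%:M.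
  rewrite dotE; congr (_%:M); rewrite /n /u dotC !dotDl !dotNl ![dot _ (x - e)]dotC.
  by rewrite !dotDl !dotNl xx ee [dot e x]dotC; field.
exists (1%:M - (2 / n) *: (u^T *m u)); split.
- have PP : (u^T *m u) *m (u^T *m u) = n *: (u^T *m u).
    by rewrite -mulmxA (mulmxA u) uE mul_scalar_mx scalemxAr.
  move: PP; move: (u^T *m u) => P PP.
  rewrite mulmxBl !mulmxBr !mul1mx mulmx1 -scalemxAl -scalemxAr PP !scalerA.
  have -> : 2 / n * (2 / n) * n = 2 / n + 2 / n :> R by field.
  by rewrite scalerDl opprB addrK subrK.
- by rewrite linearB /= linearZ /= trmx_mul trmxK trmx1.
rewrite mulmxBr mulmx1 -scalemxAr mulmxA xu mul_scalar_mx scalerA.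
have -> : 2 / n * (n / 2) = 1 :> R by field.
by rewrite scale1r /u opprB addrC subrK.
Qed.

Variable x1 : 'rV[R]_3.
Variable Q : 'M[R]_3.
Let e3 : 'rV[R]_3 := \row_(j < 3) (j == 2 :> nat)%:R.
Hypothesis QQ : Q *m Q = 1%:M.
Hypothesis QT : Q^T = Q.
Hypothesis xQ : x1 *m Q = e3.

Definition i0 : 'I_3 := @Ordinal 3 0 isT.
Definition i1 : 'I_3 := @Ordinal 3 1 isT.
Definition i2 : 'I_3 := @Ordinal 3 2 isT.

Lemma sum3 (F : 'I_3 -> R) : \sum_(j < 3) F j = F i0 + F i1 + F i2.
Proof.
rewrite !big_ord_recl big_ord0 addr0 addrA; congr (F _ + F _ + F _); exact: val_inj.
Qed.

Lemma rowP3 u v : u 0 i0 = v 0 i0 -> u 0 i1 = v 0 i1 -> u 0 i2 = v 0 i2 -> u = v.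
Proof.
move=> h0 h1 h2; apply/rowP => -[[|[|[|//]]] h].
- by move: h0; congr (u 0 _ = v 0 _); exact: val_inj.
- by move: h1; congr (u 0 _ = v 0 _); exact: val_inj.
by move: h2; congr (u 0 _ = v 0 _); exact: val_inj.
Qed.

Lemma dotQ u v : dot (u *m Q) (v *m Q) = dot u v.
Proof.
have : (u *m Q) *m (v *m Q)^T = u *m v^T by rewrite trmx_mul QT mulmxA -(mulmxA u) QQ mulmx1.
by rewrite !dotE => /matrixP/(_ 0 0); rewrite !mxE eqxx.
Qed.

(** Projection from the north pole after the reflection Q, which carries x1 to that pole. *)
Definition stereo v : C :=
  let w := v *m Q in ((w 0 i0 / (1 - w 0 i2)) +i* (w 0 i1 / (1 - w 0 i2)))%C.

Definition unstereo z : 'rV[R]_3 :=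
  let n := Re z ^+ 2 + Im z ^+ 2 in
  (\row_(j < 3) ([:: 2 * Re z; 2 * Im z; n - 1]`_j / (n + 1))) *m Q.

Lemma norm_pos z : 0 < Re z ^+ 2 + Im z ^+ 2 + 1.
Proof. by rewrite ltr_wpDl // addr_ge0 // sqr_ge0. Qed.

Lemma unstereoK z : stereo (unstereo z) = z.
Proof.
rewrite /stereo /unstereo -mulmxA QQ mulmx1 !mxE /=.
have h := norm_pos z; apply: eq_complex2 => /=; field; apply/andP; split; rewrite gt_eqF //; lra.
Qed.

Lemma unstereo_sphere z : sphere (unstereo z).
Proof.
apply/dot_sphere; rewrite dotQ /dot sum3 !mxE /=; have h := norm_pos z; field.
by rewrite gt_eqF.
Qed.

Lemma unstereo_neq z : unstereo z <> x1.
Proof.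
move=> /(congr1 (mulmx^~ Q)); rewrite xQ /unstereo -mulmxA QQ mulmx1 => /rowP/(_ i2).
rewrite !mxE /= => h; have p := norm_pos z.
have := congr1 ( *%R^~ (Re z ^+ 2 + Im z ^+ 2 + 1)) h; rewrite divfK ?gt_eqF // mul1r; lra.
Qed.

Lemma height_neq1 v : sphere v -> v <> x1 -> (v *m Q) 0 i2 != 1.
Proof.
move=> /dot_sphere vv vx; apply/eqP => h; apply: vx.
have : dot (v *m Q) (v *m Q) = 1 by rewrite dotQ.
rewrite /dot sum3 h mulr1 => /(canRL (addrK _)); rewrite subrr -!expr2 => /eqP.
rewrite paddr_eq0 ?sqr_ge0 // !sqrf_eq0 => /andP[/eqP a /eqP b].
have : v *m Q = e3 by apply: rowP3; rewrite ?a ?b ?h mxE.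
by rewrite -xQ => /(congr1 (mulmx^~ Q)); rewrite -!mulmxA QQ !mulmx1.
Qed.

Lemma stereoK v : sphere v -> v <> x1 -> unstereo (stereo v) = v.
Proof.
move=> sv vx; have h := height_neq1 sv vx.
move/dot_sphere: sv; rewrite -dotQ /dot sum3 => ww0.
transitivity (v *m Q *m Q); last by rewrite -mulmxA QQ mulmx1.
move: h ww0; rewrite /unstereo /stereo; move: (v *m Q) => w h ww.
have d0 : 1 - w 0 i2 != 0 by rewrite subr_eq0 eq_sym.
congr (_ *m Q).
have e : (w 0 i0 / (1 - w 0 i2)) ^+ 2 + (w 0 i1 / (1 - w 0 i2)) ^+ 2 = (1 + w 0 i2) / (1 - w 0 i2).
  have -> : (w 0 i0 / (1 - w 0 i2)) ^+ 2 + (w 0 i1 / (1 - w 0 i2)) ^+ 2 =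
    (w 0 i0 * w 0 i0 + w 0 i1 * w 0 i1) / (1 - w 0 i2) ^+ 2 by field.
  have -> : w 0 i0 * w 0 i0 + w 0 i1 * w 0 i1 = (1 + w 0 i2) * (1 - w 0 i2) by lra.
  by field.
have e1 : (1 + w 0 i2) / (1 - w 0 i2) + 1 = 2 / (1 - w 0 i2) by field.
by apply: rowP3; rewrite !mxE /= e e1; field; rewrite ?d0 ?pnatr_eq0.
Qed.

Lemma row_continuous (X : topologicalType) (f : X -> 'rV[R]_3) (F : set_system X) v : Filter F ->
  (forall j, (fun x => f x 0 j) @ F --> (v 0 j : R)) -> f @ F --> v.
Proof.
move=> FF h A [P hP sPA].
have hj j : F (fun x => P 0 j (f x 0 j)) := h j _ (hP 0 j).
apply: filterS (filterI (filterI (hj i0) (hj i1)) (hj i2)) => x [[h0 h1] h2].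
apply: sPA => i [[|[|[|//]]] k]; rewrite ord1.
- have -> : Ordinal k = i0 by exact: val_inj.
  exact: h0.
- have -> : Ordinal k = i1 by exact: val_inj.
  exact: h1.
have -> : Ordinal k = i2 by exact: val_inj.
exact: h2.
Qed.

Lemma mul_row_continuous (X : topologicalType) (f : X -> 'rV[R]_3) j :
  (forall k, continuous (fun x => f x 0 k)) -> continuous (fun x => (f x *m Q) 0 j).
Proof.
move=> cf; have -> : (fun x => (f x *m Q) 0 j) = fun x => f x 0 i0 * Q i0 j + f x 0 i1 * Q i1 j + f x 0 i2 * Q i2 j.
  by apply/funext => x; rewrite mxE sum3.
by apply: add_c; [apply: add_c|]; (apply: mul_c => //; exact: Kc).
Qed.

Lemma inv_c (X : topologicalType) (f : X -> R) : (forall x, f x != 0) -> continuous f ->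
  continuous (fun x => (f x)^-1).
Proof. by move=> f0 cf x; apply: (@cvgV R) => //; exact: cf. Qed.

Lemma unstereo_continuous : continuous unstereo.
Proof.
have cR := @Re_continuous R; have cI := @Im_continuous R.
have cn : continuous (fun z : C => Re z ^+ 2 + Im z ^+ 2) by apply: add_c; apply: mul_c.
move=> z; apply: (@row_continuous C unstereo (nbhs z) _ (nbhs_filter z)) => j.
move: z; apply: mul_row_continuous => k.
have -> : (fun x : C => (\row_j ([:: 2 * Re x; 2 * Im x; Re x ^+ 2 + Im x ^+ 2 - 1]`_j /
  (Re x ^+ 2 + Im x ^+ 2 + 1)) : 'rV[R]_3) 0 k) =
  fun x => [:: 2 * Re x; 2 * Im x; Re x ^+ 2 + Im x ^+ 2 - 1]`_k * (Re x ^+ 2 + Im x ^+ 2 + 1)^-1.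
  by apply/funext => x; rewrite mxE.
apply: mul_c; last first.
  by apply: inv_c => [x|]; [rewrite gt_eqF // norm_pos|apply: add_c => //; exact: Kc].
have k2 x := @Kc C R 2 x; have k1 x := @Kc C R (- 1) x.
case: k => [[|[|[|//]]] hk].
- exact: (mul_c k2 cR).
- exact: (mul_c k2 cI).
exact: (add_c cn k1).
Qed.

Lemma stereo_continuous (X : topologicalType) (f : X -> 'rV[R]_3) :
  continuous f -> (forall x, sphere (f x) /\ f x <> x1) -> continuous (fun x => stereo (f x)).
Proof.
move=> cf hf; have ck k : continuous (fun x => f x 0 k).
  apply: (comp_continuous (g := fun M : 'rV[R]_3 => M 0 k) cf); exact: coord_continuous.
have cw k := @mul_row_continuous X f k ck.
have cd : continuous (fun x => (1 - (f x *m Q) 0 i2)^-1).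
  apply: inv_c => [x|]; first by rewrite subr_eq0 eq_sym; apply: height_neq1; case: (hf x).
  by apply: add_c; [exact: Kc|exact: opp_c].
by apply: complex_continuous; rewrite /stereo /=; apply: mul_c.
Qed.

End Stereographic.

(** * Unordered pairs of points as sums and products *)

Section Configurations.
Import perm.
Variable R : realType.
Local Notation C := (cplx R).
Local Notation rc := (@rc R).
Local Notation A := (@sum_prod R).

Lemma cvg_initial (S : choiceType) (T : topologicalType) (f : S -> T)
    (F : set_system S) (x : initial_topology f) : Filter F ->
  f @ F --> f x -> F --> x.
Proof.
move=> FF h N; rewrite nbhsE => -[B [[D oD <-] Bx] BN].
by apply: filterS BN _; apply: h; exact: open_nbhs_nbhs.
Qed.

Lemma cvg_set_type (T : topologicalType) (D : set T) (F : set_system (set_type D)) (x : set_type D) :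
  Filter F -> (fun y : set_type D => sval y) @ F --> sval x -> F --> x.
Proof. by move=> FF h; apply: cvg_initial. Qed.

Lemma cvg_ptws (T : topologicalType) (m : nat) (F : set_system {ptws 'I_m -> T})
    (y : {ptws 'I_m -> T}) : Filter F ->
  (forall j, (fun z : {ptws 'I_m -> T} => z j) @ F --> y j) -> F --> y.
Proof. by move=> FF h; apply/cvg_sup => j; apply: cvg_initial. Qed.

Variables x1 x2 : 'rV[R]_3.
Hypothesis sx1 : sphere x1.
Hypothesis sx2 : sphere x2.
Hypothesis x12 : x1 <> x2.
Variable Q : 'M[R]_3.
Hypothesis QQ : Q *m Q = 1%:M.
Hypothesis QT : Q^T = Q.
Hypothesis xQ : x1 *m Q = \row_(j < 3) (j == 2 :> nat)%:R.
Local Notation S := (punctured_sphere x1 x2).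

Lemma punctured_sphereP (v : S) : [/\ sphere (sval v), sval v <> x1 & sval v <> x2].
Proof.
case: v => v /= /set_mem [sv nv]; split=> // e; apply: nv; [by left|by right].
Qed.

(** A coordinate on the sphere with x1 at infinity and x2 at 0. *)
Definition coordinate (v : S) : C := stereo Q (sval v) - stereo Q x2.

Lemma coordinateK (v : S) : sval v = unstereo Q (coordinate v + stereo Q x2).
Proof.
have [sv v1 v2] := punctured_sphereP v.
by rewrite /coordinate subrK (stereoK QQ QT xQ).
Qed.

Lemma coordinate_inj : injective coordinate.
Proof. by move=> v w e; apply: val_inj; rewrite /= !coordinateK e. Qed.

Lemma coordinate_neq0 (v : S) : coordinate v != 0.
Proof.
apply/eqP => e; have [sv v1 v2] := punctured_sphereP v; apply: v2.
by rewrite coordinateK e add0r (stereoK QQ QT xQ) //; exact/nesym.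
Qed.

Lemma coordinate_surj (z : C) : z != 0 -> exists v : S, coordinate v = z.
Proof.
move=> z0; pose p := unstereo Q (z + stereo Q x2).
have hp : (@sphere R `\` [set x1; x2]) p.
  split; first exact: (unstereo_sphere QQ QT).
  case=> e; first exact: (unstereo_neq QQ xQ e).
  move/eqP: z0; apply; have := unstereoK QQ (z + stereo Q x2).
  by rewrite -/p e => /esym/(canRL (addrK _)); rewrite subrr.
exists (exist _ p (mem_set hp)).
by rewrite /coordinate /= /p (unstereoK QQ) addrK.
Qed.

Lemma coordinate_continuous : continuous coordinate.
Proof.
apply: Dc; last exact: Kc.
apply: (stereo_continuous QQ QT xQ); first exact: initial_continuous.
by move=> v; have [] := punctured_sphereP v.
Qed.

Local Notation T := (uconf_space S 2).
Local Notation conf := (conf_space S 2).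
Definition j0 : 'I_2 := @Ordinal 2 0 isT.
Definition j1 : 'I_2 := @Ordinal 2 1 isT.

Definition zeta (c : conf) (j : 'I_2) : C := coordinate (sval c j).
Definition vieta (c : conf) : C * C := (zeta c j0 + zeta c j1, zeta c j0 * zeta c j1).
Definition conf_sum_prod (q : T) : C * C := vieta (repr q).

Lemma ord2P (j : 'I_2) : j = j0 \/ j = j1.
Proof. by case: j => [[|[|//]] h]; [left|right]; exact: val_inj. Qed.

Lemma zeta_neq (c : conf) : zeta c j0 != zeta c j1.
Proof.
case: c => y hy; apply/eqP => /coordinate_inj /=.
by have := set_mem hy; apply.
Qed.

Lemma vieta_in (c : conf) : A (vieta c).
Proof.
split=> /=; first by rewrite mulf_neq0 // coordinate_neq0.
have -> : (rc 4 : C) = 2 * 2 by rewrite rc4; congr (_ * _); apply: eq_complex2 => //=; rewrite addr0.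
rewrite -subr_eq0 (_ : _ - _ = (zeta c j0 - zeta c j1) ^+ 2); last by ring.
by rewrite sqrf_eq0 subr_eq0 zeta_neq.
Qed.

Lemma conf_exists (z w : C) : z != 0 -> w != 0 -> z != w ->
  exists c : conf, zeta c j0 = z /\ zeta c j1 = w.
Proof.
move=> /coordinate_surj[u uz] /coordinate_surj[v vw] zw.
pose y : {ptws 'I_2 -> S} := fun j => if j == j0 then u else v.
have hy : [set y : {ptws 'I_2 -> S} | forall i j, i != j -> y i <> y j] y.
  have uv : u <> v by move=> e; move: zw; rewrite -uz -vw e eqxx.
  move=> i j; rewrite /y; have [->|->] := ord2P i; have [->|->] := ord2P j => //= _.
  exact/nesym.
by exists (exist _ y (mem_set hy)).
Qed.

(** Two numbers are the roots of a quadratic polynomial, hence determined up to order by their sum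
    and product. *)
Lemma orbit_roots (c c' : conf) :
  \pi_T c = \pi_T c' <-> vieta c = vieta c'.
Proof.
split=> [/eqmodP/asboolP[s hs]|e0].
  have hz j : zeta c' j = zeta c (s j) by rewrite /zeta hs.
  rewrite /vieta !hz; have [e0|e0] := ord2P (s j0); have [e1|e1] := ord2P (s j1); rewrite e0 e1 //.
  - by have /perm_inj : s j0 = s j1 by rewrite e0 e1.
  - by rewrite addrC mulrC.
  by have /perm_inj : s j0 = s j1 by rewrite e0 e1.
have hs : zeta c j0 + zeta c j1 = zeta c' j0 + zeta c' j1 := congr1 fst e0.
have hp : zeta c j0 * zeta c j1 = zeta c' j0 * zeta c' j1 := congr1 snd e0.
apply/eqmodP/asboolP.
have : (zeta c' j0 - zeta c j0) * (zeta c' j0 - zeta c j1) = 0.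
  have -> : (zeta c' j0 - zeta c j0) * (zeta c' j0 - zeta c j1) =
    zeta c' j0 ^+ 2 - (zeta c j0 + zeta c j1) * zeta c' j0 + zeta c j0 * zeta c j1 by ring.
  by rewrite hs hp; ring.
move/eqP; rewrite mulf_eq0 !subr_eq0 => /orP[]/eqP e.
  have e1 : zeta c' j1 = zeta c j1 by apply: (addrI (zeta c' j0)); rewrite -hs e.
  by exists 1%g => j; rewrite perm1; apply: coordinate_inj; have [->|->] := ord2P j.
have e1 : zeta c' j1 = zeta c j0 by apply: (addrI (zeta c' j0)); rewrite -hs e addrC.
exists (tperm j0 j1) => j; apply: coordinate_inj.
by have [->|->] := ord2P j; rewrite ?tpermL ?tpermR.
Qed.

Lemma conf_sum_prodE (c : conf) : conf_sum_prod (\pi_T c) = vieta c.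
Proof. by apply/orbit_roots; rewrite reprK. Qed.

Lemma proj_continuous (j : 'I_2) : continuous (fun c : conf => sval c j).
Proof.
apply: (comp_continuous (f := fun c : conf => sval c) (g := fun y : {ptws 'I_2 -> S} => y j)).
  exact: initial_continuous.
exact: proj_continuous.
Qed.

Lemma vieta_continuous : continuous vieta.
Proof.
have cz j : continuous (fun c => zeta c j).
  exact: (comp_continuous (g := coordinate) (@proj_continuous j) coordinate_continuous).
by apply: pair_continuous; [exact: Dc|exact: Mc].
Qed.

Lemma conf_sum_prod_continuous : continuous conf_sum_prod.
Proof.
apply: repr_comp_continuous; first exact: vieta_continuous.
by move=> a b /eqP/orbit_roots ->.
Qed.

Lemma cvg_conf (X : topologicalType) (F : set_system X) (c : X -> conf) (c0 : conf) : Filter F ->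
  (forall j, (fun x => zeta (c x) j) @ F --> zeta c0 j) -> c @ F --> c0.
Proof.
move=> FF h; apply: cvg_set_type; apply: cvg_ptws => j; apply: cvg_set_type.
rewrite coordinateK.
have hc : (fun z : C => unstereo Q (z + stereo Q x2)) @ (zeta c0 j) --> unstereo Q (zeta c0 j + stereo Q x2).
  apply: (comp_continuous (f := fun z : C => z + stereo Q x2)); last exact: unstereo_continuous.
  by apply: Dc; [exact: id_continuous|exact: Kc].
move=> N hN; change (F (fun x => N (sval (sval (c x) j)))).
have hF : F (fun x => N (unstereo Q (zeta (c x) j + stereo Q x2))) := h j _ (hc N hN).
by apply: filterS hF => x; rewrite -coordinateK.
Qed.

(** The right side is the norm of (z0 - z)(z0 - w) for the roots z and w; the root nearer to z0 is
    listed first. *)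
Lemma conf_near (p : C * C) (z0 : C) : A p -> exists c : conf,
  vieta c = p /\ `|z0 - zeta c j0| ^+ 2 <= `|z0 ^+ 2 - p.1 * z0 + p.2|.
Proof.
move=> [p0 dp].
have rc2 : rc 2 = 2 :> C by apply: eq_complex2 => //=; rewrite addr0.
have rc4E : rc 4 = 2 * 2 :> C by rewrite rc4 rc2.
have two0 : (2 : C) != 0 by rewrite -rc2 rc_neq0 pnatr_eq0.
pose d : C := sqrtc (p.1 ^+ 2 - rc 4 * p.2).
have dd : d ^+ 2 = p.1 ^+ 2 - rc 4 * p.2 by exact: sqr_sqrtc.
have d0 : d != 0 by rewrite -sqrf_eq0 dd subr_eq0.
pose z := (p.1 + d) / 2; pose w := (p.1 - d) / 2.
have zw : z + w = p.1 by rewrite /z /w; field.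
have zwp : z * w = p.2.
  have -> : z * w = (p.1 ^+ 2 - d ^+ 2) / (2 * 2) by rewrite /z /w; field.
  by rewrite dd rc4E opprB addrC subrK mulrC mulKf // mulf_neq0.
have [z_0 w_0] : z != 0 /\ w != 0.
  by move: p0; rewrite -zwp mulf_eq0 negb_or => /andP.
have zwn : z != w.
  by rewrite -subr_eq0 (_ : z - w = d) //; rewrite /z /w; field.
have qE : z0 ^+ 2 - p.1 * z0 + p.2 = (z0 - z) * (z0 - w) by rewrite -zw -zwp; ring.
have nE (x y : C) : (`|x| <= `|y|) || (`|y| <= `|x|) by rewrite !normE !lerc le_total.
rewrite qE normrM.
have /orP[h|h] := nE (z0 - z) (z0 - w).
  have [c [cz cw]] := conf_exists z_0 w_0 zwn; exists c; split.
    by rewrite /vieta cz cw zw zwp -surjective_pairing.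
  by rewrite cz expr2 ler_wpM2l.
have [|c [cz cw]] := conf_exists w_0 z_0; first by rewrite eq_sym.
exists c; split; first by rewrite /vieta cz cw addrC mulrC zw zwp -surjective_pairing.
by rewrite cz expr2 ler_wpM2r.
Qed.

(** Vieta's map is a homeomorphism. Its inverse is continuous because roots depend continuously on
    the coefficients. *)
Lemma conf_homeo (b : T) : exists (P : T -> C * C) (P' : C * C -> T),
  [/\ continuous_on [set: T] A P, continuous_on A [set: T] P',
      forall q, P' (P q) = q & forall p, A p -> P (P' p) = p].
Proof.
(* The base point b is only a default value outside the image of [vieta]. *)
have ex p : exists q : T, forall c : conf, vieta c = p -> q = \pi_T c.
  have [[c cp]|no] := pselect (exists c : conf, vieta c = p).
    by exists (\pi_T c) => c' c'p; apply/orbit_roots; rewrite cp c'p.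
  by exists b => c' c'p; case: no; exists c'.
have [P' hP'] := choice ex.
have P'E c : P' (vieta c) = \pi_T c by apply: hP'.
have pi_cts : continuous (\pi_T : conf -> T) by exact: pi_continuous.
exists conf_sum_prod, P'; split.
- split=> [q _|X u cu _]; first exact: vieta_in.
  by apply: (comp_continuous cu); exact: conf_sum_prod_continuous.
- split=> // X u cu Au x0.
  have [c0 [c0u _]] := conf_near 0 (Au x0).
  pose z0 := zeta c0 j0; pose w0 := zeta c0 j1.
  have [c hc] := choice (fun x => conf_near z0 (Au x)).
  have uc x : u x = vieta (c x) by case: (hc x).
  have -> : (fun x => P' (u x)) = (fun x => \pi_T (c x)) by apply/funext => x; rewrite uc P'E.
  have q0 : z0 ^+ 2 - (u x0).1 * z0 + (u x0).2 = 0 by rewrite -c0u /= -/z0 -/w0; ring.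
  have cu1 : continuous (fun x => (u x).1) by apply: (comp_continuous cu); exact: fst_c.
  have cu2 : continuous (fun x => (u x).2) by apply: (comp_continuous cu); exact: snd_c.
  have cq : continuous (fun x => z0 ^+ 2 - (u x).1 * z0 + (u x).2).
    exact: (Dc (Dc (fun x => @Kc X C (z0 ^+ 2) x) (Nc (Mc cu1 (fun x => @Kc X C z0 x)))) cu2).
  have h0 : (fun x => zeta (c x) j0) @ x0 --> z0.
    (* The polynomial at [u x], evaluated at the limit root z0, tends to 0, and by [conf_near] it
       bounds the squared distance from z0 to the chosen root. *)
    apply/cvgrPdist_lt => e e0.
    have e2 : 0 < e ^+ 2 by rewrite exprn_gt0.
    have := cq x0; rewrite /continuous_at q0 => /cvgrPdist_lt/(_ _ e2) hq.
    apply: filterS hq => x; rewrite sub0r normrN => hx.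
    have [_ hle] := hc x; have := le_lt_trans hle hx.
    by rewrite ltr_pXn2r // nnegrE ?normr_ge0 // ltW.
  have h1 : (fun x => zeta (c x) j1) @ x0 --> w0.
    have -> : (fun x => zeta (c x) j1) = fun x => (u x).1 - zeta (c x) j0.
      by apply/funext => x; rewrite uc /= addrC addKr.
    have -> : w0 = (u x0).1 - z0 by rewrite -c0u /= addrC addKr.
    exact: (cvgB (cu1 x0) h0).
  have hc0 : \pi_T (c x0) = \pi_T c0 by apply/orbit_roots; rewrite -uc c0u.
  rewrite /continuous_at hc0.
  have hc1 : c @ x0 --> c0.
    apply: (cvg_conf (nbhs_filter x0)) => j; have [->|->] := ord2P j; [exact: h0|exact: h1].
  by move=> N hN; exact: hc1 _ (pi_cts c0 N hN).
- by move=> q; rewrite /conf_sum_prod P'E reprK.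
move=> p Ap; have [c [<- _]] := conf_near 0 Ap.
by rewrite P'E conf_sum_prodE.
Qed.

End Configurations.

Theorem theorem15 (R : realType) (x1 x2 : 'rV[R]_3)
    (hx1 : sphere x1) (hx2 : sphere x2) (hx : x1 <> x2)
    (b : uconf_space (punctured_sphere x1 x2) 2) (i : nat) (hi : (2 <= i)%N) :
  let B := braid_group R 2 b in
  [/\ isomorphic (subgroup_type (Gamma B i))
                 (subgroup_type (Gamma Z2_star_Z i)),
      isomorphic (Gamma_quotient B i) (Gamma_quotient Z2_star_Z i) &
      exists r : nat,
        r%:R = rank_R i /\
        isomorphic (Gamma_quotient Z2_star_Z i) (Z2_power r)].
Proof.
move=> B.
have [Q [QQ QT xQ]] : exists Q : 'M[R]_3, [/\ Q *m Q = 1%:M, Q^T = Q &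
    x1 *m Q = \row_(j < 3) (j == 2 :> nat)%:R].
  apply: reflection_exists; first exact/dot_sphere.
  by rewrite /dot sum3 !mxE /= mulr0 mulr1 !add0r.
have [P [P' [cP cP' PK P'K]]] := conf_homeo hx2 hx QQ QT xQ b.
(* Loops at b are carried by the homeomorphism to loops in [sum_prod], so the braid group is the
   fundamental group there. *)
have lm := loop_model_map cP cP' (fun x _ => PK x) P'K I (pi1_loop_model R b).
have Ab : sum_prod (P b) by exact: (proj1 cP).
have conn c : sum_prod c -> exists f : R -> cplx R * cplx R,
    [/\ is_path (@sum_prod R) f, f 0 = P b & f 1 = c].
  move=> Ac; have [f [hf f0 f1]] := connected_sum_prod Ab.
  have [g [hg g0 g1]] := connected_sum_prod Ac.
  exists (pcat (prev f) g); split; last by rewrite pcat1.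
    by apply: pcat_path => //; [exact: prev_path|rewrite prev1 f0 g0].
  by rewrite pcat0 prev0.
have [W mW] := pi1_model_of_loops lm Ab conn.
have [f [fsurj finj]] := sum_prod_group mW.
split; last exact: Z2_star_Z_quotient.
- exact: (Gamma_isomorphic fsurj finj).
exact: (Gamma_quotient_isomorphic fsurj finj).
Qed.
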